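(* Let $\Phi$ be a nonconstant entire function of subexponential type, and let $T=\Phi(D)$ be the associated convolution operator on $\mathcal{H}(\mathbb{C})$. Then there exists an infinitely generated multiplicative group $\mathcal{G}\subset\mathcal{H}(\mathbb{C})$ (under pointwise multiplication) such that every member of $\mathcal{G}$, except for the constant function $\mathbf{1}$, is $\Phi(D)$-hypercyclic. Moreover, $\mathcal{G}$ is a dense subgroup of $e^{\mathcal{H}(\mathbb{C})}_{+,0}$, and the algebra generated by $\mathcal{G}$ is infinitely generated.
   Context: $\mathcal{H}(\mathbb{C})$ is the vector space of entire functions $\mathbb{C}\to\mathbb{C}$, endowed with the topology of uniform convergence on compact subsets of $\mathbb{C}$ (an F-space, i.e. a complete metrizable topological vector space); it is an algebra under pointwise multiplication. $\mathbf{1}$ denotes the constant function $\mathbf{1}(z)=1$. An entire function $\Phi$ has subexponential type if for every $\varepsilon>0$ there is $A=A(\varepsilon)\in(0,+\infty)$ such that $|\Phi(z)|\le A e^{\varepsilon|z|}$ for all $z\in\mathbb{C}$. For such $\Phi(z)=\sum_{n\ge 0}a_nz^n$, the operator $\Phi(D)$ is the continuous linear operator on $\mathcal{H}(\mathbb{C})$ given by $\Phi(D)f=\sum_{n=0}^\infty a_nf^{(n)}$. A function $f$ is $T$-hypercyclic, for a continuous linear operator $T$ on $\mathcal{H}(\mathbb{C})$, if its orbit $\{T^nf:n\in\mathbb{N}\}$, $\mathbb{N}=\{1,2,\dots\}$, is dense in $\mathcal{H}(\mathbb{C})$. $e^{\mathcal{H}(\mathbb{C})}=\{e^g:g\in\mathcal{H}(\mathbb{C})\}$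 is the set of entire functions without zeros, and $e^{\mathcal{H}(\mathbb{C})}_{+,0}:=\{f\in e^{\mathcal{H}(\mathbb{C})}: f(0)>0\}$ (meaning $f(0)$ is real and positive); it is a topological group under pointwise multiplication with the topology inherited from $\mathcal{H}(\mathbb{C})$. ''Infinitely generated'' means not finitely generated (as a group, respectively as an algebra). The algebra generated by $\mathcal{G}$ is the smallest (complex, linear) subalgebra of $\mathcal{H}(\mathbb{C})$ containing $\mathcal{G}$. *)

(* Defs.v *)
From mathcomp Require Import all_boot all_order all_algebra.
From mathcomp Require Import all_classical all_reals all_analysis.
From mathcomp Require Import complex.

Set Implicit Arguments.
Unset Strict Implicit.
Unset Printing Implicit Defensive.

Import Order.TTheory GRing.Theory Num.Theory numFieldNormedType.Exports.

Local Open Scope classical_set_scope.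
Local Open Scope ring_scope.
Local Open Scope complex_scope.

(* The regular module [R[i]^o] (rather than [R[i]]) carries the topology and
   the normed module structure over the field [R[i]]; differentiating a
   function [CC R -> CC R] is therefore complex differentiation. *)
Notation CC R := ((R[i])^o).

(* H(C).  Its topology is that of [{family compact, CC R -> CC R}]. *)
Definition entire (R : realType) : set (CC R -> CC R) :=
  [set f | forall z : CC R, derivable f z 1].

Definition cexp (R : realType) (z : CC R) : CC R :=
  (expR (complex.Re z) * cos (complex.Im z)) +i*
  (expR (complex.Re z) * sin (complex.Im z)).

(* [normc] is the modulus with values in R; the norm [`|_|] of R[i] takes its
   values in R[i]. *)
Definition cmod (R : realType) (z : CC R) : R := ComplexField.Normc.normc z.

Definition subexponential_type (R : realType) (Phi : CC R -> CC R) : Prop :=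
  forall eps : R, 0 < eps ->
  exists2 A : R, 0 < A &
    forall z : CC R, cmod (Phi z) <= A * expR (eps * cmod z).

Definition taylor_coef (R : realType) (Phi : CC R -> CC R) (n : nat) : R[i] :=
  derive1n n Phi 0 / n`!%:R.

(* Phi(D) f: the limit in H(C) of the partial sums of sum_n a_n f^(n).  The
   library's [lim] is not available on [{family compact, _ -> _}], which has
   no pointed structure, so its definition through [get] is written out. *)
Definition conv_op (R : realType) (Phi f : CC R -> CC R) : CC R -> CC R :=
  get [set g : CC R -> CC R |
    {family compact,
      series (fun n => taylor_coef Phi n *: (derive1n n f : CC R -> CC R)) @ \oo
      --> g}].

(* Density in the subspace X for the topology of compact convergence. *)
Definition dense_in (R : realType) (X A : set (CC R -> CC R)) : Prop :=
  X `<=` closure (A : set {family compact, CC R -> CC R}).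

(* The orbit starts at T f, as the powers are indexed by {1, 2, ...}. *)
Definition orbit_pos (R : realType) (T : (CC R -> CC R) -> (CC R -> CC R))
    (f : CC R -> CC R) : set (CC R -> CC R) :=
  [set g | exists2 n : nat, (0 < n)%N & g = iter n T f].

Definition hypercyclic (R : realType) (T : (CC R -> CC R) -> (CC R -> CC R))
    (f : CC R -> CC R) : Prop :=
  entire f /\ dense_in (@entire R) (orbit_pos T f).

Definition expH (R : realType) : set (CC R -> CC R) :=
  [set f | exists2 g, entire g & f = @cexp R \o g].

(* In [R[i]], [0 < w] means that w is real and positive. *)
Definition expH_pos0 (R : realType) : set (CC R -> CC R) :=
  [set f | expH f /\ 0 < f 0].

Definition mul_group (R : realType) (G : set (CC R -> CC R)) : Prop :=
  [/\ G (cst 1),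
      forall f g, G f -> G g -> G (f * g) &
      forall f, G f -> exists2 g, G g & f * g = cst 1].

Definition group_fg (R : realType) (G : set (CC R -> CC R)) : Prop :=
  exists S : set (CC R -> CC R),
    [/\ finite_set S, S `<=` G & G = smallest (@mul_group R) S].

(* Linear subalgebras of H(C), not required to contain the constants. *)
Definition subalgebra (R : realType) (A : set (CC R -> CC R)) : Prop :=
  [/\ A `<=` @entire R,
      A 0,
      forall (c : R[i]) f g, A f -> A g -> A (c *: f + g) &
      forall f g, A f -> A g -> A (f * g)].

Definition gen_algebra (R : realType) (S : set (CC R -> CC R)) :
    set (CC R -> CC R) :=
  smallest (@subalgebra R) S.

Definition algebra_fg (R : realType) (A : set (CC R -> CC R)) : Prop :=
  exists S : set (CC R -> CC R),
    [/\ finite_set S, S `<=` A & A = gen_algebra S].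

(* Main.v *)
Require Import Defs.
From mathcomp Require Import all_boot all_order all_algebra.
From mathcomp Require Import all_classical all_reals all_analysis.
From mathcomp Require Import complex ring lra.

Set Implicit Arguments.
Unset Strict Implicit.
Unset Printing Implicit Defensive.

Import Order.TTheory GRing.Theory Num.Theory numFieldNormedType.Exports.
Import ComplexField.Normc.

Local Open Scope classical_set_scope.
Local Open Scope ring_scope.
Local Open Scope complex_scope.

(** Why the theorem is true.

    Write [T] for Phi(D), and look for the generators of the group in the form
    f i = e^(g i) with g i entire and real at 0.  The elements of the group
    are then the e^(comb m g), where comb m g is the combination of the g i
    with the integer exponents m`_i.  The sequence g is found by a Baire
    category argument ([baire]) in the product of countably many copies of the
    space of such logarithms; each of the following conditions holds on a set
    with dense interior.

    - Hypercyclicity ([fat_hypercyclic]): for m <> 0, some iterate of [T] maps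
      e^(comb m g) close to a given function on a given disc.
    - Density ([fat_dense]): some g j is close to a given function that is
      real at 0, which is immediate since a neighbourhood in the product
      constrains finitely many g j only.
    - Growth ([fat_growth]): somewhere, Re (g K) is much larger than the
      moduli of g 0, ..., g (K - 1).

    The first condition makes every element other than 1 hypercyclic, and the
    second makes the group dense, exp being continuous.  The third shows that
    e^(g K) does not belong to the algebra of functions whose growth is at most
    that of the exponentials of combinations of g 0, ..., g (K - 1)
    ([growth_class_out]).  A finite set of elements of the group, or of the
    algebra that it generates, lies in such an algebra for some K; hence
    neither is finitely generated.

    The hypercyclicity condition rests on a transitivity statement within the
    zero-free functions ([zero_free_transitive]).  Exponential sums with
    frequencies in |Phi| < 1, and those with frequencies in |Phi| > 1, are
    dense; since T e^(l z) = Phi(l) e^(l z), Godefroy and Shapiro's argument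
    ([conv_transitive]) yields an entire p close to e^G with T^n p close to a
    given target.  On a disc, p = e^G (1 + u) with u small, and 1 + u is the
    uniform limit of e^(L_k(u)), where L_k is the Taylor polynomial of
    log(1 + u) ([exp_logpoly]).  Now n is fixed and the subexponential type of
    Phi makes T^n continuous from the sup norm on any larger disc
    ([iter_conv_bound]), so the zero-free e^(G + L_k(u)) has for large k the
    same approximation property as p.

    The complex analysis behind this starts from complex differentiability
    alone.  Goursat's theorem gives primitives ([primitive_exists]).  For a
    function with continuous derivative, sums over roots of unity play the
    role of contour integrals and exhibit it as a limit of power series with
    common Cauchy bounds ([cauchy_pser]); such limits are power series
    ([pser_limit]), and the latter fact also contains Weierstrass's theorem
    ([holo_limit]).  Everything is quantitative, in terms of the real modulus
    [normc] and of explicit epsilons; the topologies of the statement only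
    enter through [cder_cvg], [fam_compact_cvg], [fam_cvg_pointwise] and
    [closure_compact]. *)

(** * The modulus *)

Section Modulus.
Variable R : realType.
Local Notation C := R[i].
Implicit Types (z w h : C) (f g : C -> C).

Lemma normc_ge0 z : 0 <= normc z.
Proof. by case: z => a b /=; rewrite sqrtr_ge0. Qed.

Lemma normcD z w : normc (z + w) <= normc z + normc w.
Proof. exact: le_normcD. Qed.

Lemma normc_opp z : normc (- z) = normc z.
Proof. exact: normcN. Qed.

Lemma normcB z w : normc (z - w) <= normc z + normc w.
Proof. by rewrite -(normc_opp w) normcD. Qed.

Lemma normc_distC z w : normc (z - w) = normc (w - z).
Proof. by rewrite -normc_opp opprB. Qed.

Lemma normc_split y z w : normc (z - w) <= normc (z - y) + normc (y - w).
Proof. by rewrite (le_trans _ (normcD _ _)) // addrA subrK. Qed.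

Lemma normcX z n : normc (z ^+ n) = normc z ^+ n.
Proof. by elim: n => [|n IH]; rewrite ?expr0 ?normc1 // !exprS normcM IH. Qed.

Lemma normc_real (x : R) : normc x%:C = `|x|.
Proof. by rewrite /= expr0n addr0 sqrtr_sqr. Qed.

Lemma normc_gt0 z : (0 < normc z) = (z != 0).
Proof.
rewrite lt0r normc_ge0 andbT; congr (~~ _).
by apply/eqP/eqP => [/eq0_normc //|->]; rewrite normc0.
Qed.

Lemma normc_Re z : `|complex.Re z| <= normc z.
Proof. by case: z => a b /=; rewrite -sqrtr_sqr ler_wsqrtr // lerDl sqr_ge0. Qed.

Lemma normc_Im z : `|complex.Im z| <= normc z.
Proof. by case: z => a b /=; rewrite -sqrtr_sqr ler_wsqrtr // lerDr sqr_ge0. Qed.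

Lemma normc_le_ReIm z : normc z <= `|complex.Re z| + `|complex.Im z|.
Proof.
case: z => a b /=; rewrite -[leRHS]ger0_norm ?addr_ge0 // -sqrtr_sqr.
rewrite ler_wsqrtr // sqrrD !real_normK ?num_real // -addrA lerD2l lerDr.
by rewrite mulrn_wge0 // mulr_ge0.
Qed.

Lemma normc_sum (I : Type) (s : seq I) (F : I -> C) :
  normc (\sum_(i <- s) F i) <= \sum_(i <- s) normc (F i).
Proof.
elim: s => [|i s IH]; rewrite ?big_nil ?normc0 // !big_cons.
by rewrite (le_trans (normcD _ _)) // lerD2l.
Qed.

Lemma normc_sum_le n (F : nat -> C) (b : nat -> R) :
  (forall i, (i < n)%N -> normc (F i) <= b i) ->
  normc (\sum_(i < n) F i) <= \sum_(i < n) b i.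
Proof.
move=> h; rewrite (le_trans (normc_sum _ _)) //.
by apply: ler_sum => i _; apply: h.
Qed.

Lemma normc_mean_le n (F : nat -> C) (b : R) :
  (forall i, (i < n)%N -> normc (F i) <= b) ->
  normc (\sum_(i < n) F i) <= n%:R * b.
Proof.
move=> h; rewrite (le_trans (normc_sum_le (b := fun=> b) h)) //.
by rewrite sumr_const card_ord mulr_natl.
Qed.

Lemma normc_nat n : normc (n%:R : C) = n%:R.
Proof. by rewrite -(rmorph_nat (real_complex R)) normc_real ger0_norm. Qed.

Lemma normc_le_eq0 z : (forall e : R, 0 < e -> normc z <= e) -> z = 0.
Proof.
move=> h; apply/eqP; apply/negPn/negP; rewrite -normc_gt0 => z0.
by have := h _ (divr_gt0 z0 (ltr0Sn R 1)); lra.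
Qed.

End Modulus.

(** * Complex derivatives *)

Section Derivative.
Variable R : realType.
Local Notation C := R[i].
Implicit Types (z w h L : C) (f g : C -> C).

Definition cctn f z := forall e : R, 0 < e ->
  exists2 d, 0 < d & forall h, normc h < d -> normc (f (z + h) - f z) <= e.

Lemma cctn_cst c z : cctn (fun=> c) z.
Proof.
by move=> e e0; exists 1 => // h _; rewrite subrr normc0 ltW.
Qed.

Lemma cctn_id z : cctn id z.
Proof.
by move=> e e0; exists e => // h /ltW; rewrite addrC addKr.
Qed.

Lemma cctnD f g z : cctn f z -> cctn g z -> cctn (fun x => f x + g x) z.
Proof.
move=> cf cg e e0; have e2 : 0 < e / 2 by rewrite divr_gt0.
have [d1 d10 h1] := cf _ e2; have [d2 d20 h2] := cg _ e2.
exists (Num.min d1 d2); first by rewrite lt_min d10.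
move=> h; rewrite lt_min => /andP[/h1 k1 /h2 k2].
rewrite opprD addrACA (le_trans (normcD _ _)) // (splitr e).
exact: lerD.
Qed.

Lemma cctnM f g z : cctn f z -> cctn g z -> cctn (fun x => f x * g x) z.
Proof.
move=> cf cg e e0.
pose K := normc (f z) + normc (g z) + 1.
have K1 : 1 <= K by rewrite lerDr addr_ge0 ?normc_ge0.
have K0 : 0 < K by rewrite (lt_le_trans ltr01).
pose e1 := Num.min 1 (e / (2 * K)).
have e10 : 0 < e1 by rewrite lt_min ltr01 divr_gt0 ?mulr_gt0.
have [d1 d10 h1] := cf _ e10; have [d2 d20 h2] := cg _ e10.
exists (Num.min d1 d2); first by rewrite lt_min d10.
move=> h; rewrite lt_min => /andP[/h1 k1 /h2 k2].
have -> : f (z + h) * g (z + h) - f z * g z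
  = (f (z + h) - f z) * (g (z + h) - g z) + f z * (g (z + h) - g z)
    + (f (z + h) - f z) * g z by ring.
rewrite (le_trans (normcD _ _)) // (@le_trans _ _ (e1 * K)) //; last first.
  have : e1 <= e / (2 * K) by rewrite ge_min lexx orbT.
  rewrite -(ler_pM2r K0) => /le_trans -> //.
  rewrite invfM mulrA mulfVK ?gt_eqF //; lra.
rewrite (@le_trans _ _ (e1 * 1 + normc (f z) * e1 + e1 * normc (g z))) //; last first.
  by rewrite /K; lra.
rewrite lerD // ?(le_trans (normcD _ _)) // ?lerD // normcM.
- apply: ler_pM; rewrite ?normc_ge0 //.
  by apply: (le_trans k2); rewrite ge_min lexx.
- by rewrite ler_wpM2l ?normc_ge0.
- by rewrite ler_wpM2r ?normc_ge0.
Qed.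

Lemma cctn_comp f g z : cctn g z -> cctn f (g z) -> cctn (fun x => f (g x)) z.
Proof.
move=> cg cf e e0; have [d d0 h1] := cf _ e0.
have [d' d'0 h2] := cg _ (divr_gt0 d0 (ltr0Sn R 1)).
exists d' => // h /h2 k.
have -> : g (z + h) = g z + (g (z + h) - g z) by ring.
by apply: h1; apply: (le_lt_trans k); lra.
Qed.

Lemma cctnV z : z != 0 -> cctn (fun x => x^-1) z.
Proof.
rewrite -normc_gt0 => z0 e e0.
exists (Num.min (normc z / 2) (e * normc z ^+ 2 / 2)).
  by rewrite lt_min !divr_gt0 // mulr_gt0 // exprn_gt0.
move=> h; rewrite lt_min => /andP[h1 h2].
have h3 : normc z / 2 <= normc (z + h).
  have := normcB (z + h) h; rewrite addrK; lra.
have zh : 0 < normc (z + h) by lra.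
have -> : (z + h)^-1 - z^-1 = - h / (z * (z + h)).
  by field; rewrite -!normc_gt0 zh z0.
rewrite normcM normcV normcM normc_opp ler_pdivrMr ?mulr_gt0 //.
apply: (le_trans (ltW h2)); rewrite -mulrA ler_wpM2l ?(ltW e0) //.
by rewrite expr2 -mulrA ler_wpM2l ?(ltW z0).
Qed.

(** Carathéodory's form of differentiability: the difference quotient,
    completed by the derivative at 0, is continuous.  All the rules of
    calculus then reduce to the continuity of sums, products and composites. *)
Definition cder f z L :=
  exists2 q : C -> C, (forall h, f (z + h) = f z + h * q h) & q 0 = L /\ cctn q 0.

Lemma cderP f z L : cder f z L <-> forall e : R, 0 < e ->
  exists2 d, 0 < d & forall h, normc h < d ->
    normc (f (z + h) - f z - h * L) <= e * normc h.
Proof.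
split=> [[q fq [q0 cq]] e e0|H].
  have [d d0 hd] := cq _ e0; exists d => // h /hd.
  rewrite add0r q0 => k; rewrite fq.
  have -> : f z + h * q h - f z - h * L = h * (q h - L) by ring.
  by rewrite normcM mulrC ler_wpM2r ?normc_ge0.
exists (fun h => if h == 0 then L else (f (z + h) - f z) / h).
  move=> h; case: eqVneq => [->|h0]; first by rewrite addr0 mul0r addr0.
  by field.
split; first by rewrite eqxx.
move=> e e0; have [d d0 hd] := H _ e0; exists d => // h /hd.
rewrite add0r eqxx; case: eqVneq => [_ _|h0]; first by rewrite subrr normc0 ltW.
have -> : f (z + h) - f z - h * L = ((f (z + h) - f z) / h - L) * h by field.
by rewrite normcM ler_pM2r ?normc_gt0.
Qed.

Lemma cder_cctn f z L : cder f z L -> cctn f z.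
Proof.
move=> [q fq [q0 cq]] e e0.
have [d d0 hd] := cctnM (@cctn_id 0) cq e0; exists d => // h /hd.
by rewrite mul0r subr0 add0r fq addrC addKr.
Qed.

Lemma cder_unique f z L L' : cder f z L -> cder f z L' -> L = L'.
Proof.
move=> /cderP d1 /cderP d2; apply/eqP; rewrite -subr_eq0; apply/eqP.
apply: normc_le_eq0 => e e0; have e2 : 0 < e / 2 by rewrite divr_gt0.
have [a a0 h1] := d1 _ e2; have [b b0 h2] := d2 _ e2.
pose t := Num.min a b / 2; have t0 : 0 < t by rewrite divr_gt0 // lt_min a0.
have tt : normc t%:C = t by rewrite normc_real gtr0_norm.
have ta : normc t%:C < a by rewrite tt /t /Num.min; case: ifP; lra.
have tb : normc t%:C < b by rewrite tt /t /Num.min; case: ifP; lra.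
rewrite -(ler_pM2l t0) -[X in X * normc _]tt -normcM.
have -> : t%:C * (L - L') = (f (z + t%:C) - f z - t%:C * L')
  - (f (z + t%:C) - f z - t%:C * L) by ring.
have := h1 _ ta; have := h2 _ tb; rewrite tt => k1 k2.
rewrite (le_trans (normcB _ _)) //; lra.
Qed.

Lemma cder_cst c z : cder (fun=> c) z 0.
Proof.
exists (fun=> 0); first by move=> h; rewrite mulr0 addr0.
by split => //; apply: cctn_cst.
Qed.

Lemma cder_id z : cder id z 1.
Proof.
exists (fun=> 1); first by move=> h; rewrite mulr1.
by split => //; apply: cctn_cst.
Qed.

Lemma cderD f g z L L' : cder f z L -> cder g z L' ->
  cder (fun x => f x + g x) z (L + L').
Proof.
move=> [q fq [q0 cq]] [p gp [p0 cp]]; exists (fun x => q x + p x).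
  by move=> h; rewrite fq gp; ring.
by rewrite q0 p0; split => //; apply: cctnD.
Qed.

Lemma cderM f g z L L' : cder f z L -> cder g z L' ->
  cder (fun x => f x * g x) z (L * g z + f z * L').
Proof.
move=> [q fq [q0 cq]] [p gp [p0 cp]].
exists (fun x => q x * g z + f z * p x + x * (q x * p x)).
  by move=> h; rewrite fq gp; ring.
rewrite mul0r addr0 q0 p0; split => //.
have cc c := @cctn_cst c 0.
by apply: cctnD; [apply: cctnD|]; do ![exact: cctn_id|apply: cctnM|exact: cc].
Qed.

Lemma cder_comp f g z L L' : cder g z L -> cder f (g z) L' ->
  cder (fun x => f (g x)) z (L * L').
Proof.
move=> [q gq [q0 cq]] [p fp [p0 cp]].
exists (fun x => q x * p (x * q x)).
  by move=> h; rewrite gq fp mulrA.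
rewrite mul0r q0 p0; split => //; apply: cctnM => //.
apply: (@cctn_comp p (fun x => x * q x)); first by apply: cctnM => //; exact: cctn_id.
by rewrite mul0r.
Qed.

Lemma cderV z : z != 0 -> cder (fun x => x^-1) z (- (z ^+ 2)^-1).
Proof.
move=> z0; apply/cderP => e e0.
have [d d0 hd] := cctnV z0 (mulr_gt0 e0 (etrans (normc_gt0 z) z0)).
exists (Num.min d (normc z)); first by rewrite lt_min d0 normc_gt0.
move=> h; rewrite lt_min => /andP[/hd k hz].
have zh : z + h != 0.
  apply: contraTneq hz => /eqP; rewrite addr_eq0 => /eqP ->.
  by rewrite normc_opp ltxx.
have -> : (z + h)^-1 - z^-1 - h * (- (z ^+ 2)^-1)
   = - (h * (((z + h)^-1 - z^-1) / z)) by field; rewrite z0 zh.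
rewrite normc_opp normcM mulrC ler_wpM2r ?normc_ge0 // normcM normcV.
by rewrite ler_pdivrMr ?normc_gt0.
Qed.

Lemma cder_eq f g z L L' : f =1 g -> L = L' -> cder f z L -> cder g z L'.
Proof. by move=> /funext -> ->. Qed.

Lemma cderZ c f z L : cder f z L -> cder (fun x => c * f x) z (c * L).
Proof.
move=> df; apply: cder_eq (cderM (cder_cst c z) df) => //.
by rewrite mul0r add0r.
Qed.

Lemma cderN f z L : cder f z L -> cder (fun x => - f x) z (- L).
Proof.
move=> /(cderZ (-1)); apply: cder_eq => [x|]; by rewrite mulN1r.
Qed.

Lemma cderB f g z L L' : cder f z L -> cder g z L' ->
  cder (fun x => f x - g x) z (L - L').
Proof. by move=> df /cderN; apply: cderD. Qed.

Lemma cderX z n : cder (fun x => x ^+ n) z (n%:R * z ^+ n.-1).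
Proof.
elim: n => [|n IH]; first by rewrite mul0r; apply: cder_eq (cder_cst 1 z).
apply: cder_eq (cderM (cder_id z) IH) => [x|]; first by rewrite exprS.
rewrite -natr1 mulrDl !mul1r addrC; congr (_ + _).
by case: n {IH} => [|n]; rewrite ?mul0r ?mulr0 //= mulrCA -exprS.
Qed.

Lemma cder_sum n (F : nat -> C -> C) (L : nat -> C) z :
  (forall i, (i < n)%N -> cder (F i) z (L i)) ->
  cder (fun x => \sum_(i < n) F i x) z (\sum_(i < n) L i).
Proof.
elim: n => [|n IH] h.
  rewrite big_ord0; apply: cder_eq (cder_cst 0 z) => // x; by rewrite big_ord0.
rewrite big_ord_recr; apply: cder_eq (cderD (IH _) (h n _)) => //=.
  by move=> x; rewrite big_ord_recr.
by move=> i ni; apply: h; rewrite ltnW.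
Qed.

Lemma cder_shift f a z L : cder f (a + z) L <-> cder (fun x => f (a + x)) z L.
Proof.
by split=> [] [q fq hq]; exists q => // h; rewrite ?addrA ?fq -?addrA // fq.
Qed.

End Derivative.

(** * Sequences of complex numbers *)

Section Limits.
Variable R : realType.
Local Notation C := R[i].
Implicit Types (z w h : C) (u v : nat -> C).

Definition clim u l := forall e : R, 0 < e ->
  exists N, forall n, (N <= n)%N -> normc (u n - l) <= e.

Definition ccauchy u := forall e : R, 0 < e ->
  exists N, forall n m, (N <= n)%N -> (N <= m)%N -> normc (u n - u m) <= e.

Lemma real_cauchy_lim (u : nat -> R) :
  (forall e : R, 0 < e -> exists N, forall n m,
     (N <= n)%N -> (N <= m)%N -> `|u n - u m| <= e) ->
  exists l, forall e : R, 0 < e ->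
    exists N, forall n, (N <= n)%N -> `|u n - l| <= e.
Proof.
move=> uC; have : cvg (u @ \oo).
  apply: cauchy_cvg; apply: cauchy_exP => e e0 /=.
  have [N hN] := uC _ (divr_gt0 e0 (ltr0Sn R 1)).
  exists (u N); exists N => // n /= Nn; rewrite -ball_normE /=.
  by have := hN N n (leqnn _) Nn; lra.
move=> /cvg_ex [l /cvgrPdist_le ul]; exists l => e /ul [N _ hN].
by exists N => n Nn; rewrite distrC; apply: hN.
Qed.

Lemma ccauchy_lim u : ccauchy u -> exists l, clim u l.
Proof.
move=> uC.
have [|a ha] := @real_cauchy_lim (fun n => complex.Re (u n)).
  move=> e /uC [N hN]; exists N => n m Nn Nm; apply: le_trans (hN _ _ Nn Nm).
  by rewrite -raddfB normc_Re.
have [|b hb] := @real_cauchy_lim (fun n => complex.Im (u n)).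
  move=> e /uC [N hN]; exists N => n m Nn Nm; apply: le_trans (hN _ _ Nn Nm).
  by rewrite -raddfB normc_Im.
exists (a +i* b) => e e0; have e2 : 0 < e / 2 by rewrite divr_gt0.
have [N hN] := ha _ e2; have [M hM] := hb _ e2.
exists (maxn N M) => n; rewrite geq_max => /andP[Nn Mn].
rewrite (le_trans (normc_le_ReIm _)) // (splitr e) lerD //.
  by rewrite raddfB; apply: hN.
by rewrite raddfB; apply: hM.
Qed.

Lemma clim_le u l w (b : R) : clim u l ->
  (exists N, forall n, (N <= n)%N -> normc (u n - w) <= b) -> normc (l - w) <= b.
Proof.
move=> ul [N hN]; apply/ler_addgt0Pr => e /ul [M hM].
rewrite (le_trans (normc_split (u (maxn N M)) _ _)) // addrC lerD //.
  by apply: hN; rewrite leq_maxl.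
by rewrite normc_distC; apply: hM; rewrite leq_maxr.
Qed.

Lemma clim_unique u l l' : clim u l -> clim u l' -> l = l'.
Proof.
move=> ul ul'; apply/eqP; rewrite -subr_eq0; apply/eqP/normc_le_eq0 => e e0.
exact: clim_le ul (ul' e e0).
Qed.

Lemma clim_cauchy u l : clim u l -> ccauchy u.
Proof.
move=> ul e e0; have [N hN] := ul _ (divr_gt0 e0 (ltr0Sn R 1)).
exists N => n m /hN a /hN b; rewrite (le_trans (normc_split l _ _)) //.
by rewrite (splitr e) lerD // normc_distC.
Qed.

Lemma climD u v l l' : clim u l -> clim v l' -> clim (fun n => u n + v n) (l + l').
Proof.
move=> ul vl e e0; have e2 : 0 < e / 2 by rewrite divr_gt0.
have [N hN] := ul _ e2; have [M hM] := vl _ e2.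
exists (maxn N M) => n; rewrite geq_max => /andP[/hN a /hM b].
by rewrite opprD addrACA (le_trans (normcD _ _)) // (splitr e) lerD.
Qed.

Lemma climZ c u l : clim u l -> clim (fun n => c * u n) (c * l).
Proof.
move=> ul e e0; have c0 : 0 < normc c + 1 by rewrite ltr_wpDl ?normc_ge0.
have [N hN] := ul _ (divr_gt0 e0 c0); exists N => n /hN a.
rewrite -mulrBr normcM (le_trans (ler_wpM2l (normc_ge0 _) a)) //.
rewrite mulrCA ler_piMr ?(ltW e0) // ler_pdivrMr //; lra.
Qed.

Lemma clim_eq u v l l' : u =1 v -> l = l' -> clim u l -> clim v l'.
Proof. by move=> /funext -> ->. Qed.

Lemma clim_cst l : clim (fun=> l) l.
Proof. by move=> e e0; exists 0%N => n _; rewrite subrr normc0 ltW. Qed.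

Lemma clim_comp u l (s : nat -> nat) : (forall n, (n <= s n)%N) ->
  clim u l -> clim (fun n => u (s n)) l.
Proof.
move=> hs ul e /ul [N hN]; exists N => n Nn; apply: hN.
exact: leq_trans (hs n).
Qed.

Lemma geo_small (q K e : R) : 0 <= q -> q < 1 -> 0 <= K -> 0 < e ->
  exists N, forall n, (N <= n)%N -> K * q ^+ n <= e.
Proof.
move=> q0 q1 K0 e0; have K1 : 0 < K + 1 by lra.
have : `|q| < 1 by rewrite ger0_norm.
move=> /cvg_expr /cvgrPdist_le /(_ _ (divr_gt0 e0 K1)) [N _ hN].
exists N => n /hN /=; rewrite sub0r normrN ger0_norm ?exprn_ge0 // => h.
rewrite (le_trans (ler_wpM2l K0 h)) // mulrCA ler_piMr ?(ltW e0) //.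
by rewrite ler_pdivrMr //; lra.
Qed.

Lemma half_pow_small (s e : R) : 0 < e -> exists n, s / 2 ^+ n < e.
Proof.
move=> e0; have q1 : 2^-1 < 1 :> R by rewrite invf_lt1 // ltr1n.
have q0 : 0 <= 2^-1 :> R by rewrite invr_ge0.
have [N hN] := geo_small q0 q1 (normr_ge0 s) (divr_gt0 e0 (ltr0Sn R 1)).
exists N; have := hN N (leqnn _); rewrite exprVn => h.
have : s / 2 ^+ N <= `|s| / 2 ^+ N.
  by rewrite ler_wpM2r ?invr_ge0 ?exprn_ge0 // ler_norm.
lra.
Qed.

End Limits.

(** * Bisection *)

Section Bisection.
Variable R : realType.
Local Notation C := R[i].
Implicit Types (z w h : C) (f : C -> C).

(** If the property fails on a cell (a square, a segment, a triangle), then it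
    fails on one of half the size nearby; iterating, the failing cells shrink
    to a point, which contradicts local validity there.  Compactness of discs,
    the mean value inequality and Goursat's theorem all come from this. *)
Lemma bisection (X : Type) (P : X -> Prop) (ctr : X -> C) (sz : X -> R) :
  (forall x, ~ P x -> exists y,
     [/\ ~ P y, sz y = sz x / 2 & normc (ctr y - ctr x) <= sz x]) ->
  (forall z, exists2 d, 0 < d & forall x,
     sz x < d -> normc (ctr x - z) <= 2 * sz x -> P x) ->
  forall x, P x.
Proof.
move=> Hsub Hloc x0; apply: contrapT => nPx0.
pose Y := {x : X | ~ P x}.
have /choice[nxt hnxt] : forall x : Y, exists y : Y,
    sz (sval y) = sz (sval x) / 2 /\
    normc (ctr (sval y) - ctr (sval x)) <= sz (sval x).
  by move=> [x nPx]; have [y [nPy h1 h2]] := Hsub _ nPx; exists (exist _ y nPy).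
pose u n : Y := iter n nxt (exist _ x0 nPx0).
pose s := sz x0.
have su n : sz (sval (u n)) = s / 2 ^+ n.
  elim: n => [|n IH]; first by rewrite expr0 divr1.
  by rewrite /= (hnxt _).1 IH exprS invfM mulrCA mulrC.
have s0 : 0 <= s.
  by have := (hnxt (u 0%N)).2; rewrite su expr0 divr1; apply: le_trans (normc_ge0 _).
have cu n k : normc (ctr (sval (u (n + k)%N)) - ctr (sval (u n)))
    <= 2 * (s / 2 ^+ n) - s / 2 ^+ (n + k) * 2.
  elim: k => [|k IH]; first by rewrite addn0 subrr normc0; lra.
  rewrite addnS (le_trans (normc_split (ctr (sval (u (n + k)%N))) _ _)) //.
  have := (hnxt (u (n + k)%N)).2; rewrite su => h.
  have -> : s / 2 ^+ (n + k).+1 * 2 = s / 2 ^+ (n + k).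
    by rewrite exprS; field; rewrite expf_neq0.
  by apply: (le_trans (lerD h IH)); lra.
have cu' n k : normc (ctr (sval (u (n + k)%N)) - ctr (sval (u n))) <= 2 * (s / 2 ^+ n).
  apply: le_trans (cu n k) _; rewrite gerBl mulr_ge0 // divr_ge0 // exprn_ge0 //.
have [z hz] : exists z, clim (fun n => ctr (sval (u n))) z.
  apply: ccauchy_lim => e e0; have [N hN] := half_pow_small (4 * s) e0.
  exists N => n m Nn Nm.
  rewrite (le_trans (normc_split (ctr (sval (u N))) _ _)) //.
  have := cu' N (n - N)%N; have := cu' N (m - N)%N; rewrite !subnKC //.
  rewrite normc_distC => a b; apply: le_trans (lerD b a) _; lra.
have [d d0 hd] := Hloc z; have [N hN] := half_pow_small s d0.
apply: (svalP (u N)); apply: hd; first by rewrite su.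
rewrite su normc_distC; apply: clim_le hz _; exists N => n Nn.
by have := cu' N (n - N)%N; rewrite subnKC.
Qed.

(** Heine-Borel for discs, as an induction principle for the ideals of sets
    that contain a neighbourhood of each point. *)
Lemma disc_compact (B : (C -> Prop) -> Prop) :
  (forall U V : C -> Prop, (forall z, U z -> V z) -> B V -> B U) ->
  (forall U V, B U -> B V -> B (fun z => U z \/ V z)) ->
  (forall z, exists2 d, 0 < d & B (fun w => normc (w - z) < d)) ->
  forall r, B (fun w => normc w <= r).
Proof.
move=> Bmon BU Bloc r.
pose sq (x : C * R) w :=
  `|complex.Re (w - x.1)| <= x.2 /\ `|complex.Im (w - x.1)| <= x.2.
suff H : forall x, B (sq x).
  apply: Bmon (H (0, r)) => w wr; rewrite /sq /= subr0.
  by split; apply: le_trans wr; rewrite ?normc_Re ?normc_Im.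
apply: (@bisection _ _ (fun x => x.1) (fun x => 2 * `|x.2|)).
  move=> [c s] nB; apply: contrapT => nE; apply: nB.
  pose q (a b : R) := (c + ((a * s / 2) +i* (b * s / 2)), s / 2).
  have n2 : `|2^-1 : R| = 2^-1 by rewrite ger0_norm // invr_ge0.
  have Bq a b : `|a| = 1 -> `|b| = 1 -> B (sq (q a b)).
    move=> a1 b1; apply: contrapT => nB; apply: nE; exists (q a b); split => //=.
      by rewrite normrM n2 mulrA.
    rewrite addrC addKr (le_trans (normc_le_ReIm _)) //=.
    rewrite !normrM a1 b1 !mul1r n2; have := normr_ge0 s; lra.
  have n1 : `|1 : R| = 1 by rewrite normr1.
  have nN1 : `|-1 : R| = 1 by rewrite normrN1.
  apply: Bmon (BU _ _ (BU _ _ (Bq _ _ n1 n1) (Bq _ _ n1 nN1))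
                      (BU _ _ (Bq _ _ nN1 n1) (Bq _ _ nN1 nN1))).
  move=> w [] /=; rewrite /sq /q /=.
  clear nE Bq; move: @q => _; case: c => c1 c2; case: w => w1 w2 /=; rewrite !ler_norml => /andP[h1 h2] /andP[h3 h4].
  have [k1|k1] := lerP c1 w1; have [k2|k2] := lerP c2 w2.
  - by left; left; split; lra.
  - by left; right; split; lra.
  - by right; left; split; lra.
  - by right; right; split; lra.
move=> z; have [d d0 hd] := Bloc z; exists (d / 3); first by rewrite divr_gt0.
move=> [c s] /= hs hc; apply: Bmon hd => w [] /= h1 h2.
rewrite (le_lt_trans (normc_split c _ _)) //.
have := normc_le_ReIm (w - c); have := ler_norm s; lra.
Qed.

Lemma cctn_bounded f : (forall z, cctn f z) ->
  forall r, exists M, forall z, normc z <= r -> normc (f z) <= M.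
Proof.
move=> fC; apply: (@disc_compact (fun U => exists M, forall z, U z -> normc (f z) <= M)).
- by move=> U V UV [M hM]; exists M => z /UV; apply: hM.
- move=> U V [M hM] [N hN]; exists (Num.max M N) => z.
  by case=> [/hM|/hN] h; rewrite le_max h ?orbT.
- move=> z; have [d d0 hd] := fC z _ ltr01; exists d => //.
  exists (normc (f z) + 1) => w /hd; rewrite [z + _]addrC subrK => h.
  have := normcD (f w - f z) (f z); rewrite subrK; lra.
Qed.

Lemma cctn_unif f : (forall z, cctn f z) -> forall r (e : R), 0 < e ->
  exists2 d, 0 < d & forall z h, normc z <= r -> normc h < d ->
    normc (f (z + h) - f z) <= e.
Proof.
move=> fC r e e0.
pose B U := exists2 d, 0 < d & forall z h, U z -> normc h < d ->
    normc (f (z + h) - f z) <= e.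
apply: (@disc_compact B).
- by move=> U V UV [d d0 hd]; exists d => // z h /UV; apply: hd.
- move=> U V [d d0 hd] [d' d'0 hd']; exists (Num.min d d'); first by rewrite lt_min d0.
  move=> z h; rewrite lt_min => + /andP[k1 k2].
  by case=> [/hd|/hd']; apply.
- move=> z; have [d d0 hd] := fC z _ (divr_gt0 e0 (ltr0Sn R 1)).
  exists (d / 2); first by rewrite divr_gt0.
  exists (d / 2); first by rewrite divr_gt0.
  move=> w h hw hh; rewrite (le_trans (normc_split (f z) _ _)) //.
  have -> : w + h = z + (w - z + h) by ring.
  rewrite [in X in _ + X]normc_distC -{2}(subrK z w) [w - z + z]addrC (splitr e) lerD // hd //; last lra.
  rewrite (le_lt_trans (normcD _ _)) //; lra.
Qed.

(** The function is only required to be differentiable along the real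
    segment [0, 1]: bisect, and compare with the tangent at a nearby point. *)
Lemma mean_value f (K : R) :
  (forall t : R, 0 <= t <= 1 -> exists2 L, cder f t%:C L & normc L <= K) ->
  normc (f 1 - f 0) <= K.
Proof.
move=> df; apply/ler_addgt0Pr => e e0.
pose P (x : R * R) := 0 <= x.1 -> 0 <= x.2 -> x.1 + x.2 <= 1 ->
  normc (f (x.1 + x.2)%:C - f x.1%:C) <= (K + e) * x.2.
suff /(_ (0, 1)) : forall x, P x.
  by rewrite /P /= add0r mulr1 => h; apply: h.
apply: (@bisection _ P (fun x => x.1%:C) (fun x => x.2)).
  move=> [a s] nP; have [a0 s0 as1] : [/\ 0 <= a, 0 <= s & a + s <= 1].
    by split; apply: contrapT => k; apply: nP => ? ? ?; case: k.
  apply: contrapT => nE; apply: nP => _ _ _ /=.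
  have s20 : 0 <= s / 2 by rewrite divr_ge0.
  have h1 : P (a, s / 2).
    apply: contrapT => nP; apply: nE; exists (a, s / 2); split => //.
    by rewrite subrr normc0.
  have h2 : P (a + s / 2, s / 2).
    apply: contrapT => nP; apply: nE; exists (a + s / 2, s / 2); split => //.
    have -> : ((a + s / 2)%:C - a%:C : R[i]) = (s / 2)%:C by rewrite -rmorphB [a + _]addrC addrK.
    rewrite normc_real ger0_norm //=; lra.
  have {}h1 := h1 a0 s20; have {}h2 := h2; rewrite /P /= in h1 h2.
  have as2 : a + s / 2 + s / 2 = a + s by lra.
  have := h1; have := h2; rewrite as2.
  move=> k1 k2; have {}k1 := k1 (addr_ge0 a0 s20) s20 as1.
  have {}k2 : normc (f (a + s / 2)%:C - f a%:C) <= (K + e) * (s / 2) by apply: k2; lra.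
  rewrite (le_trans (normc_split (f (a + s / 2)%:C) _ _)) //.
  apply: le_trans (lerD k1 k2) _; lra.
(* The limit point is projected to [0, 1], which brings it closer to the
   cells there; their end points are then within 3 s of it. *)
move=> z; pose t := if complex.Re z < 0 then 0 else
  if 1 < complex.Re z then 1 else complex.Re z.
have t01 : 0 <= t <= 1.
  by rewrite /t; case: ltP => ?; [|case: ltP => ?]; lra.
have [L /cderP dL LK] := df _ t01.
have [d d0 hd] := dL _ (divr_gt0 e0 (ltr0Sn R 4)).
exists (d / 3); first by rewrite divr_gt0.
move=> [a s] /= sd az; rewrite /P /= => a0 s0 as1.
have at2 : `|a - t| <= 2 * s.
  apply: le_trans az; apply: le_trans (normc_Re _); rewrite raddfB /=.
  rewrite /t; case: ltP => ?; last (case: ltP => ? //).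
    by rewrite subr0 !ger0_norm //; lra.
  by rewrite !ler0_norm; lra.
have ats : `|a + s - t| <= 3 * s.
  move: at2; rewrite !ler_norml; lra.
have k1 : normc (f a%:C - f t%:C - (a - t)%:C * L) <= e / 5 * (2 * s).
  have := hd (a - t)%:C; rewrite -rmorphD [t + _]addrC subrK normc_real.
  move=> h; apply: le_trans (h _) _; first by lra.
  by rewrite ler_wpM2l // divr_ge0 // ltW.
have k2 : normc (f (a + s)%:C - f t%:C - (a + s - t)%:C * L) <= e / 5 * (3 * s).
  have := hd (a + s - t)%:C; rewrite -rmorphD [t + _]addrC subrK normc_real.
  move=> h; apply: le_trans (h _) _; first by lra.
  by rewrite ler_wpM2l // divr_ge0 // ltW.
have -> : f (a + s)%:C - f a%:C = (f (a + s)%:C - f t%:C - (a + s - t)%:C * L)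
    - (f a%:C - f t%:C - (a - t)%:C * L) + s%:C * L.
  by rewrite !rmorphB rmorphD /=; ring.
rewrite (le_trans (normcD _ _)) //.
have k3 : normc (s%:C * L) <= s * K.
  by rewrite normcM normc_real ger0_norm // ler_wpM2l.
have k4 := normcB (f (a + s)%:C - f t%:C - (a + s - t)%:C * L) (f a%:C - f t%:C - (a - t)%:C * L).
rewrite (le_trans (lerD (le_trans k4 (lerD k2 k1)) k3)) //; lra.
Qed.

End Bisection.

(** * The complex exponential *)

Section Exponential.
Variable R : realType.
Local Notation C := R[i].
Implicit Types (z w h : C).

(** [cexp] with [R[i]] in place of the regular module over it, so that sums
    and products in its argument are those of the field [R[i]]. *)
Definition ce z : C :=
  (expR (complex.Re z) * cos (complex.Im z)) +i*
  (expR (complex.Re z) * sin (complex.Im z)).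

Lemma ceD z w : ce (z + w) = ce z * ce w.
Proof.
case: z => a b; case: w => c d; rewrite /ce /= expRD cosD sinD.
by apply/eqP; rewrite eq_complex /=; apply/andP; split; apply/eqP; ring.
Qed.

Lemma ce0 : ce 0 = 1.
Proof. by rewrite /ce /= expR0 cos0 sin0 mul1r mulr0. Qed.

Lemma normc_ce z : normc (ce z) = expR (complex.Re z).
Proof.
rewrite /ce /= !exprMn -mulrDr cos2Dsin2 mulr1 sqrtr_sqr.
by rewrite ger0_norm // expR_ge0.
Qed.

Lemma ce_neq0 z : ce z != 0.
Proof. by rewrite -normc_gt0 normc_ce expR_gt0. Qed.

Lemma ceN z : ce (- z) = (ce z)^-1.
Proof.
apply: (mulfI (ce_neq0 z)); rewrite divff ?ce_neq0 //.
by rewrite -ceD subrr ce0.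
Qed.

Lemma ceB z w : ce (z - w) = ce z / ce w.
Proof. by rewrite ceD ceN. Qed.

Lemma ceX n z : ce (n%:R * z) = ce z ^+ n.
Proof.
elim: n => [|n IH]; first by rewrite mul0r ce0 expr0.
by rewrite -natr1 mulrDl mul1r ceD IH exprSr.
Qed.

Lemma normc_ce_le z : normc (ce z) <= expR (normc z).
Proof. by rewrite normc_ce ler_expR (le_trans (ler_norm _)) // normc_Re. Qed.

Lemma real_diff_eps (f : R -> R) (x L : R) : is_derive x 1 f L ->
  forall e : R, 0 < e -> exists2 d, 0 < d & forall h : R, `|h| < d ->
    `|f (x + h) - f x - h * L| <= e * `|h|.
Proof.
move=> [df dL] e e0.
have : h^-1 *: (f (h *: 1 + x) - f x) @[h --> 0^'] --> L.
  by rewrite -dL; apply: df.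
move=> /cvgrPdist_le /(_ _ e0); rewrite -nbhs_nearE => /nbhs_ballP [d /= d0 hd].
exists d => // h hh; have [->|h0] := eqVneq h 0.
  by rewrite addr0 mul0r subr0 subrr !normr0 mulr0.
have := hd h; rewrite -ball_normE /= sub0r normrN => /(_ hh h0).
have -> : f (x + h) - f x - h * L = - (h * (L - h^-1 * (f (h * 1 + x) - f x))).
  by rewrite mulr1 [h + x]addrC; field.
by rewrite normrN normrM mulrC => k; rewrite ler_wpM2r.
Qed.

Lemma cder_ce0 : cder ce 0 1.
Proof.
apply/cderP => e e0.
have [e1 [e10 e14 e11]] : exists e1 : R, [/\ 0 < e1, e1 <= e / 8 & e1 <= 1].
  by exists (Num.min (e / 8) 1); rewrite lt_min ltr01 divr_gt0 // !ge_min !lexx orbT.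
have [d1 d10 H1] := real_diff_eps (is_derive_expR 0) e10.
have [d2 d20 H2] := real_diff_eps (is_derive_cos 0) e10.
have [d3 d30 H3] := real_diff_eps (is_derive_sin 0) e10.
exists (Num.min (Num.min d1 d2) (Num.min d3 e1)); first by rewrite !lt_min d10 d20 d30 e10.
case=> a b; rewrite !lt_min => /andP[/andP[h1 h2] /andP[h3 h4]].
have na := normc_Re (a +i* b); have nb := normc_Im (a +i* b).
rewrite [complex.Re _]/= in na; rewrite [complex.Im _]/= in nb.
set N := normc _ in h1 h2 h3 h4 na nb *.
have {H1} := H1 a (le_lt_trans na h1).
have {H2} := H2 b (le_lt_trans nb h2).
have {H3} := H3 b (le_lt_trans nb h3).
rewrite !add0r expR0 cos0 sin0 oppr0 mulr0 !mulr1 addr0 !subr0 => k3 k2 k1.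
rewrite ce0 /ce [complex.Re _]/= [complex.Im _]/=.
rewrite (le_trans (normc_le_ReIm _)) //=.
have c1 := cos_max b.
have N0 : 0 <= N by rewrite normc_ge0.
have kc : `|cos b - 1| <= e1 * N by rewrite (le_trans k2) // ler_wpM2l // ltW.
have ks : `|sin b - b| <= e1 * N by rewrite (le_trans k3) // ler_wpM2l // ltW.
have ke : `|expR a - 1 - a| <= e1 * N by rewrite (le_trans k1) // ler_wpM2l // ltW.
have s1 : `|sin b| <= 1 by rewrite ler_norml sin_le1 sin_geN1.
have a1 : `|1 + a| <= 2 by rewrite (le_trans (ler_normD _ _)) // normr1; lra.
have lem (x y z t : R) : `|x| <= e1 * N -> `|y| <= 1 -> `|z| <= 2 -> `|t| <= e1 * N ->
    `|x * y + z * t| <= 3 * (e1 * N).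
  move=> x1 y1 z1 t1; rewrite (le_trans (ler_normD _ _)) // !normrM.
  have : `|x| * `|y| <= (e1 * N) * 1 by apply: ler_pM.
  have : `|z| * `|t| <= 2 * (e1 * N) by apply: ler_pM.
  by lra.
have -> : expR a * cos b - 1 - a = (expR a - 1 - a) * cos b + (1 + a) * (cos b - 1) by ring.
have -> : expR a * sin b - 0 - b
  = (expR a - 1 - a) * sin b + (1 + a) * (sin b - b) + a * b by ring.
have kab : `|a * b| <= e1 * N.
  by rewrite normrM; apply: ler_pM => //; lra.
have eN : e1 * N <= e / 8 * N by rewrite ler_wpM2r.
have m1 := lem _ _ _ _ ke c1 a1 kc; have m2 := lem _ _ _ _ ke s1 a1 ks.
have m3 := ler_normD ((expR a - 1 - a) * sin b + (1 + a) * (sin b - b)) (a * b).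
have eN0 : 0 <= e * N by rewrite mulr_ge0 // ltW.
lra.
Qed.

Lemma cder_ce z : cder ce z (ce z).
Proof.
have [q hq [q0 cq]] := cder_ce0; exists (fun h => ce z * q h).
  by move=> h; rewrite ceD -[h in LHS]add0r hq ce0; ring.
rewrite q0 mulr1; split => //; apply: cctnM => //; exact: cctn_cst.
Qed.

Lemma cder_ce_lin l z : cder (fun x => ce (l * x)) z (l * ce (l * z)).
Proof.
by have := cder_comp (cderZ l (cder_id z)) (cder_ce (l * z)); rewrite mulr1.
Qed.

Lemma ce_lip : exists2 d, 0 < d & forall h, normc h < d ->
  normc (ce h - 1) <= 2 * normc h.
Proof.
have /cderP /(_ _ ltr01) [d d0 hd] := cder_ce0; exists d => // h /hd.
rewrite add0r ce0 mulr1 mul1r => k.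
have := normcD (ce h - 1 - h) h; rewrite subrK; lra.
Qed.

(** ** Roots of unity *)

Definition unity_root (n : nat) : C := ce (0 +i* (2 * pi / n%:R)).

Lemma normc_unity_root n : normc (unity_root n) = 1.
Proof. by rewrite normc_ce /= expR0. Qed.

Lemma unity_rootX n k : unity_root n ^+ k =
  cos (2 * pi * k%:R / n%:R) +i* sin (2 * pi * k%:R / n%:R).
Proof.
rewrite -ceX /ce -(rmorph_nat (real_complex R)) /= !mulr0 mul0r subr0.
rewrite addr0 expR0 !mul1r; congr (cos _ +i* sin _); ring.
Qed.

Lemma unity_root_exp n : (0 < n)%N -> unity_root n ^+ n = 1.
Proof.
move=> n0; rewrite unity_rootX mulfK ?pnatr_eq0 -?lt0n //.
by rewrite mulr_natl cos2pi sin2pi.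
Qed.

(** With t = pi k / n, cos (2 t) = 1 would force sin t = 0, but 0 < t < pi. *)
Lemma unity_root_prim n k : (0 < k < n)%N -> unity_root n ^+ k != 1.
Proof.
move=> /andP[k0 kn]; rewrite unity_rootX; apply/eqP => [[h _]].
have n0 : (0 < n%:R :> R) by rewrite ltr0n (leq_trans _ kn).
have : 0 < sin (pi * k%:R / n%:R : R).
  apply: sin_gt0_pi; rewrite divr_gt0 ?mulr_gt0 ?pi_gt0 ?n0 ?ltr0n //=.
  by rewrite ltr_pdivrMr // ltr_pM2l ?pi_gt0 // ltr_nat.
have : cos (2 * pi * k%:R / n%:R) = 1 - 2 * sin (pi * k%:R / n%:R : R) ^+ 2.
  have -> : 2 * pi * k%:R / n%:R = pi * k%:R / n%:R + pi * k%:R / n%:R :> R by ring.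
  rewrite cosD -!expr2; have := cos2Dsin2 (pi * k%:R / n%:R : R); lra.
rewrite h => h2 /lt0r_neq0; rewrite -sqrf_eq0 => /eqP; apply; lra.
Qed.

Lemma unity_root_sum n k : (0 < k < n)%N ->
  \sum_(i < n) unity_root n ^+ k ^+ i = 0.
Proof.
move=> kn; have h := subrX1 (unity_root n ^+ k) n.
have n0 : (0 < n)%N by case/andP: kn => _; apply: leq_ltn_trans.
have /eqP : (unity_root n ^+ k - 1) * (\sum_(i < n) unity_root n ^+ k ^+ i) = 0.
  by rewrite -h -exprM mulnC exprM unity_root_exp // expr1n subrr.
by rewrite mulf_eq0 subr_eq0 (negbTE (unity_root_prim kn)) => /eqP.
Qed.

Lemma unity_root_lim (e : R) : 0 < e ->
  exists N, forall n, (N <= n)%N -> normc (unity_root n - 1) < e.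
Proof.
move=> e0; have [d d0 hd] := ce_lip.
have pi0 : 0 < pi :> R := pi_gt0 R.
pose b := Num.min d (e / 2).
have b0 : 0 < b by rewrite lt_min d0 divr_gt0.
have [N hN] : exists N, 2 * pi / b < N%:R by exists (Num.truncn (2 * pi / b)).+1; rewrite Num.Theory.truncnS_gt.
exists N => n Nn; have nN : 2 * pi / b < n%:R by rewrite (lt_le_trans hN) // ler_nat.
have n0 : (0 < n%:R :> R) by rewrite (lt_trans _ nN) // divr_gt0 // mulr_gt0.
have k : normc (0 +i* (2 * pi / n%:R)) < b.
  rewrite /= expr0n add0r sqrtr_sqr ger0_norm; last by rewrite divr_ge0 ?mulr_ge0 // ltW.
  by rewrite ltr_pdivrMr // [b * _]mulrC -ltr_pdivrMr.
move: k; rewrite lt_min => /andP[/hd k1 k2].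
apply: (le_lt_trans k1); lra.
Qed.

End Exponential.

(** * Primitives of holomorphic functions *)

Section Goursat.
Variable R : realType.
Local Notation C := R[i].
Implicit Types (z w h a b c : C) (f g : C -> C).

(** Trapezoidal approximations of the integral of [f] along the segment from
    [z] to [w], on 2^n equal pieces.  They are antisymmetric in the end points
    and exact on affine functions, and halving the segment is built in. *)
Fixpoint trap f n z w : C :=
  if n is m.+1 then trap f m z ((z + w) / 2) + trap f m ((z + w) / 2) w
  else (f z + f w) / 2 * (w - z).

Lemma trap_opp f n z w : trap f n w z = - trap f n z w.
Proof.
elim: n z w => [|n IH] z w /=; first by ring.
rewrite [w + z]addrC [trap f n w _]IH [trap f n _ z]IH opprD; exact: addrC.
Qed.

Lemma two_neq0 : (2 : C) != 0.
Proof. by rewrite pnatr_eq0. Qed.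

Lemma trap_affine c b n z w :
  trap (fun x => c + b * x) n z w = (w - z) * (c + b * ((z + w) / 2)).
Proof.
have h := two_neq0.
elim: n z w => [|n IH] z w /=; first by field.
by rewrite !IH; field.
Qed.

Lemma trapB f g n z w :
  trap (fun x => f x - g x) n z w = trap f n z w - trap g n z w.
Proof.
elim: n z w => [|n IH] z w /=; first by ring.
by rewrite !IH; ring.
Qed.

Lemma normc_half z : normc (z / 2) = normc z / 2.
Proof. by rewrite normcM normcV normc_nat. Qed.

Lemma normc_mid c r z w : normc (z - c) <= r -> normc (w - c) <= r ->
  normc ((z + w) / 2 - c) <= r.
Proof.
move=> zr wr; have h := two_neq0.
have -> : (z + w) / 2 - c = ((z - c) + (w - c)) / 2 by field.
by rewrite normc_half; have := normcD (z - c) (w - c); lra.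
Qed.

Lemma normc_midB z w : normc ((z + w) / 2 - z) = normc (w - z) / 2
  /\ normc (w - (z + w) / 2) = normc (w - z) / 2.
Proof.
have h := two_neq0.
by split; rewrite -normc_half; congr normc; field.
Qed.

Lemma trap_bound f n z w c (r K : R) :
  (forall x, normc (x - c) <= r -> normc (f x) <= K) ->
  normc (z - c) <= r -> normc (w - c) <= r ->
  normc (trap f n z w) <= K * normc (w - z).
Proof.
move=> fK; elim: n z w => [|n IH] z w zr wr /=.
  rewrite normcM ler_wpM2r ?normc_ge0 // normc_half.
  by have := normcD (f z) (f w); have := fK _ zr; have := fK _ wr; lra.
have mr := normc_mid zr wr; rewrite (le_trans (normcD _ _)) //.
apply: le_trans (lerD (IH _ _ zr mr) (IH _ _ mr wr)) _.
by have [-> ->] := normc_midB z w; lra.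
Qed.

Lemma trap_approx f n z w c (r K : R) al :
  (forall x, normc (x - c) <= r -> normc (f x - al) <= K) ->
  normc (z - c) <= r -> normc (w - c) <= r ->
  normc (trap f n z w - al * (w - z)) <= K * normc (w - z).
Proof.
move=> fK zr wr; apply: le_trans (trap_bound n fK zr wr).
rewrite (trapB f (fun=> al)).
have -> : trap (fun=> al) n z w = al * (w - z) => //.
have -> : (fun=> al) = (fun x => al + 0 * x) by apply/funext => x; rewrite mul0r addr0.
by rewrite trap_affine mul0r addr0 mulrC.
Qed.

(** Refining pieces that are already short changes little, however many times
    it is done: on each of them [f] is nearly constant. *)
Lemma trap_refine f r (d e : R) s n z w :
  (forall z h, normc z <= r -> normc h < d -> normc (f (z + h) - f z) <= e) ->
  normc z <= r -> normc w <= r -> normc (w - z) < 2 ^+ s * d ->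
  normc (trap f (s + n) z w - trap f s z w) <= e * normc (w - z).
Proof.
move=> fu; elim: s z w => [|s IH] z w zr wr zw.
  rewrite add0n [trap f 0 z w]/=.
  have [m1 m2] := normc_midB z w.
  apply: (@trap_approx _ _ _ _ ((z + w) / 2) (normc (w - z) / 2)).
  - move=> x xm.
    have hz : normc (x - z) < d.
      rewrite (le_lt_trans (normc_split ((z + w) / 2) _ _)) // m1; lra.
    have hw : normc (x - w) < d.
      rewrite (le_lt_trans (normc_split ((z + w) / 2) _ _)) //.
      rewrite [normc (_ - w)]normc_distC m2; lra.
    have := fu z (x - z) zr hz; have := fu w (x - w) wr hw.
    rewrite [w + _]addrC [z + _]addrC !subrK => k1 k2.
    have h2 := two_neq0.
    have -> : f x - (f z + f w) / 2 = ((f x - f z) + (f x - f w)) / 2 by field.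
    by rewrite normc_half; have := normcD (f x - f z) (f x - f w); lra.
  - by rewrite normc_distC m1.
  - by rewrite m2.
have [m1 m2] := normc_midB z w.
have mr : normc ((z + w) / 2) <= r.
  by have := @normc_mid 0 r z w; rewrite !subr0; apply.
have hs : normc (w - z) / 2 < 2 ^+ s * d by move: zw; rewrite exprS; lra.
rewrite addSn /= opprD addrACA (le_trans (normcD _ _)) //.
apply: le_trans (lerD (IH _ _ zr mr _) (IH _ _ mr wr _)) _; rewrite ?m1 ?m2 //.
lra.
Qed.

Section Segment.
Variable f : C -> C.
Hypothesis f_ct : forall z, cctn f z.

Lemma trap_cvg z w : exists l, clim (fun n => trap f n z w) l.
Proof.
apply: ccauchy_lim => e e0.
pose r := Num.max (normc z) (normc w).
have K0 : 0 < normc (w - z) + 1 by rewrite ltr_wpDl ?normc_ge0.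
have e20 : 0 < e / 2 / (normc (w - z) + 1) by rewrite !divr_gt0.
have [d d0 hd] := cctn_unif f_ct r e20.
have [s hs] := half_pow_small (normc (w - z)) d0.
have {}hs : normc (w - z) < 2 ^+ s * d.
  by move: hs; rewrite ltr_pdivrMr ?exprn_gt0 // mulrC.
have zr : normc z <= r by rewrite le_max lexx.
have wr : normc w <= r by rewrite le_max lexx orbT.
have H n : (s <= n)%N -> normc (trap f n z w - trap f s z w) <= e / 2.
  move=> sn; have := trap_refine (n - s) hd zr wr hs; rewrite subnKC //.
  move=> h; apply: (le_trans h); rewrite mulrAC ler_pdivrMr //.
  rewrite ler_wpM2l ?divr_ge0 ?(ltW e0) //; lra.
exists s => n m sn sm; rewrite (le_trans (normc_split (trap f s z w) _ _)) //.
by rewrite (splitr e) lerD ?H // normc_distC H.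
Qed.

Definition segint z w : C := sval (cid (trap_cvg z w)).

Lemma segint_lim z w : clim (fun n => trap f n z w) (segint z w).
Proof. by rewrite /segint; case: cid. Qed.

Lemma segint_opp z w : segint w z = - segint z w.
Proof.
apply: clim_unique (segint_lim w z) _.
apply: clim_eq (climZ (-1) (segint_lim z w)) => [n|]; rewrite mulN1r //.
by rewrite -trap_opp.
Qed.

Lemma segint_mid z w : segint z w = segint z ((z + w) / 2) + segint ((z + w) / 2) w.
Proof.
have := clim_comp (s := succn) _ (segint_lim z w) => /(_ (fun n => leqnSn n)) h.
apply: clim_unique h _.
exact: climD (segint_lim _ _) (segint_lim _ _).
Qed.

Lemma segint_approx z w c (r K : R) al :
  (forall x, normc (x - c) <= r -> normc (f x - al) <= K) ->
  normc (z - c) <= r -> normc (w - c) <= r ->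
  normc (segint z w - al * (w - z)) <= K * normc (w - z).
Proof.
move=> fK zr wr; apply: clim_le (segint_lim z w) _; exists 0%N => n _.
exact: trap_approx fK zr wr.
Qed.

Definition triint a b c := segint a b + segint b c + segint c a.

Lemma triint_sub a b c : triint a b c =
  triint a ((a + b) / 2) ((c + a) / 2) + triint ((a + b) / 2) b ((b + c) / 2)
  + triint ((c + a) / 2) ((b + c) / 2) c
  + triint ((a + b) / 2) ((b + c) / 2) ((c + a) / 2).
Proof.
rewrite /triint (segint_mid a b) (segint_mid b c) (segint_mid c a).
rewrite (segint_opp ((a + b) / 2) ((b + c) / 2)).
rewrite (segint_opp ((c + a) / 2) ((a + b) / 2)).
by rewrite (segint_opp ((b + c) / 2) ((c + a) / 2)); ring.
Qed.

Hypothesis f_diff : forall z, exists L, cder f z L.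

(** Goursat: near a point [f] is affine up to o(|h|), and the integral of an
    affine function over the boundary of a triangle is 0; so the integral over
    a small triangle of diameter d is at most e d^2, a bound that survives the
    subdivision of a triangle into four halves of it. *)
Lemma goursat a b c : triint a b c = 0.
Proof.
apply: normc_le_eq0 => e0 e00.
pose D := normc (b - a) + normc (c - b) + normc (a - c).
have D0 : 0 <= D by rewrite !addr_ge0 ?normc_ge0.
have DD : 0 < D ^+ 2 + 1 by rewrite ltr_wpDl // sqr_ge0.
have e_gt0 : 0 < e0 / (D ^+ 2 + 1) by rewrite divr_gt0.
have eD : e0 / (D ^+ 2 + 1) * D ^+ 2 <= e0.
  rewrite mulrAC ler_pdivrMr //; rewrite ler_wpM2l ?(ltW e00) //; lra.
move: (e0 / _) e_gt0 eD => e e_gt0 eD; apply: le_trans eD.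
pose P (x : (C * C * C) * R) := let: (a, b, c, d) := x in
  normc (b - a) <= d -> normc (c - b) <= d -> normc (a - c) <= d ->
  normc (triint a b c) <= e * d ^+ 2.
suff /(_ (a, b, c, D)) : forall x, P x.
  have := normc_ge0 (b - a); have := normc_ge0 (c - b); have := normc_ge0 (a - c).
  by move=> k1 k2 k3; apply; rewrite /D; lra.
move=> {a b c D D0 DD e0 e00}.
apply: (@bisection _ _ P (fun x => x.1.1.1) (fun x => x.2)).
  move=> [[[a b] c] d] nP; apply: contrapT => nE; apply: (nP) => ab bc ca.
  have d0 : 0 <= d := le_trans (normc_ge0 _) ab.
  pose ab2 := (a + b) / 2; pose bc2 := (b + c) / 2; pose ca2 := (c + a) / 2.
  have [ab_a b_ab] := normc_midB a b; have [bc_b c_bc] := normc_midB b c.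
  have [ca_c a_ca] := normc_midB c a.
  have h2 := two_neq0.
  have e1 : bc2 - ab2 = (c - a) / 2 by rewrite /bc2 /ab2; field.
  have e2 : ca2 - bc2 = (a - b) / 2 by rewrite /ca2 /bc2; field.
  have e3 : ab2 - ca2 = (b - c) / 2 by rewrite /ab2 /ca2; field.
  have n1 : normc (bc2 - ab2) <= d / 2 by rewrite e1 normc_half normc_distC; lra.
  have n2 : normc (ca2 - bc2) <= d / 2 by rewrite e2 normc_half normc_distC; lra.
  have n3 : normc (ab2 - ca2) <= d / 2 by rewrite e3 normc_half normc_distC; lra.
  have sub x y z : normc (x - a) <= d -> normc (y - x) <= d / 2 ->
      normc (z - y) <= d / 2 -> normc (x - z) <= d / 2 ->
      normc (triint x y z) <= e * (d / 2) ^+ 2.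
    move=> xa yx zy xz; apply: contrapT => nle; apply: nE.
    by exists (x, y, z, d / 2); split => //= h; apply: nle; apply: h.
  have t1 : normc (triint a ab2 ca2) <= e * (d / 2) ^+ 2.
    apply: sub; rewrite ?subrr ?normc0 //; first by rewrite /ab2; lra.
      by rewrite normc_distC.
    by rewrite /ca2; lra.
  have t2 : normc (triint ab2 b bc2) <= e * (d / 2) ^+ 2.
    apply: sub; rewrite /ab2 /bc2 -?/ab2 -?/bc2; first lra; first lra; first lra.
    by rewrite normc_distC.
  have t3 : normc (triint ca2 bc2 c) <= e * (d / 2) ^+ 2.
    apply: sub; first by rewrite normc_distC a_ca; lra.
    - by rewrite normc_distC.
    - by rewrite /bc2; lra.
    - by rewrite /ca2; lra.
  have t4 : normc (triint ab2 bc2 ca2) <= e * (d / 2) ^+ 2.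
    by apply: sub => //; rewrite /ab2; lra.
  rewrite triint_sub -/ab2 -/bc2 -/ca2.
  rewrite (le_trans (normcD _ _)) //.
  apply: (@le_trans _ _ (4 * (e * (d / 2) ^+ 2))); last by lra.
  have := normcD (triint a ab2 ca2) (triint ab2 b bc2).
  have := normcD (triint a ab2 ca2 + triint ab2 b bc2) (triint ca2 bc2 c).
  lra.
(* The three sides have length at most s and lie within 3 s of z. *)
move=> z; have [L /cderP dL] := f_diff z.
have [d d0 hd] := dL _ (divr_gt0 e_gt0 (ltr0Sn R 8)).
exists (d / 3); first by rewrite divr_gt0.
move=> [[[a b] c] s] /= sd az ab bc ca.
have s0 : 0 <= s := le_trans (normc_ge0 _) ab.
have az3 : normc (a - z) <= 3 * s by lra.
have bz3 : normc (b - z) <= 3 * s.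
  by rewrite (le_trans (normc_split a _ _)) //; lra.
have cz3 : normc (c - z) <= 3 * s.
  by rewrite (le_trans (normc_split a _ _)) // normc_distC; lra.
pose aff (x : C) : C := (f z - z * L) + L * x.
have fa x : normc (x - z) <= 3 * s -> normc (f x - aff x) <= e / 9 * (3 * s).
  move=> xz; have := hd (x - z); rewrite [z + _]addrC subrK.
  have -> : f x - f z - (x - z) * L = f x - aff x by rewrite /aff; ring.
  move=> h; apply: le_trans (h _) _; first by lra.
  by rewrite ler_wpM2l // ltW // divr_gt0.
rewrite -[triint a b c]subr0.
apply: clim_le (climD (climD (segint_lim a b) (segint_lim b c)) (segint_lim c a)) _.
exists 0%N => n _; rewrite subr0.
have -> : trap f n a b + trap f n b c + trap f n c a =
  trap (fun x => f x - aff x) n a b + trap (fun x => f x - aff x) n b c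
  + trap (fun x => f x - aff x) n c a.
  by rewrite !trapB /aff !trap_affine; have h2 := two_neq0; field.
have k1 := trap_bound n fa az3 bz3; have k2 := trap_bound n fa bz3 cz3.
have k3 := trap_bound n fa cz3 az3.
have lem (x y : C) : normc (y - x) <= s -> e / 9 * (3 * s) * normc (y - x) <= e / 3 * s ^+ 2.
  move=> xy; have -> : e / 3 * s ^+ 2 = e / 9 * (3 * s) * s by field.
  by rewrite ler_wpM2l // !mulr_ge0 // ltW.
have {k1}k1 := le_trans k1 (lem _ _ ab); have {k2}k2 := le_trans k2 (lem _ _ bc).
have {k3}k3 := le_trans k3 (lem _ _ ca).
rewrite (le_trans (normcD _ _)) //; rewrite (le_trans (lerD (normcD _ _) k3)) //.
have := lerD k1 k2; lra.
Qed.

(** By Goursat's theorem for the triangle 0, z, z + h, the increment of the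
    integral from 0 is the integral along the segment from z to z + h. *)
Lemma primitive_exists : exists F, forall z, cder F z (f z).
Proof.
exists (segint 0) => z; apply/cderP => e e0.
have [d d0 hd] := f_ct z e0; exists d => // h hh.
have -> : segint 0 (z + h) - segint 0 z = segint z (z + h).
  have := goursat 0 z (z + h); rewrite /triint (segint_opp 0 (z + h)).
  by move=> /eqP; rewrite subr_eq0 addrC => /eqP <-; rewrite addrK.
have := @segint_approx z (z + h) z (normc h) e (f z).
rewrite [z + h]addrC addrK mulrC; apply; rewrite ?subrr ?normc0 ?normc_ge0 //.
move=> x xh; have := hd (x - z); rewrite [z + _]addrC subrK; apply.
exact: le_lt_trans hh.
Qed.

End Segment.
End Goursat.

(** * Power series *)

Section PowerSeries.
Variable R : realType.
Local Notation C := R[i].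
Implicit Types (z w h : C) (f F : C -> C) (a b c : nat -> C).

Definition csum a s := clim (fun n => \sum_(i < n) a i) s.

Lemma clim_psum n (u : nat -> nat -> C) c z :
  (forall i, (i < n)%N -> clim (fun N => u N i) (c i)) ->
  clim (fun N => \sum_(i < n) u N i * z ^+ i) (\sum_(i < n) c i * z ^+ i).
Proof.
elim: n => [_|n IH h].
  by rewrite big_ord0; apply: clim_eq (@clim_cst R 0) => // N; rewrite big_ord0.
rewrite big_ord_recr; apply: clim_eq (climD (IH _) (climZ (z ^+ n) (h n _))) => //=.
- by move=> N; rewrite big_ord_recr /= [z ^+ n * _]mulrC.
- by rewrite [z ^+ n * _]mulrC.
- by move=> i ni; apply: h; rewrite ltnW.
Qed.

Lemma climB (u v : nat -> C) l l' :
  clim u l -> clim v l' -> clim (fun n => u n - v n) (l - l').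
Proof.
move=> ul /(climZ (-1)) vl; apply: climD ul _.
by apply: clim_eq vl => [n|]; rewrite mulN1r.
Qed.

Lemma csum_unique a s s' : csum a s -> csum a s' -> s = s'.
Proof. exact: clim_unique. Qed.

Lemma csum_eq a b s s' : a =1 b -> s = s' -> csum a s -> csum b s'.
Proof. by move=> /funext -> ->. Qed.

Lemma csumD a b s t : csum a s -> csum b t -> csum (fun i => a i + b i) (s + t).
Proof.
move=> sa sb; apply: clim_eq (climD sa sb) => // n /=.
by rewrite big_split.
Qed.

Lemma csumZ l a s : csum a s -> csum (fun i => l * a i) (l * s).
Proof.
by move=> sa; apply: clim_eq (climZ l sa) => // n; rewrite mulr_sumr.
Qed.

Lemma csum0 : csum (fun=> 0) 0.
Proof. by apply: clim_eq (@clim_cst R 0) => // n; rewrite big1. Qed.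

Lemma csum_sum n (A : nat -> nat -> C) (s : nat -> C) :
  (forall k, (k < n)%N -> csum (A k) (s k)) ->
  csum (fun i => \sum_(k < n) A k i) (\sum_(k < n) s k).
Proof.
elim: n => [|n IH] h.
  by rewrite big_ord0; apply: csum_eq csum0 => // i; rewrite big_ord0.
rewrite big_ord_recr; apply: csum_eq (csumD (IH _) (h n _)) => //=.
  by move=> i; rewrite big_ord_recr.
by move=> k kn; apply: h; rewrite ltnW.
Qed.

Lemma geo_partial a (K q : R) n k : 0 <= q -> q < 1 ->
  (forall i, normc (a i) <= K * q ^+ i) ->
  normc (\sum_(i < n + k) a i - \sum_(i < n) a i)
    <= K * (q ^+ n - q ^+ (n + k)) / (1 - q).
Proof.
move=> q0 q1 aK; elim: k => [|k IH].
  by rewrite addn0 !subrr normc0 mulr0 mul0r.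
rewrite addnS big_ord_recr /= addrAC (le_trans (normcD _ _)) //.
apply: le_trans (lerD IH (aK _)) _; rewrite exprS le_eqVlt; apply/orP; left.
apply/eqP; field; lra.
Qed.

Lemma geo_majorant_ge0 a (K q : R) :
  (forall i, normc (a i) <= K * q ^+ i) -> 0 <= K.
Proof. by move=> /(_ 0%N); rewrite mulr1; apply: le_trans (normc_ge0 _). Qed.

Lemma geo_tail a (K q : R) n s : 0 <= q -> q < 1 ->
  (forall i, normc (a i) <= K * q ^+ i) -> csum a s ->
  normc (s - \sum_(i < n) a i) <= K * q ^+ n / (1 - q).
Proof.
move=> q0 q1 aK sa; apply: clim_le sa _; exists n => m nm.
have := geo_partial n (m - n) q0 q1 aK; rewrite subnKC // => h.
apply: (le_trans h); rewrite ler_pM2r ?invr_gt0 ?subr_gt0 //.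
by rewrite ler_wpM2l ?(geo_majorant_ge0 aK) // gerBl exprn_ge0.
Qed.

Lemma geo_le a (K q : R) s : 0 <= q -> q < 1 ->
  (forall i, normc (a i) <= K * q ^+ i) -> csum a s -> normc s <= K / (1 - q).
Proof.
by move=> q0 q1 aK /(geo_tail 0 q0 q1 aK); rewrite big_ord0 subr0 mulr1.
Qed.

Lemma geo_csum a (K q : R) : 0 <= q -> q < 1 ->
  (forall i, normc (a i) <= K * q ^+ i) -> exists s, csum a s.
Proof.
move=> q0 q1 aK; apply: ccauchy_lim => e e0.
have K0 : 0 <= K / (1 - q) by rewrite divr_ge0 ?(geo_majorant_ge0 aK) ?subr_ge0 ?ltW.
have [N hN] := geo_small q0 q1 K0 (divr_gt0 e0 (ltr0Sn R 1)).
have H n : (N <= n)%N -> normc (\sum_(i < n) a i - \sum_(i < N) a i) <= e / 2.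
  move=> Nn; have := geo_partial N (n - N) q0 q1 aK; rewrite subnKC // => h.
  apply: (le_trans h); apply: le_trans (hN N (leqnn _)).
  rewrite [leRHS]mulrAC ler_pM2r ?invr_gt0 ?subr_gt0 //.
  by rewrite ler_wpM2l ?(geo_majorant_ge0 aK) // gerBl exprn_ge0.
exists N => n m /H h1 /H h2; rewrite (le_trans (normc_split (\sum_(i < N) a i) _ _)) //.
by rewrite (splitr e) lerD // normc_distC.
Qed.

Lemma csum_geometric w : normc w < 1 -> csum (fun i => w ^+ i) (1 - w)^-1.
Proof.
move=> w1; have bd i : normc (w ^+ i) <= 1 * normc w ^+ i by rewrite normcX mul1r.
have [s hs] := geo_csum (normc_ge0 w) w1 bd.
have w0 : 1 - w != 0.
  by apply: contraTneq w1 => /eqP; rewrite subr_eq0 => /eqP <-; rewrite normc1 ltxx.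
suff -> : (1 - w)^-1 = s by [].
apply: (mulfI w0); rewrite divff //.
apply: clim_unique (climZ (1 - w) hs) => e e0.
have [N hN] := geo_small (normc_ge0 w) w1 ler01 e0; exists N => n /hN.
have -> : (1 - w) * \sum_(i < n) w ^+ i = 1 - w ^+ n.
  by rewrite -opprB mulNr -subrX1 opprB.
by rewrite addrC addKr normc_opp normcX mul1r.
Qed.

(** The Cauchy bounds belong to the notion, with their constant: they are what
    makes limits of power series converge. *)
Definition pser c (M r : R) f :=
  (forall j, normc (c j) * r ^+ j <= M) /\
  (forall z, normc z < r -> csum (fun j => c j * z ^+ j) (f z)).

Lemma pser_term c (M r : R) z j : 0 < r -> normc (c j) * r ^+ j <= M ->
  normc (c j * z ^+ j) <= M * (normc z / r) ^+ j.
Proof.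
move=> r0 cM; rewrite normcM normcX.
have -> : M * (normc z / r) ^+ j = M / r ^+ j * normc z ^+ j.
  by rewrite exprMn exprVn; ring.
rewrite ler_wpM2r ?exprn_ge0 ?normc_ge0 //.
by rewrite ler_pdivlMr ?exprn_gt0.
Qed.

Lemma ratio_bounds z (r : R) : normc z < r -> [/\ 0 < r, 0 <= normc z / r & normc z / r < 1].
Proof.
move=> zr; have r0 : 0 < r := le_lt_trans (normc_ge0 _) zr.
by rewrite divr_ge0 ?normc_ge0 ?(ltW r0) // ltr_pdivrMr // mul1r.
Qed.

(** Power series with common Cauchy bounds that converge pointwise converge
    to a power series.  This gives both the analyticity of holomorphic
    functions and Weierstrass's theorem on locally uniform limits.  The
    coefficients converge one after the other: once those below [j] do, the
    series cut at [j] and evaluated near 0 determines the [j]th one up to a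
    small error. *)
Lemma pser_limit (a : nat -> nat -> C) (S : nat -> C -> C) F (M r : R) :
  0 < r -> (forall N, pser (a N) M r (S N)) ->
  (forall z, normc z < r -> clim (fun N => S N z) (F z)) ->
  exists c, pser c M r F.
Proof.
move=> r0 aS SF.
have M0 : 0 <= M by have := (aS 0%N).1 0%N; rewrite mulr1; apply: le_trans (normc_ge0 _).
have coef_cauchy j : ccauchy (fun N => a N j).
  have [n] := ubnP j; elim: n j => // n IH j; rewrite ltnS => jn e e0.
  have rj : 0 < r ^+ j by rewrite exprn_gt0.
  pose q := Num.min (1 / 2) (e * r ^+ j / (8 * (M + 1))).
  have M1 : 0 < 8 * (M + 1) by rewrite mulr_gt0 // ltr_wpDl.
  have q0 : 0 < q by rewrite lt_min !divr_gt0 // mulr_gt0.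
  have q2 : q <= 1 / 2 by rewrite ge_min lexx.
  have qe : q * (8 * (M + 1)) <= e * r ^+ j.
    by rewrite -ler_pdivlMr // ge_min lexx orbT.
  pose z : C := (q * r)%:C.
  have nz : normc z = q * r by rewrite normc_real ger0_norm // ltW // mulr_gt0.
  have zr : normc z < r by rewrite nz gtr_pMl //; lra.
  have nzr : normc z / r = q by rewrite nz mulfK ?gt_eqF.
  (* At the point [z] of modulus q r, the terms after the [j]th one add up to
     at most 2 M q^(j+1), little in comparison with [z ^+ j]. *)
  have tail N : normc (S N z - \sum_(i < j) a N i * z ^+ i - a N j * z ^+ j)
      <= 2 * M * q ^+ j.+1.
    have [_ _ qq] := ratio_bounds zr.
    have := geo_tail j.+1 (ltW (q0 : 0 < q)) _ _ ((aS N).2 z zr) => /(_ M).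
    rewrite big_ord_recr /= opprD addrA => h; apply: le_trans (h _ _) _.
    - by rewrite -nzr.
    - by move=> i; rewrite -nzr; apply: pser_term => //; apply: (aS N).1.
    - rewrite ler_pdivrMr; last by lra.
      have : 0 <= M * q ^+ j.+1 by rewrite mulr_ge0 // exprn_ge0 // ltW.
      nra.
  have vC : ccauchy (fun N => S N z - \sum_(i < j) a N i * z ^+ i).
    have : forall i, exists l, (i < j)%N -> clim (fun N => a N i) l.
      move=> i; case: (ltnP i j) => ij; last by exists 0.
      by have [l hl] := ccauchy_lim (IH i (leq_trans ij jn)); exists l.
    move=> /choice [l hl]; apply: (@clim_cauchy _ _ (F z - \sum_(i < j) l i * z ^+ i)).
    by apply: climB (SF z zr) (clim_psum z hl).
  have t0 : 0 < q * r by rewrite mulr_gt0.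
  have e20 : 0 < e / 2 * (q * r) ^+ j by rewrite mulr_gt0 ?divr_gt0 ?exprn_gt0.
  have [N0 hN0] := vC _ e20; exists N0 => n1 n2 /hN0 h /h {}h.
  have tj : 0 < (q * r) ^+ j by rewrite exprn_gt0.
  rewrite -(ler_pM2r tj) -nz -normcX -normcM mulrBl.
  have k1 := tail n1; have k2 := tail n2.
  set v1 := S n1 z - _ in h k1; set v2 := S n2 z - _ in h k2.
  have -> : a n1 j * z ^+ j - a n2 j * z ^+ j
     = (v1 - v2) - (v1 - a n1 j * z ^+ j) + (v2 - a n2 j * z ^+ j) by ring.
  rewrite (le_trans (normcD _ _)) // normcX nz.
  rewrite (le_trans (lerD (normcB _ _) k2)) //.
  rewrite (le_trans (lerD (lerD h k1) (lexx _))) //.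
  have : q ^+ j.+1 * (8 * (M + 1)) <= e * (q * r) ^+ j.
    by rewrite exprSr -mulrA exprMn [leRHS]mulrCA ler_wpM2l // exprn_ge0 // ltW.
  have : 0 <= q ^+ j.+1 by rewrite exprn_ge0 // ltW.
  lra.
have /choice [c hc] : forall j, exists l, clim (fun N => a N j) l.
  by move=> j; apply: ccauchy_lim.
have cM j : normc (c j) * r ^+ j <= M.
  rewrite -ler_pdivlMr ?exprn_gt0 // -[c j]subr0; apply: clim_le (hc j) _.
  by exists 0%N => N _; rewrite subr0 ler_pdivlMr ?exprn_gt0 //; apply: (aS N).1.
exists c; split => // z zr e e0.
have [_ q0 q1] := ratio_bounds zr.
have K0 : 0 <= M / (1 - normc z / r) by rewrite divr_ge0 // subr_ge0 ltW.
have [n0 hn0] := geo_small q0 q1 K0 e0; exists n0 => n /hn0 hn.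
rewrite -[_ - F z]subr0.
have H : clim (fun N => \sum_(i < n) a N i * z ^+ i - S N z) (\sum_(i < n) c i * z ^+ i - F z).
  exact: climB (clim_psum z (fun i _ => hc i)) (SF z zr).
apply: clim_le H _; exists 0%N => N _; rewrite subr0 normc_distC.
have bd i : normc (a N i * z ^+ i) <= M * (normc z / r) ^+ i.
  by apply: pser_term => //; apply: (aS N).1.
by apply: le_trans (geo_tail n q0 q1 bd ((aS N).2 z zr)) _; rewrite mulrAC.
Qed.

End PowerSeries.

(** * Termwise differentiation *)

Section TermwiseDerivative.
Variable R : realType.
Local Notation C := R[i].
Implicit Types (z w h : C) (f F : C -> C) (a b c : nat -> C).

Lemma nat_geo_bound (q : R) n : 0 <= q -> q < 1 -> n%:R * q ^+ n <= (1 - q)^-1.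
Proof.
move=> q0 q1; have q10 : 0 < 1 - q by rewrite subr_gt0.
rewrite -[leRHS]mul1r ler_pdivlMr //.
have h : n%:R * q ^+ n <= \sum_(i < n) q ^+ i.
  have -> : n%:R * q ^+ n = \sum_(i < n) q ^+ n.
    by rewrite sumr_const card_ord mulr_natl.
  by apply: ler_sum => i _; apply: ler_wiXn2l => //; [exact: ltW | exact/ltnW].
apply: le_trans (ler_wpM2r (ltW q10) h) _.
have := subrX1 q n; have : 0 <= q ^+ n by rewrite exprn_ge0.
by move=> h1 h2; rewrite mulrC -opprB mulNr -h2; lra.
Qed.

(** n t^n is bounded for t < 1; take t to be the fourth root of [q], so that
    n^2 q^n = (n t^n)^2 (t^2)^n. *)
Lemma nat_geo_decay (q : R) : 0 <= q -> q < 1 -> exists B s : R,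
  [/\ 0 <= B, 0 <= s, s < 1 & forall n, n%:R ^+ 2 * q ^+ n <= B * s ^+ n].
Proof.
move=> q0 q1; pose s := Num.sqrt q; pose t := Num.sqrt s.
have s0 : 0 <= s by rewrite sqrtr_ge0.
have t0 : 0 <= t by rewrite sqrtr_ge0.
have s1 : s < 1 by rewrite -sqrtr1 ltr_sqrt.
have t1 : t < 1 by rewrite -sqrtr1 ltr_sqrt.
exists ((1 - t)^-1 ^+ 2), s; split => //; first by rewrite exprn_ge0 // invr_ge0 subr_ge0 ltW.
move=> n; have -> : q = t ^+ 2 * s by rewrite sqr_sqrtr // -expr2 sqr_sqrtr.
rewrite exprMn mulrA ler_wpM2r ?exprn_ge0 // exprAC -exprMn.
by rewrite ler_sqr ?nnegrE ?mulr_ge0 ?exprn_ge0 ?invr_ge0 ?subr_ge0 ?(ltW t1) // nat_geo_bound.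
Qed.

(** The factor [p ^+ 2] on the left stands for p^(n - 2) on the right. *)
Lemma expr_taylor1 z h (p : R) n : 0 < p -> normc z <= p -> normc (z + h) <= p ->
  normc ((z + h) ^+ n - z ^+ n - h * (n%:R * z ^+ n.-1)) * p ^+ 2
    <= n%:R ^+ 2 * p ^+ n * normc h ^+ 2.
Proof.
move=> p0 zp zhp; elim: n => [|n IH].
  by rewrite !expr0 [0 ^+ 2]expr2 !mul0r mulr0 subr0 subrr normc0 mul0r.
have -> : (z + h) ^+ n.+1 - z ^+ n.+1 - h * (n.+1%:R * z ^+ n.+1.-1)
  = (z + h) * ((z + h) ^+ n - z ^+ n - h * (n%:R * z ^+ n.-1))
    + n%:R * z ^+ n.-1 * h ^+ 2.
  rewrite /= -natr1; case: n {IH} => [|n] /=; first by rewrite !expr0 !expr1; ring.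
  rewrite (exprS z n.+1) (exprS z n) (exprS (z + h) n.+1).
  by move: (z ^+ n) ((z + h) ^+ n.+1) (n.+1%:R : C) => A B m; ring.
rewrite (le_trans (ler_wpM2r _ (normcD _ _))) ?exprn_ge0 ?(ltW p0) // mulrDl.
have k1 : normc ((z + h) * ((z + h) ^+ n - z ^+ n - h * (n%:R * z ^+ n.-1))) * p ^+ 2
   <= p * (n%:R ^+ 2 * p ^+ n * normc h ^+ 2).
  rewrite normcM -mulrA; apply: ler_pM => //; rewrite ?normc_ge0 //.
  by rewrite mulr_ge0 ?normc_ge0 ?exprn_ge0 // ltW.
have k2 : normc (n%:R * z ^+ n.-1 * h ^+ 2) * p ^+ 2 <= n%:R * p ^+ n.+1 * normc h ^+ 2.
  rewrite normcM [normc (n%:R * _)]normcM !normcX normc_nat mulrAC ler_wpM2r ?exprn_ge0 ?normc_ge0 //.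
  case: n {IH k1} => [|n]; first by rewrite !mul0r.
  rewrite -mulrA ler_wpM2l //.
  rewrite /= -[n.+2]addn2 exprD ler_wpM2r ?exprn_ge0 ?(ltW p0) //.
  by rewrite lerXn2r ?nnegrE ?normc_ge0 // ltW.
apply: le_trans (lerD k1 k2) _.
have H0 : 0 <= p ^+ n.+1 * normc h ^+ 2.
  by rewrite mulr_ge0 ?exprn_ge0 ?normc_ge0 // ltW.
rewrite -natr1; have n0 : 0 <= n%:R :> R by [].
have -> : p * (n%:R ^+ 2 * p ^+ n * normc h ^+ 2) + n%:R * p ^+ n.+1 * normc h ^+ 2
 = (n%:R ^+ 2 + n%:R) * (p ^+ n.+1 * normc h ^+ 2) by rewrite (exprS p n); ring.
rewrite -mulrA ler_wpM2r //; nra.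
Qed.

Lemma pser_deriv c (M r : R) f z : pser c M r f -> normc z < r -> exists L,
  csum (fun j => j.+1%:R * c j.+1 * z ^+ j) L /\ cder f z L.
Proof.
move=> [cM fc] zr; have [r0 _ _] := ratio_bounds zr.
have [p zp pr] : exists2 p, normc z < p & p < r.
  by exists ((normc z + r) / 2); lra.
have p0 : 0 < p := le_lt_trans (normc_ge0 _) zp.
have q0 : 0 <= p / r by rewrite divr_ge0 // ltW.
have q1 : p / r < 1 by rewrite ltr_pdivrMr // mul1r.
have [B [s [B0 s0 s1 hB]]] := nat_geo_decay q0 q1.
have M0 : 0 <= M by have := cM 0%N; rewrite mulr1; apply: le_trans (normc_ge0 _).
have cb j : normc (c j) * (j%:R ^+ 2 * p ^+ j) <= M * B * s ^+ j.
  have := hB j; rewrite exprMn exprVn [_ * (p ^+ j / _)]mulrA ler_pdivrMr ?exprn_gt0 // => h.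
  apply: (le_trans (ler_wpM2l (normc_ge0 _) h)).
  have -> : normc (c j) * (B * s ^+ j * r ^+ j) = (normc (c j) * r ^+ j) * (B * s ^+ j) by ring.
  by rewrite -[leRHS]mulrA ler_wpM2r // mulr_ge0 ?exprn_ge0.
pose d j := j%:R * c j * z ^+ j.-1.
have db j : normc (d j) <= M * B / p * s ^+ j.
  case: j => [|j]; first by rewrite /d !mul0r normc0 mulr1 divr_ge0 ?mulr_ge0 // ltW.
  rewrite mulrAC ler_pdivlMr //; apply: le_trans (cb j.+1).
  have -> : normc (d j.+1) * p = normc (c j.+1) * (j.+1%:R * (normc z ^+ j * p)).
    by rewrite /d !normcM normcX normc_nat /=; ring.
  rewrite ler_wpM2l ?normc_ge0 //; apply: ler_pM => //.
  - by rewrite mulr_ge0 ?exprn_ge0 ?normc_ge0 // ltW.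
  - by rewrite expr2 ler_peMr // ler1n.
  - by rewrite exprSr ler_wpM2r ?(ltW p0) // lerXn2r ?nnegrE ?normc_ge0 // ltW.
have [L dL] := geo_csum s0 s1 db; exists L; split.
  move=> e /dL [N hN]; exists N => n Nn; have := hN n.+1 (leqW Nn).
  by rewrite big_ord_recl /d !mul0r add0r.
pose K := M * B / (1 - s) / p ^+ 2.
have K0 : 0 <= K by rewrite !divr_ge0 ?mulr_ge0 ?exprn_ge0 ?subr_ge0 // ltW.
have H h : normc h < p - normc z -> normc (f (z + h) - f z - h * L) <= K * normc h ^+ 2.
  move=> hp; have zhp : normc (z + h) <= p by rewrite (le_trans (normcD _ _)) //; lra.
  have zhr : normc (z + h) < r := le_lt_trans zhp pr.
  rewrite -[X in normc X]subr0.
  apply: clim_le (climB (climB (fc _ zhr) (fc _ zr)) (climZ h dL)) _.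
  exists 0%N => n _; rewrite subr0 mulr_sumr -!sumrB.
  have tb j : normc (c j * (z + h) ^+ j - c j * z ^+ j - h * d j)
      <= M * B * normc h ^+ 2 / p ^+ 2 * s ^+ j.
    have -> : c j * (z + h) ^+ j - c j * z ^+ j - h * d j
      = c j * ((z + h) ^+ j - z ^+ j - h * (j%:R * z ^+ j.-1)) by rewrite /d; ring.
    rewrite [leRHS]mulrAC ler_pdivlMr ?exprn_gt0 // normcM -[leLHS]mulrA.
    apply: (le_trans (ler_wpM2l (normc_ge0 _) (expr_taylor1 j p0 (ltW zp) zhp))).
    by rewrite [leLHS]mulrA [leRHS]mulrAC ler_wpM2r ?exprn_ge0 ?normc_ge0.
  have := geo_partial 0 n s0 s1 tb; rewrite add0n big_ord0 subr0 => k.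
  apply: (le_trans k); rewrite expr0 /K.
  have -> : M * B / (1 - s) / p ^+ 2 * normc h ^+ 2
    = M * B * normc h ^+ 2 / p ^+ 2 * 1 / (1 - s) by ring.
  rewrite ler_pM2r ?invr_gt0 ?subr_gt0 // ler_wpM2l //.
    by rewrite divr_ge0 ?mulr_ge0 ?exprn_ge0 ?normc_ge0 // ltW.
  by rewrite gerBl exprn_ge0.
apply/cderP => e e0; have K1 : 0 < K + 1 by rewrite ltr_wpDl.
exists (Num.min (p - normc z) (e / (K + 1))).
  by rewrite lt_min subr_gt0 zp divr_gt0.
move=> h; rewrite lt_min => /andP[/H hh h2]; apply: (le_trans hh).
rewrite expr2 mulrA ler_wpM2r ?normc_ge0 //.
apply: le_trans (ler_wpM2l K0 (ltW h2)) _.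
by rewrite mulrCA ler_piMr ?(ltW e0) // ler_pdivrMr //; lra.
Qed.

Lemma pser_deriv_pser c (M r p : R) f f' : pser c M r f -> 0 < p -> p < r ->
  (forall z, cder f z (f' z)) ->
  exists M', pser (fun j => j.+1%:R * c j.+1) M' p f'.
Proof.
move=> cf p0 pr ff'; have r0 := lt_trans p0 pr.
have q0 : 0 <= p / r by rewrite divr_ge0 // ltW.
have q1 : p / r < 1 by rewrite ltr_pdivrMr // mul1r.
have M0 : 0 <= M by have := cf.1 0%N; rewrite mulr1; apply: le_trans (normc_ge0 _).
exists (M * (1 - p / r)^-1 / p); split=> [j|z zp].
  rewrite ler_pdivlMr // -[leLHS]mulrA -exprSr normcM normc_nat.
  have h : normc (c j.+1) <= M / r ^+ j.+1.
    by rewrite ler_pdivlMr ?exprn_gt0 //; apply: cf.1.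
  have h1 : j.+1%:R * normc (c j.+1) <= j.+1%:R * (M / r ^+ j.+1) by apply: ler_wpM2l h; rewrite ler0n.
  have pj : 0 <= p ^+ j.+1 by rewrite exprn_ge0 // ltW.
  apply: (le_trans (ler_wpM2r pj h1)).
  have := nat_geo_bound j.+1 q0 q1; rewrite exprMn exprVn => k.
  apply: le_trans (ler_wpM2l M0 k); rewrite le_eqVlt; apply/orP; left; apply/eqP; ring.
have [L [sL dL]] := pser_deriv cf (lt_trans zp pr).
by rewrite (cder_unique (ff' z) dL).
Qed.

End TermwiseDerivative.

(** * Cauchy's formula *)

Section Cauchy.
Variable R : realType.
Local Notation C := R[i].
Implicit Types (z w h : C) (f F : C -> C) (c : nat -> C).

Section DiscreteCauchy.
Variables (f F : C -> C) (r M : R).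
Hypothesis r0 : 0 < r.
Hypothesis Ff : forall z, cder F z (f z).
Hypothesis f_ct : forall z, cctn f z.
Hypothesis FM : forall z, normc z <= r -> normc (F z) <= M.

Let om N : C := unity_root R N.
Let zt N k : C := r%:C * om N ^+ k.

Let normc_zt N k : normc (zt N k) = r.
Proof.
by rewrite normcM normcX normc_unity_root expr1n mulr1 normc_real ger0_norm // ltW.
Qed.

Let zt_neq0 N k : zt N k != 0.
Proof. by rewrite -normc_gt0 normc_zt. Qed.

Let zt_sub N k z : normc z < r -> zt N k - z != 0.
Proof.
by move=> zr; apply: contraTneq zr => /eqP; rewrite subr_eq0 => /eqP <-;
  rewrite normc_zt ltxx.
Qed.

Let ztS N k : zt N k.+1 - zt N k = zt N k * (om N - 1).
Proof. by rewrite /zt exprSr; ring. Qed.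

Let zt_expN N k : (0 < N)%N -> zt N k ^+ N = r%:C ^+ N.
Proof.
by move=> N0; rewrite exprMn -exprM mulnC exprM unity_root_exp // expr1n mulr1.
Qed.

Let zt_sum N : (1 < N)%N -> \sum_(k < N) zt N k = 0.
Proof.
move=> N1; rewrite -mulr_sumr; have := @unity_root_sum R N 1.
by rewrite expr1 N1 => -> //; rewrite mulr0.
Qed.

(** Sums over the [N]th roots of unity replace contour integrals: the sum of
    f(p k) (p k.+1 - p k) nearly telescopes to 0, since it nearly is the sum
    of F(p k.+1) - F(p k). *)
Let telescope_bound N z (t d eta : R) : (1 < N)%N -> 0 <= t <= 1 -> normc z <= r ->
  0 <= eta ->
  (forall x h, normc x <= r -> normc h < d -> normc (f (x + h) - f x) <= eta) ->
  r * normc (om N - 1) < d ->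
  normc (\sum_(k < N) f (z + t%:C * (zt N k - z)) * zt N k) <= N%:R * (eta * r).
Proof.
move=> N1 /andP[t0 t1] zr eta0 fu hd.
have [->|tn0] := eqVneq t 0.
  under eq_bigr do rewrite mul0r addr0.
  by rewrite -mulr_sumr zt_sum // mulr0 normc0 !mulr_ge0 // ltW.
pose p k := z + t%:C * (zt N k - z).
pose err k := F (p k.+1) - F (p k) - f (p k) * (p k.+1 - p k).
have tt : normc t%:C = t by rewrite normc_real ger0_norm.
have pS k : p k.+1 - p k = t%:C * (om N - 1) * zt N k.
  by rewrite /p -[t%:C * (om N - 1) * _]mulrA [(om N - 1) * _]mulrC -ztS; ring.
have npS k : normc (p k.+1 - p k) = t * normc (om N - 1) * r.
  by rewrite pS (normcM _ (zt N k)) (normcM t%:C) normc_zt tt.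
have om1 : om N - 1 != 0.
  by rewrite subr_eq0; have := @unity_root_prim R N 1; rewrite expr1; apply.
have pr k : normc (p k) <= r.
  have -> : p k = (1 - t)%:C * z + t%:C * zt N k by rewrite /p rmorphB /=; ring.
  rewrite (le_trans (normcD _ _)) // (normcM _ z) (normcM _ (zt N k)) normc_zt !normc_real !ger0_norm ?subr_ge0 //.
  have : (1 - t) * normc z <= (1 - t) * r by rewrite ler_wpM2l ?subr_ge0.
  lra.
have errk k : normc (err k) <= eta * normc (p k.+1 - p k).
  have pd : normc (p k.+1 - p k) < d.
    rewrite npS -mulrA (le_lt_trans _ hd) // mulrC [_ * r]mulrC.
    by rewrite ler_piMr // mulr_ge0 ?normc_ge0 // ltW.
  set dl := p k.+1 - p k in pd *.
  pose g x := F (p k + x * dl) - x * (f (p k) * dl).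
  have -> : err k = g 1 - g 0.
    by rewrite /err /g !mul0r addr0 !mul1r subr0 -/dl /dl [p k + _]addrC subrK; ring.
  apply: mean_value => s /andP[s0 s1].
  exists (dl * f (p k + s%:C * dl) - f (p k) * dl).
    apply: cderB.
      have d1 := cderD (cder_cst (p k) s%:C) (cderM (cder_id s%:C) (cder_cst dl s%:C)).
      apply: cder_eq (cder_comp d1 (Ff _)) => //; rewrite mul1r mulr0 addr0 add0r //.
    apply: cder_eq (cderM (cder_id s%:C) (cder_cst (f (p k) * dl) s%:C)) => //.
    by rewrite mul1r mulr0 addr0.
  rewrite [f (p k) * _]mulrC -mulrBr normcM mulrC ler_wpM2r ?normc_ge0 //.
  apply: fu => //; rewrite normcM normc_real ger0_norm //.
  by rewrite (le_lt_trans _ pd) // ler_piMl ?normc_ge0.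
have pN : p N = p 0%N by rewrite /p /zt unity_root_exp ?expr0 // ltnW.
have key : t%:C * (om N - 1) * (\sum_(k < N) f (p k) * zt N k) = - \sum_(k < N) err k.
  have -> : \sum_(k < N) err k = (F (p N) - F (p 0%N)) - \sum_(k < N) f (p k) * (p k.+1 - p k).
    rewrite -(telescope_sumr (fun k => F (p k)) (leq0n N)) big_mkord -sumrB.
    by [].
  rewrite pN subrr sub0r opprK mulr_sumr; apply: eq_bigr => k _.
  by rewrite pS; ring.
have X0 : 0 < normc (t%:C * (om N - 1)).
  by rewrite normc_gt0 mulf_neq0 // -normc_gt0 tt lt0r tn0.
rewrite -(ler_pM2l X0) -normcM key normc_opp.
apply: (le_trans (normc_mean_le (b := eta * (t * normc (om N - 1) * r)) _)).
  by move=> k _; rewrite -(npS k).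
by rewrite normcM tt le_eqVlt; apply/orP; left; apply/eqP; ring.
Qed.

(** Discrete Fourier coefficients of [F] on the circle of radius [r], which
    are also the coefficients of [kernel_sum N] as a power series. *)
Let coef N j : C := N%:R^-1 * \sum_(k < N) F (zt N k) * (zt N k ^+ j)^-1.

Let kernel_sum N z : C := N%:R^-1 * \sum_(k < N) F (zt N k) * (zt N k / (zt N k - z)).

Let nzN N : (0 < N)%N -> (N%:R : C) != 0.
Proof. by rewrite pnatr_eq0 lt0n. Qed.

Let normc_mean N (G : nat -> C) (b : R) : (0 < N)%N ->
  (forall k, (k < N)%N -> normc (G k) <= b) -> normc (N%:R^-1 * \sum_(k < N) G k) <= b.
Proof.
move=> N0 h; rewrite normcM normcV normc_nat mulrC ler_pdivrMr ?ltr0n //.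
by rewrite mulrC; apply: normc_mean_le.
Qed.

Let coef_pser N : (0 < N)%N -> pser (coef N) M r (kernel_sum N).
Proof.
move=> N0; split=> [j|z zr].
  rewrite -ler_pdivlMr ?exprn_gt0 //.
  apply: (normc_mean (G := fun k => F (zt N k) * (zt N k ^+ j)^-1)) => // k _.
  rewrite normcM normcV normcX normc_zt ler_wpM2r ?invr_ge0 ?exprn_ge0 ?(ltW r0) //.
  by apply: FM; rewrite normc_zt.
have h k : (k < N)%N -> csum (fun j => F (zt N k) * (z / zt N k) ^+ j)
    (F (zt N k) * (zt N k / (zt N k - z))).
  move=> _; apply: csumZ; apply: csum_eq (csum_geometric (w := z / zt N k) _) => //.
    by field; rewrite zt_neq0 zt_sub.
  by rewrite normcM normcV normc_zt ltr_pdivrMr // mul1r.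
apply: csum_eq (csumZ (N%:R^-1) (csum_sum h)) => // j.
rewrite /coef -mulrA; congr (_ * _); rewrite mulr_suml; apply: eq_bigr => k _.
by rewrite exprMn exprVn; ring.
Qed.

(** The kernel sum of the constant function 1. *)
Let weight N z : C := N%:R^-1 * \sum_(k < N) zt N k / (zt N k - z).

Let weightE N z : (0 < N)%N -> normc z < r -> (1 - (z / r%:C) ^+ N) * weight N z = 1.
Proof.
move=> N0 zr; rewrite /weight mulrCA; apply: (mulfI (nzN N0)).
rewrite [LHS]mulrA divff ?nzN // mul1r mulr1 mulr_sumr.
have geo k : (1 - (z / r%:C) ^+ N) * (zt N k / (zt N k - z)) = \sum_(j < N) (z / zt N k) ^+ j.
  have -> : (z / r%:C) ^+ N = (z / zt N k) ^+ N by rewrite !exprMn !exprVn zt_expN.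
  have -> : 1 - (z / zt N k) ^+ N = (1 - z / zt N k) * \sum_(j < N) (z / zt N k) ^+ j.
    by rewrite -opprB subrX1 -mulNr opprB.
  have -> : zt N k / (zt N k - z) = (1 - z / zt N k)^-1.
    by field; rewrite zt_neq0 zt_sub.
  rewrite mulrAC mulfV ?mul1r //.
  have -> : 1 - z / zt N k = (zt N k - z) / zt N k by field.
  by rewrite mulf_neq0 ?invr_neq0 ?zt_sub.
(* In the double sum, only the powers of exponent [j = 0] do not cancel. *)
under eq_bigr do rewrite geo.
rewrite exchange_big /=; case: N N0 geo => // N _ _.
rewrite big_ord_recl [X in _ + X]big1 ?addr0.
  by rewrite (eq_bigr (fun=> 1)) ?sumr_const ?card_ord // => i _; rewrite expr0.
move=> j _; pose l := lift ord0 j.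
have rn : r%:C != 0 by rewrite -normc_gt0 normc_real gtr0_norm.
rewrite (eq_bigr (fun k : 'I_N.+1 => (z / r%:C) ^+ l * (om N.+1 ^+ (N.+1 - l)) ^+ k)).
  rewrite -mulr_sumr unity_root_sum ?mulr0 // subn_gt0 ltn_ord /=.
  by rewrite ltn_subrL.
move=> k _; rewrite -/l !exprMn -!mulrA; congr (_ * _).
rewrite exprVn exprMn invfM exprVn; congr (_ * _).
rewrite -!exprM [X in _ = om _ ^+ X]mulnC.
have omn0 : om N.+1 != 0 by rewrite -normc_gt0 normc_unity_root.
apply: (mulfI (expf_neq0 (k * l) omn0)); rewrite divff ?expf_neq0 //.
rewrite -exprD -mulnDr subnKC ?(ltnW (ltn_ord l)) //.
by rewrite mulnC exprM unity_root_exp // expr1n.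
Qed.

Let weight_lim z : normc z < r -> clim (fun N => weight N.+2 z) 1.
Proof.
move=> zr e e0; have [_ q0 q1] := ratio_bounds zr.
have rz : 0 < r - normc z by rewrite subr_gt0.
have K0 : 0 <= r / (r - normc z) by rewrite divr_ge0 // ltW.
have [N hN] := geo_small q0 q1 K0 e0; exists N => n Nn.
have nn : (N <= n.+2)%N by rewrite (leq_trans Nn) // -addn2 leq_addr.
apply: le_trans (hN _ nn); have we := weightE (ltn0Sn n.+1) zr.
have -> : weight n.+2 z - 1 = (z / r%:C) ^+ n.+2 * weight n.+2 z.
  by rewrite -[X in _ - X]we; ring.
rewrite normcM normcX normcM normcV normc_real gtr0_norm // mulrC.
rewrite ler_wpM2r ?exprn_ge0 //.
apply: (normc_mean (G := fun k => zt n.+2 k / (zt n.+2 k - z))) => // k _.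
rewrite normcM normcV normc_zt ler_wpM2l ?(ltW r0) // lef_pV2 ?posrE //.
  have := normcD (zt n.+2 k - z) z; rewrite subrK normc_zt; lra.
by rewrite normc_gt0 zt_sub.
Qed.

Let kernel_sum_lim z : normc z < r -> clim (fun N => kernel_sum N.+2 z) (F z).
Proof.
move=> zr.
suff H : clim (fun N => kernel_sum N.+2 z - weight N.+2 z * F z) 0.
  have := climD H (climZ (F z) (weight_lim zr)); rewrite mulr1 add0r.
  by apply: clim_eq => // N /=; rewrite [F z * _]mulrC subrK.
move=> e e0.
have e1 : 0 < e / r by rewrite divr_gt0.
have [d d0 hd] := cctn_unif f_ct r e1.
have [N hN] := unity_root_lim (divr_gt0 d0 r0).
exists N => n Nn; rewrite subr0; set m := n.+2.
have mN : (N <= m)%N by rewrite /m (leq_trans Nn) // -addn2 leq_addr.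
have omd : r * normc (om m - 1) < d by rewrite mulrC -ltr_pdivlMr // hN.
(* Contract the circle to [z]: [F] is sampled at z + x (zt k - z), so that
   the derivative in [x] is one of the sums that nearly telescope. *)
pose A x := m%:R^-1 * \sum_(k < m) F (z + x * (zt m k - z)) * (zt m k / (zt m k - z)).
have -> : kernel_sum m z - weight m z * F z = A 1 - A 0.
  congr (_ - _).
    by congr (_ * _); apply: eq_bigr => k _; rewrite mul1r [z + _]addrC subrK.
  rewrite /weight -mulrA mulr_suml; congr (_ * _); apply: eq_bigr => k _.
  by rewrite mul0r addr0 mulrC.
apply: mean_value => t t01.
exists (m%:R^-1 * \sum_(k < m) f (z + t%:C * (zt m k - z)) * zt m k).
  apply: cderZ; apply: (@cder_sum R m (fun k x => F (z + x * (zt m k - z)) * (zt m k / (zt m k - z)))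
    (fun k => f (z + t%:C * (zt m k - z)) * zt m k)) => k _.
  have d1 := cderD (cder_cst z t%:C) (cderM (cder_id t%:C) (cder_cst (zt m k - z) t%:C)).
  apply: cder_eq (cderM (cder_comp d1 (Ff _)) (cder_cst (zt m k / (zt m k - z)) t%:C)) => //.
  by field; rewrite zt_sub.
rewrite normcM normcV normc_nat mulrC ler_pdivrMr ?ltr0n //.
have := telescope_bound (isT : (1 < m)%N) t01 (ltW zr) (ltW e1) hd omd.
by rewrite mulfVK ?gt_eqF // mulrC.
Qed.

Lemma cauchy_pser : exists c, pser c M r F.
Proof.
exact: pser_limit r0 (fun N => coef_pser (ltn0Sn N.+1)) kernel_sum_lim.
Qed.

End DiscreteCauchy.
End Cauchy.

(** * Entire functions *)

Section Entire.
Variable R : realType.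
Local Notation C := R[i].
Implicit Types (z w h : C) (f g F : C -> C) (c : nat -> C).

Lemma normr_normc (x : C) : `|x| = (normc x)%:C.
Proof. by case: x => a b; rewrite normc_def. Qed.

Lemma posc_real (e : C) : 0 < e -> exists2 d : R, 0 < d & e = d%:C.
Proof.
case: e => a b; rewrite ltcE /= => /andP[/eqP -> a0]; by exists a.
Qed.

Lemma cder_cvg f z L : cder f z L <->
  (h^-1 *: ((f : CC R -> CC R) (h *: 1 + z) - f z) @[h --> (0 : (R[i] : numFieldType))^'] --> (L : CC R)).
Proof.
split=> [/cderP df|].
  apply/cvgrPdist_le => e /posc_real [d d0 ->].
  have [t t0 ht] := df _ d0.
  rewrite -nbhs_nearE; apply/nbhs_ballP; exists t%:C; first by rewrite /= ltcR.
  move=> h /=; rewrite -ball_normE /= sub0r normrN normr_normc ltcR => hh h0.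
  rewrite (_ : `|_| = (normc (L - h^-1 * (f (h * 1 + z) - f z)))%:C); last exact: normr_normc.
  rewrite lecR; have := ht h hh; rewrite mulr1 [h + z]addrC.
  have -> : f (z + h) - f z - h * L = - ((L - h^-1 * (f (z + h) - f z)) * h) by field.
  by rewrite normc_opp normcM ler_pM2r ?normc_gt0.
move=> /cvgrPdist_le df; apply/cderP => e e0.
have e0' : (0 : C) < e%:C by rewrite ltcR.
have := df _ e0'; rewrite -nbhs_nearE => /nbhs_ballP [d' /= /posc_real [d d0 ->] hd].
exists d => // h hh; have [->|h0] := eqVneq h 0.
  by rewrite addr0 mul0r subr0 subrr normc0 mulr0.
have := hd h; rewrite -ball_normE /= sub0r normrN normr_normc ltcR => /(_ hh h0).
rewrite (_ : `|_| = (normc (L - h^-1 * (f (h * 1 + z) - f z)))%:C); last exact: normr_normc.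
rewrite lecR mulr1 [h + z]addrC.
have -> : f (z + h) - f z - h * L = - ((L - h^-1 * (f (z + h) - f z)) * h) by field.
by rewrite normc_opp normcM ler_pM2r ?normc_gt0.
Qed.

Definition holo f := forall z, exists L, cder f z L.

(** [derive1n] with [R[i]] in place of the regular module over it. *)
Definition dern n f : C -> C := derive1n n (f : CC R -> CC R).

Lemma dernE f z L : cder f z L -> dern 1 f z = L.
Proof.
move=> /cder_cvg; rewrite /dern derive1n1 derive1E /derive => h.
exact: (cvg_lim _ h).
Qed.

Lemma dern0 f : dern 0 f = f.
Proof. by []. Qed.

Lemma dernS n f : dern n.+1 f = dern n (dern 1 f).
Proof. by rewrite /dern derive1Sn derive1n1. Qed.

Opaque dern.

Lemma holo_dern f z : holo f -> cder f z (dern 1 f z).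
Proof. by move=> /(_ z) [L dL]; rewrite (dernE dL). Qed.

Lemma entireE f : entire (f : CC R -> CC R) <-> holo f.
Proof.
split=> ef z.
  have := ef z => /cvg_ex [L h]; exists L; exact/cder_cvg.
by have [L /cder_cvg h] := ef z; apply/cvg_ex; exists L.
Qed.

Lemma holo_cctn f : holo f -> forall z, cctn f z.
Proof. by move=> hf z; have [L /cder_cctn] := hf z. Qed.

Lemma holo_bounded f r : holo f -> exists2 M, 0 <= M & forall z, normc z <= r -> normc (f z) <= M.
Proof.
move=> /holo_cctn/cctn_bounded => /(_ r) [M hM]; exists (Num.max 0 M).
  by rewrite le_max lexx.
by move=> z /hM h; rewrite le_max h orbT.
Qed.

Lemma holo_C1_pser f (r M : R) : holo f -> (forall z, cctn (dern 1 f) z) -> 0 < r ->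
  (forall z, normc z <= r -> normc (f z) <= M) -> exists c, pser c M r f.
Proof.
move=> hf cf r0 fM; apply: (cauchy_pser r0 _ cf fM) => z; exact: holo_dern.
Qed.

(** [f] has a primitive [F], to which Cauchy's formula applies since its
    derivative [f] is continuous; so [F] is analytic, hence so is [f]. *)
Lemma holo_deriv f : holo f -> holo (dern 1 f).
Proof.
move=> hf z; have [F dF] := primitive_exists (holo_cctn hf) hf.
have hF : holo F by move=> w; exists (f w).
have F1 : dern 1 F = f by apply/funext => w; apply: dernE.
pose r := normc z + 3.
have r0 : 0 < r by rewrite ltr_wpDl ?normc_ge0.
have [M _ FM] := holo_bounded r hF.
have [|c cF] := holo_C1_pser hF _ r0 FM; first by rewrite F1; apply: holo_cctn.
(* Each differentiation of a power series shrinks the disc. *)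
have p2 : 0 < r - 1 by rewrite /r; have := normc_ge0 z; lra.
have p1 : 0 < r - 2 by rewrite /r; have := normc_ge0 z; lra.
have [r1 r2] : r - 1 < r /\ r - 2 < r - 1 by split; lra.
have [M' cf] := pser_deriv_pser cF p2 r1 dF.
have [M'' cf1] := pser_deriv_pser cf p1 r2 (fun w => holo_dern w hf).
have [|L [_ dL]] := pser_deriv cf1 (_ : normc z < r - 2); first by rewrite /r; lra.
by exists L.
Qed.

Lemma holo_pser f (r M : R) : holo f -> 0 < r ->
  (forall z, normc z <= r -> normc (f z) <= M) -> exists c, pser c M r f.
Proof.
move=> hf r0 fM; apply: holo_C1_pser => //; exact/holo_cctn/holo_deriv.
Qed.

Lemma dern_coef c (M r : R) f n : holo f -> 0 < r -> pser c M r f ->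
  dern n f 0 = n`!%:R * c n.
Proof.
elim: n c M r f => [|n IH] c M r f hf r0 cf.
  have [h0 hz] : normc (0 : C) < r /\ (0%N`!%:R : C) = 1 by rewrite normc0.
  rewrite hz mul1r; apply: csum_unique (cf.2 0 h0) _ => e e0.
  exists 1%N => -[//|m] _; rewrite big_ord_recl expr0 mulr1 big1 ?addr0.
    by rewrite subrr normc0 ltW.
  by move=> i _; rewrite exprS mul0r mulr0.
have p0 : 0 < r / 2 by rewrite divr_gt0.
have pr : r / 2 < r by lra.
have [M' cf'] := pser_deriv_pser cf p0 pr (fun w => holo_dern w hf).
rewrite dernS (IH _ _ _ _ (holo_deriv hf) p0 cf').
by rewrite factS mulnC natrM; ring.
Qed.

Lemma dern_shift n f a z : holo f -> dern n (fun x => f (a + x)) z = dern n f (a + z).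
Proof.
elim: n f z => [|n IH] f z hf; first by rewrite (dern0 f) (dern0 (fun x => f (a + x))).
have e : dern 1 (fun x => f (a + x)) = (fun x => dern 1 f (a + x)).
  by apply/funext => w; apply: dernE; apply/cder_shift; apply: holo_dern.
by rewrite (dernS n f) (dernS n _) e; apply: IH; apply: holo_deriv.
Qed.

Lemma holo_shift f a : holo f -> holo (fun x => f (a + x)).
Proof. by move=> hf z; have [L dL] := hf (a + z); exists L; apply/cder_shift. Qed.

Lemma holo_dernn n f : holo f -> holo (dern n f).
Proof. elim: n f => [|n IH] f hf; first by rewrite (dern0 f).
by rewrite (dernS n f); apply: IH; apply: holo_deriv. Qed.

Lemma cauchy_estimate f (s M : R) a n : holo f -> 0 < s ->
  (forall z, normc (z - a) <= s -> normc (f z) <= M) ->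
  normc (dern n f a) * s ^+ n <= n`!%:R * M.
Proof.
move=> hf s0 fM; have hfa := holo_shift a hf.
have [|c cf] := @holo_pser _ s M hfa s0.
  by move=> z zs; apply: fM; rewrite addrC addKr.
have := dern_coef n hfa s0 cf; rewrite dern_shift // addr0 => ->.
by rewrite normcM normc_nat -mulrA ler_wpM2l // cf.1.
Qed.

Lemma taylor_series f z : holo f -> csum (fun n => dern n f 0 / n`!%:R * z ^+ n) (f z).
Proof.
move=> hf; pose r := normc z + 1.
have r0 : 0 < r by rewrite ltr_wpDl ?normc_ge0.
have [M _ fM] := holo_bounded r hf; have [c cf] := holo_pser hf r0 fM.
apply: csum_eq (cf.2 z _) => //; last by rewrite /r; lra.
by move=> n; rewrite (dern_coef n hf r0 cf) [_ * c n]mulrC mulfK // pnatr_eq0 -lt0n fact_gt0.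
Qed.

(** Weierstrass's theorem: on each disc, the power series of the [F n] have
    common Cauchy bounds, so that their limit is a power series. *)
Lemma holo_limit (F : nat -> C -> C) f : (forall n, holo (F n)) ->
  (forall r, exists N M, forall n z, (N <= n)%N -> normc z <= r ->
     normc (F n z) <= M) ->
  (forall z, clim (fun n => F n z) (f z)) -> holo f.
Proof.
move=> hF bF Ff z; pose r := normc z + 1.
have zr : normc z < r by rewrite /r; lra.
have [r0 _ _] := ratio_bounds zr.
have [N [M hM]] := bF r.
have /choice [c hc] n := holo_pser (hF (N + n)%N) r0 (fun z => hM (N + n)%N z (leq_addr n N)).
have [d cf] := pser_limit r0 hc (fun w _ => clim_comp (fun n => leq_addl N n) (Ff w)).
by have [L [_ dL]] := pser_deriv cf zr; exists L.
Qed.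

(** The Cauchy estimate on larger and larger circles kills all the derivatives
    at 0. *)
Lemma liouville f M : holo f -> (forall z, normc (f z) <= M) -> forall z, f z = f 0.
Proof.
move=> hf fM z; have M0 : 0 <= M := le_trans (normc_ge0 _) (fM 0).
have d0 n : (0 < n)%N -> dern n f 0 = 0.
  move=> n0; apply: normc_le_eq0 => e e0.
  pose s := Num.max 1 (n`!%:R * M / e).
  have s1 : 1 <= s by rewrite le_max lexx.
  have s0 : 0 < s := lt_le_trans ltr01 s1.
  have := @cauchy_estimate _ s M 0 n hf s0 (fun z _ => fM z).
  have sn : s <= s ^+ n by rewrite -[leLHS]expr1; apply: ler_weXn2l.
  have : n`!%:R * M / e <= s ^+ n by apply: le_trans sn; rewrite le_max lexx orbT.
  rewrite ler_pdivrMr // [_ * e]mulrC.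
  by move=> h1 h2; have := le_trans h2 h1; rewrite ler_pM2r ?exprn_gt0.
have H w : csum (fun n => dern n f 0 / n`!%:R * w ^+ n) (f 0).
  move=> e e0; exists 1%N => -[//|m] _; rewrite big_ord_recl big1 ?addr0.
    by rewrite divr1 mulr1 subrr normc0 ltW.
  by move=> i _; rewrite d0 // !mul0r.
exact: csum_unique (taylor_series z hf) (H z).
Qed.

Lemma holo_cst a : holo (fun=> a).
Proof. by move=> z; exists 0; apply: cder_cst. Qed.

Lemma holo_id : holo id.
Proof. by move=> z; exists 1; apply: cder_id. Qed.

Lemma holoD f g : holo f -> holo g -> holo (fun z => f z + g z).
Proof.
by move=> hf hg z; have [L dL] := hf z; have [K dK] := hg z; exists (L + K); apply: cderD.
Qed.

Lemma holoM f g : holo f -> holo g -> holo (fun z => f z * g z).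
Proof.
by move=> hf hg z; have [L dL] := hf z; have [K dK] := hg z; eexists; apply: cderM; eassumption.
Qed.

Lemma holoZ a f : holo f -> holo (fun z => a * f z).
Proof. by apply: holoM; apply: holo_cst. Qed.

Lemma holoB f g : holo f -> holo g -> holo (fun z => f z - g z).
Proof.
by move=> hf hg z; have [L dL] := hf z; have [K dK] := hg z; exists (L - K); apply: cderB.
Qed.

Lemma holoX f n : holo f -> holo (fun z => f z ^+ n).
Proof.
move=> hf; elim: n => [|n IH]; first exact: holo_cst.
by have := holoM hf IH; congr holo; apply/funext => z; rewrite exprS.
Qed.

Lemma holo_sum n (F : nat -> C -> C) : (forall i, (i < n)%N -> holo (F i)) ->
  holo (fun z => \sum_(i < n) F i z).
Proof.
elim: n => [_|n IH h].
  by have := holo_cst 0; congr holo; apply/funext => z; rewrite big_ord0.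
have := holoD (IH (fun i ni => h i (ltnW ni))) (h n (ltnSn n)).
by congr holo; apply/funext => z; rewrite big_ord_recr.
Qed.

Lemma holo_ce f : holo f -> holo (fun z => ce (f z)).
Proof.
by move=> hf z; have [L dL] := hf z; eexists; apply: cder_comp dL _; apply: cder_ce.
Qed.

End Entire.

(** * Compact convergence *)

Section CompactConvergence.
Variable R : realType.
Local Notation C := R[i].
Implicit Types (z w h : C) (f g F : C -> C).

Lemma compact_disc (A : set (CC R)) : compact A ->
  exists r : R, forall z, A z -> normc z <= r.
Proof.
rewrite compact_cover => Aco.
have covA : A `<=` \bigcup_(n : nat) [set p : CC R | normc p < n%:R].
  move=> p _; exists (Num.truncn (normc (p : C))).+1 => //=.
  exact: Num.Theory.truncnS_gt.
have /Aco [] := covA.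
  move=> n _; rewrite openE => p /= pn; apply/nbhs_ballP.
  exists (n%:R - normc (p : C))%:C; first by rewrite /= ltcR subr_gt0.
  move=> q; rewrite -ball_normE /= normr_normc ltcR => h.
  have := normc_split (p : C) (q : C) 0; rewrite !subr0.
  rewrite normc_distC; lra.
move=> D _ DcovA; exists (\sum_(i <- finmap.enum_fset D) i%:R) => z /DcovA [n Dn /= zn].
apply: (le_trans (ltW zn)); rewrite (big_rem n) //= lerDl.
by apply: sumr_ge0 => i _.
Qed.

Lemma fam_compact_cvg (G : set_system (C -> C)) g : Filter G ->
  (forall r e : R, 0 < e -> G [set f | forall z, normc z <= r -> normc (f z - g z) <= e]) ->
  {family compact, (G : set_system (CC R -> CC R)) --> (g : CC R -> CC R)}.
Proof.
move=> FG hG; apply/fam_cvgP => A /compact_disc [r hr] P /uniform_nbhs [E [entE subP]].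
have [e' /= /posc_real [e e0 ->] he] : exists2 e : C, 0 < e &
    [set xy : CC R * CC R | ball xy.1 e xy.2] `<=` E.
  by move: entE; rewrite -entourage_ballE => -[e /= e0 he]; exists e.
have e2 : 0 < e / 2 by rewrite divr_gt0.
apply: filterS (hG r _ e2) => f /= hf; apply: subP => y Ay /=.
apply: he => /=; rewrite -ball_normE /= normr_normc ltcR.
have := hf y (hr _ Ay); rewrite normc_distC; lra.
Qed.

Lemma fam_cvg_pointwise (u : nat -> C -> C) g :
  {family compact, (u @ \oo : set_system (CC R -> CC R)) --> (g : CC R -> CC R)} ->
  forall z, clim (fun n => u n z) (g z).
Proof.
move=> ug z e e0.
have cz : compact [set (z : CC R)] by exact: compact_set1.
have /fam_cvgP /(_ _ cz) := ug.
have e0' : (0 : C) < e%:C by rewrite ltcR.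
pose E := [set xy : CC R * CC R | ball xy.1 e%:C xy.2].
have entE : entourage E by apply: entourage_ball (PosNum e0').
move=> /(_ [set h | forall y, [set (z : CC R)] y -> E (g y, h y)]) [].
  apply: (proj2 (@uniform_nbhs (CC R) [set (z : CC R)] (CC R) g _)).
  by exists E; split => // h.
move=> N _ hN; exists N => n Nn; have := hN n Nn z erefl.
by rewrite /E /= -ball_normE /= normr_normc ltcR normc_distC => /ltW.
Qed.

Lemma nat_large (r e : R) : 0 < e -> exists N : nat, r <= N%:R /\ N.+1%:R^-1 <= e.
Proof.
move=> e0; exists (maxn (Num.truncn r).+1 (Num.truncn e^-1).+1); split.
  by apply: ltW; apply: lt_le_trans (Num.Theory.truncnS_gt _) _; rewrite ler_nat leq_maxl.
rewrite -[leRHS]invrK lef_pV2 ?posrE ?invr_gt0 //.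
by apply: ltW; apply: lt_le_trans (Num.Theory.truncnS_gt _) _; rewrite ler_nat leqW // leq_maxr.
Qed.

(** Discs exhaust the compact sets, so the filter of the sets of functions that
    are close to [g] on a disc converges to [g]; thus any neighbourhood of [g]
    contains one of these sets. *)
Lemma closure_compact (A : set (CC R -> CC R)) g :
  (forall r e : R, 0 < e -> exists2 f, A f &
    forall z : C, normc z <= r -> normc ((f z : C) - g z) <= e) ->
  closure (A : set {family compact, CC R -> CC R}) (g : CC R -> CC R).
Proof.
move=> H B nB.
pose D (n : nat) := [set f : C -> C | forall z, normc z <= n%:R -> normc (f z - g z) <= n.+1%:R^-1].
pose G := filter_from [set: nat] D.
have DS m n : (m <= n)%N -> D n `<=` D m.
  move=> mn f hf z zm; apply: le_trans (hf z _) _.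
    by apply: (le_trans zm); rewrite ler_nat.
  by rewrite lef_pV2 ?posrE // ler_nat.
have FG : Filter G.
  apply: filter_from_filter; first by exists 0%N.
  move=> i j _ _; exists (maxn i j) => // f hf; split; apply: DS hf.
    exact: leq_maxl.
  exact: leq_maxr.
have cG : {family compact, (G : set_system (CC R -> CC R)) --> (g : CC R -> CC R)}.
  apply: fam_compact_cvg => r e e0.
  have [n [rn ne]] := nat_large r e0; exists n => // f hf z zr.
  by apply: le_trans ne; apply: hf; apply: le_trans rn.
have [n _ hn] := cG _ nB.
have n0 : 0 < n.+1%:R^-1 :> R by rewrite invr_gt0.
have [f Af hf] := H n%:R _ n0.
by exists f; split => //; apply: hn.
Qed.

End CompactConvergence.

(** * The operator of convolution *)

Section Convolution.
Variable R : realType.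
Local Notation C := R[i].
Implicit Types (z w h : C) (f g F : C -> C).

Variable Phi : C -> C.
Hypothesis Phi_holo : holo Phi.
Hypothesis Phi_sub : forall eps : R, 0 < eps -> exists2 A : R, 0 < A &
  forall z, normc (Phi z) <= A * expR (eps * normc z).

Definition phic n : C := dern n Phi 0 / n`!%:R.

Lemma fact_le_expn n : (n`! <= n ^ n)%N.
Proof.
elim: n => // n IH; rewrite factS expnS leq_mul2l /= (leq_trans IH) //.
by case: n {IH} => // n; rewrite leq_exp2r.
Qed.

(** Cauchy's estimate on circles of radius proportional to [n]: the derivatives
    at 0 of a function of subexponential type are smaller than any geometric
    sequence. *)
Lemma phic_bound (eps : R) : 0 < eps -> exists2 K, 0 <= K &
  forall n, normc (phic n) * n`!%:R <= K * eps ^+ n.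
Proof.
(* On that circle Phi is at most A expR n, a geometric sequence that the
   choice of [e] absorbs, and n! <= n^n. *)
move=> e0; pose e := eps / expR 1.
have E0 : 0 < expR 1 :> R by rewrite expR_gt0.
have e_gt0 : 0 < e by rewrite divr_gt0.
have [A A0 hA] := Phi_sub e_gt0; exists A; first exact: ltW.
move=> n; have fn0 : (0 < n`!%:R :> R) by rewrite ltr0n fact_gt0.
rewrite /phic normcM normcV normc_nat mulfVK ?gt_eqF //.
case: n fn0 => [|n] fn0.
  rewrite (dern0 Phi) expr0 mulr1; have := hA 0.
  by rewrite normc0 mulr0 expR0 mulr1.
pose s := n.+1%:R / e.
have s0 : 0 < s by rewrite divr_gt0.
have := @cauchy_estimate _ Phi s (A * expR (e * s)) 0 n.+1 Phi_holo s0.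
have -> : e * s = n.+1%:R by rewrite /s mulrC mulfVK ?gt_eqF.
move=> h; have {h} : normc (dern n.+1 Phi 0) * s ^+ n.+1 <= n.+1`!%:R * (A * expR n.+1%:R).
  apply: h => z; rewrite subr0 => zs; apply: (le_trans (hA z)).
  rewrite ler_wpM2l ?(ltW A0) // ler_expR.
  by move: zs; rewrite /s ler_pdivlMr // mulrC.
rewrite -ler_pdivlMr ?exprn_gt0 // => h; apply: (le_trans h).
have -> : expR n.+1%:R = expR 1 ^+ n.+1 :> R by rewrite -expRM_natr mul1r.
have -> : eps = e * expR 1 by rewrite /e mulfVK ?gt_eqF.
rewrite ler_pdivrMr ?exprn_gt0 // [(e * _) ^+ _]exprMn.
have -> : A * (e ^+ n.+1 * expR 1 ^+ n.+1) * s ^+ n.+1 = (n.+1 ^ n.+1)%:R * (A * expR 1 ^+ n.+1).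
  have en : e ^+ n.+1 != 0 by rewrite expf_neq0 ?gt_eqF.
  rewrite natrX /s [(_ / e) ^+ _]exprMn exprVn.
  by move: (e ^+ _) (expR 1 ^+ _) (n.+1%:R ^+ _) en => x y w x0; field.
rewrite ler_wpM2r ?ler_nat ?fact_le_expn //.
by rewrite mulr_ge0 ?exprn_ge0 ?ltW.
Qed.

Lemma phic_series z : csum (fun n => phic n * z ^+ n) (Phi z).
Proof. exact: taylor_series. Qed.

(** The derivatives of [f] on the smaller disc are at most n! M / s^n, and the
    factor n! is compensated by [phic n]. *)
Lemma conv_term (s : R) : 0 < s -> exists2 K, 0 <= K &
  forall f (r M : R), holo f -> (forall z, normc z <= r + s -> normc (f z) <= M) ->
  forall n z, normc z <= r -> normc (phic n * dern n f z) <= K * M * (1 / 2) ^+ n.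
Proof.
move=> s0; have [K K0 hK] := phic_bound (divr_gt0 s0 (ltr0Sn R 1)).
exists K => // f r M hf fM n z zr.
have fz w : normc (w - z) <= s -> normc (f w) <= M.
  move=> wz; apply: fM; have := normcD z (w - z).
  by rewrite addrC subrK; lra.
have M0 : 0 <= M.
  by apply: le_trans (normc_ge0 (f z)) (fz z _); rewrite subrr normc0 ltW.
have sn : 0 < s ^+ n by rewrite exprn_gt0.
have h1 := cauchy_estimate n hf s0 fz; have h2 := hK n.
rewrite normcM -(ler_pM2r sn).
apply: (@le_trans _ _ (normc (phic n) * (n`!%:R * M))).
  by rewrite -mulrA ler_wpM2l ?normc_ge0.
rewrite mulrA; apply: (le_trans (ler_wpM2r M0 h2)).
have -> : K * (s / 2) ^+ n * M = K * M * (1 / 2) ^+ n * s ^+ n => //.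
by rewrite !exprMn expr1n; ring.
Qed.

Let half0 : (0 : R) <= 1 / 2. Proof. by rewrite divr_ge0. Qed.
Let half1 : (1 / 2 : R) < 1. Proof. by lra. Qed.

Lemma conv_sum_exists f z : holo f -> exists s, csum (fun n => phic n * dern n f z) s.
Proof.
move=> hf; have [K K0 hK] := conv_term ltr01.
have [M M0 hM] := holo_bounded (normc z + 1) hf.
by apply: (geo_csum half0 half1 (fun n => hK _ _ _ hf hM n z (lexx _))).
Qed.

Definition PhiD f : C -> C := conv_op (Phi : CC R -> CC R) (f : CC R -> CC R).

(** The partial sums converge uniformly on discs, hence in the compact-open
    topology; limits there are pointwise limits, so that [get] returns this
    one. *)
Lemma conv_csum f z : holo f -> csum (fun n => phic n * dern n f z) (PhiD f z).
Proof.
move=> hf.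
have /choice [g hg] := fun w => conv_sum_exists w hf.
pose u n (w : C) : C := \sum_(i < n) phic i * dern i f w.
have uE : (series (fun n => taylor_coef (Phi : CC R -> CC R) n *:
    (derive1n n (f : CC R -> CC R) : CC R -> CC R)) : nat -> CC R -> CC R) = u.
  apply/funext => n; apply/funext => w; rewrite /series /= /u.
  rewrite big_mkord fct_sumE; apply: eq_bigr => i _; by [].
have ug : {family compact, (u @ \oo : set_system (CC R -> CC R)) --> (g : CC R -> CC R)}.
  apply: fam_compact_cvg => r e e0.
  have [K K0 hK] := conv_term ltr01; have [M M0 hM] := holo_bounded (r + 1) hf.
  have KM : 0 <= K * M / (1 - 1 / 2) by rewrite divr_ge0 ?mulr_ge0 // subr_ge0 ltW.
  have [N hN] := geo_small half0 half1 KM e0; exists N => // n Nn w wr.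
  rewrite normc_distC; apply: le_trans (hN n Nn).
  rewrite [leRHS]mulrAC; apply: (geo_tail n half0 half1 _ (hg w)) => i.
  exact: hK hf hM i w wr.
have := @getPex (CC R -> CC R) [set g : CC R -> CC R |
    {family compact, (u @ \oo : set_system (CC R -> CC R)) --> g}] (ex_intro _ g ug).
rewrite /PhiD /conv_op uE => /fam_cvg_pointwise /(_ z).
exact.
Qed.

Lemma conv_bound (s : R) : 0 < s -> exists2 K, 0 <= K &
  forall f (r M : R), holo f -> (forall z, normc z <= r + s -> normc (f z) <= M) ->
  forall z, normc z <= r -> normc (PhiD f z) <= K * M.
Proof.
move=> s0; have [K K0 hK] := conv_term s0; exists (K * 2); first by rewrite mulr_ge0.
move=> f r M hf fM z zr.
apply: le_trans (geo_le half0 half1 (fun n => hK _ _ _ hf fM n z zr) (conv_csum z hf)) _.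
by rewrite ler_pdivrMr; lra.
Qed.

Lemma conv_holo f : holo f -> holo (PhiD f).
Proof.
move=> hf; apply: (holo_limit (F := fun n z => \sum_(i < n) phic i * dern i f z)).
- move=> n; apply: (holo_sum (F := fun i z => phic i * dern i f z)) => i _.
  by apply: holoZ; apply: holo_dernn.
- move=> r; have [K K0 hK] := conv_term ltr01; have [M M0 hM] := holo_bounded (r + 1) hf.
  exists 0%N, (K * M / (1 - 1 / 2)) => n z _ zr.
  have := geo_partial 0 n half0 half1 (fun i => hK _ _ _ hf hM i z zr).
  rewrite add0n big_ord0 subr0 => h; apply: (le_trans h).
  rewrite ler_pM2r ?invr_gt0 ?subr_gt0 // ler_piMr ?mulr_ge0 //.
  by rewrite expr0 gerBl exprn_ge0.
- by move=> z; apply: conv_csum.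
Qed.

Lemma dern_lin n f g a z : holo f -> holo g ->
  dern n (fun x => f x + a * g x) z = dern n f z + a * dern n g z.
Proof.
elim: n f g z => [|n IH] f g z hf hg.
  by rewrite (dern0 f) (dern0 g) (dern0 (fun x => f x + a * g x)).
have e : dern 1 (fun x => f x + a * g x) = (fun x => dern 1 f x + a * dern 1 g x).
  apply/funext => w; apply: dernE; apply: cderD; first exact: holo_dern.
  exact/cderZ/holo_dern.
by rewrite (dernS n f) (dernS n g) (dernS n (fun x => f x + a * g x)) e;
  apply: IH; apply: holo_deriv.
Qed.

Lemma conv_lin f g a : holo f -> holo g ->
  PhiD (fun x => f x + a * g x) = (fun x => PhiD f x + a * PhiD g x).
Proof.
move=> hf hg; apply/funext => z.
have hfg : holo (fun x => f x + a * g x) by apply: holoD => //; apply: holoZ.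
apply: csum_unique (conv_csum z hfg) _.
apply: csum_eq (csumD (conv_csum z hf) (csumZ a (conv_csum z hg))) => // n.
by rewrite (dern_lin n a z hf hg); ring.
Qed.

Lemma iter_conv_holo n f : holo f -> holo (iter n PhiD f).
Proof. by move=> hf; elim: n => [//|n IH]; apply: conv_holo. Qed.

Lemma iter_conv_lin n f g a : holo f -> holo g ->
  iter n PhiD (fun x => f x + a * g x) = (fun x => iter n PhiD f x + a * iter n PhiD g x).
Proof.
move=> hf hg; elim: n => [//|n IH]; rewrite !iterS IH.
by rewrite conv_lin //; apply: iter_conv_holo.
Qed.

(** Continuity of the iterates: the enlargement of the disc can be as small as
    wished, which is where the subexponential type of [Phi] is used. *)
Lemma iter_conv_bound n (s : R) : 0 < s -> exists2 K, 0 <= K &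
  forall f (r M : R), holo f -> (forall z, normc z <= r + s -> normc (f z) <= M) ->
  forall z, normc z <= r -> normc (iter n PhiD f z) <= K * M.
Proof.
elim: n s => [|n IH] s s0.
  exists 1 => // f r M hf fM z zr; rewrite mul1r; apply: fM; lra.
have s2 : 0 < s / 2 by rewrite divr_gt0.
have [K1 K10 h1] := conv_bound s2; have [K2 K20 h2] := IH _ s2.
exists (K1 * K2); first by rewrite mulr_ge0.
move=> f r M hf fM z zr; rewrite iterS -mulrA; apply: h1 zr.
  exact: iter_conv_holo.
move=> w wr; apply: h2 wr => // v; rewrite -addrA -splitr; exact: fM.
Qed.

End Convolution.

(** * Exponential sums *)

Section ExponentialSums.
Variable R : realType.
Local Notation C := R[i].
Implicit Types (z w h l : C) (f g F : C -> C) (s : seq (C * C)) (U : C -> Prop).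

Lemma taylor_unif f (r e : R) : holo f -> 0 < e -> exists N, forall n, (N <= n)%N ->
  forall z, normc z <= r -> normc (\sum_(i < n) dern i f 0 / i`!%:R * z ^+ i - f z) <= e.
Proof.
move=> hf e0; pose r1 := `|r| + 1.
have r10 : 0 < r1 by rewrite ltr_wpDl.
have [M M0 fM] := holo_bounded r1 hf; have [c cf] := holo_pser hf r10 fM.
have q0 : 0 <= `|r| / r1 by rewrite divr_ge0 // ltW.
have q1 : `|r| / r1 < 1 by rewrite ltr_pdivrMr // mul1r /r1; lra.
have K0 : 0 <= M / (1 - `|r| / r1) by rewrite divr_ge0 // subr_ge0 ltW.
have [N hN] := geo_small q0 q1 K0 e0; exists N => n /hN hn z zr.
have zr' : normc z <= `|r| := le_trans zr (ler_norm r).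
rewrite normc_distC; apply: le_trans hn; rewrite mulrAC.
apply: (geo_tail n q0 q1 _ (taylor_series z hf)) => i.
rewrite (dern_coef i hf r10 cf) [_ * c i]mulrC mulfK; last first.
  by rewrite pnatr_eq0 -lt0n fact_gt0.
apply: (le_trans (pser_term z r10 (cf.1 i))); rewrite ler_wpM2l //.
by rewrite lerXn2r ?nnegrE ?divr_ge0 ?normc_ge0 ?(ltW r10) // ler_pM2r ?invr_gt0.
Qed.

Definition expsum s z : C := \sum_(p <- s) p.1 * ce (p.2 * z).

Lemma expsum_cat s1 s2 z : expsum (s1 ++ s2) z = expsum s1 z + expsum s2 z.
Proof. by rewrite /expsum big_cat. Qed.

Lemma expsum_scale a s z : expsum [seq (a * p.1, p.2) | p <- s] z = a * expsum s z.
Proof. by rewrite /expsum big_map mulr_sumr; apply: eq_bigr => p _; rewrite mulrA. Qed.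

Lemma expsum_cons p s : expsum (p :: s) = (fun z => p.1 * ce (p.2 * z) + expsum s z).
Proof. by apply/funext => z; rewrite /expsum big_cons. Qed.

Lemma cder_expsum s z : cder (expsum s) z (expsum [seq (p.1 * p.2, p.2) | p <- s] z).
Proof.
elim: s => [|p s IH].
  apply: cder_eq (cder_cst 0 z) => [x|]; by rewrite /expsum big_nil.
rewrite expsum_cons /= expsum_cons /=; apply: cderD IH.
by rewrite -mulrA; apply/cderZ/cder_ce_lin.
Qed.

Lemma holo_expsum s : holo (expsum s).
Proof. by move=> z; eexists; apply: cder_expsum. Qed.

Lemma dern_expsum n s : dern n (expsum s) = expsum [seq (p.1 * p.2 ^+ n, p.2) | p <- s].
Proof.
elim: n s => [|n IH] s.
  rewrite (dern0 (expsum s)); congr expsum; rewrite -[LHS]map_id.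
  by apply: eq_map => -[a b]; rewrite expr0 mulr1.
rewrite (dernS n (expsum s)).
have -> : dern 1 (expsum s) = expsum [seq (p.1 * p.2, p.2) | p <- s].
  by apply/funext => z; apply/dernE/cder_expsum.
rewrite IH -map_comp; congr expsum; apply: eq_map => p /=.
by rewrite -mulrA -exprS.
Qed.

Definition exp_approx U f := forall r e : R, 0 < e -> exists2 s,
  (forall p, p \in s -> U p.2) & forall z, normc z <= r -> normc (expsum s z - f z) <= e.

Lemma exp_approxD U f g : exp_approx U f -> exp_approx U g ->
  exp_approx U (fun z => f z + g z).
Proof.
move=> af ag r e e0; have e2 : 0 < e / 2 by rewrite divr_gt0.
have [s1 U1 h1] := af r _ e2; have [s2 U2 h2] := ag r _ e2.
exists (s1 ++ s2) => [p|z zr]; first by rewrite mem_cat => /orP[/U1|/U2].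
rewrite expsum_cat opprD addrACA (le_trans (normcD _ _)) // (splitr e).
by rewrite lerD ?h1 ?h2.
Qed.

Lemma exp_approxZ U f a : exp_approx U f -> exp_approx U (fun z => a * f z).
Proof.
move=> af r e e0; have K0 : 0 < normc a + 1 by rewrite ltr_wpDl ?normc_ge0.
have [s Us hs] := af r _ (divr_gt0 e0 K0).
exists [seq (a * p.1, p.2) | p <- s] => [p /mapP [q /Us Uq ->] //|z /hs h].
rewrite expsum_scale -mulrBr normcM; apply: le_trans (ler_wpM2l (normc_ge0 _) h) _.
by rewrite mulrCA ler_piMr ?(ltW e0) // ler_pdivrMr //; lra.
Qed.

Lemma exp_approx_lim U f :
  (forall r e : R, 0 < e -> exists2 g, exp_approx U g &
    forall z, normc z <= r -> normc (g z - f z) <= e) -> exp_approx U f.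
Proof.
move=> H r e e0; have e2 : 0 < e / 2 by rewrite divr_gt0.
have [g ag hg] := H r _ e2; have [s Us hs] := ag r _ e2.
exists s => // z zr; rewrite (le_trans (normc_split (g z) _ _)) // (splitr e).
by rewrite lerD ?hs ?hg.
Qed.

(** The monomial z^(k+1) e^(l z) is the derivative of z^k e^(l z) with respect
    to [l], hence a limit of difference quotients. *)
Lemma exp_approx_monom U l k :
  (forall l, U l -> exists2 d : R, 0 < d & forall h, normc h < d -> U (l + h)) ->
  U l -> exp_approx U (fun z => z ^+ k * ce (l * z)).
Proof.
move=> Uo; elim: k l => [|k IH] l Ul.
  move=> r e e0; exists [:: (1, l)] => [p|z _].
    by rewrite inE => /eqP ->.
  by rewrite /expsum big_seq1 expr0 !mul1r subrr normc0 ltW.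
apply: exp_approx_lim => r e e0; pose r1 := `|r| + 1.
have r10 : 0 < r1 by rewrite ltr_wpDl.
have hg : holo (fun z => z ^+ k * ce (l * z)).
  by apply: holoM; [apply: holoX; apply: holo_id | apply/holo_ce/holoZ/holo_id].
have [B B0 hB] := holo_bounded r1 hg.
have K0 : 0 < (B + 1) * r1 by rewrite mulr_gt0 // ltr_wpDl.
have /cderP /(_ _ (divr_gt0 e0 K0)) [d d0 hd] := cder_ce0 R.
have [d' d'0 hd'] := Uo _ Ul.
have [t t0 [td tr]] : exists2 t : R, 0 < t & t < d' /\ t * r1 < d.
  exists (Num.min (d' / 2) (d / (2 * r1))).
    by rewrite lt_min !divr_gt0 // mulr_gt0.
  split; first by rewrite gt_min; apply/orP; left; lra.
  apply: (@le_lt_trans _ _ (d / 2)); last lra.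
  have : Num.min (d' / 2) (d / (2 * r1)) <= d / (2 * r1) by rewrite ge_min lexx orbT.
  move=> /(ler_wpM2r (ltW r10)) h; apply: (le_trans h).
  by rewrite invfM mulrA mulfVK ?gt_eqF.
have tC : t%:C != 0 by rewrite -normc_gt0 normc_real gtr0_norm.
have nt : normc t%:C = t by rewrite normc_real gtr0_norm.
exists (fun z => t%:C^-1 * (z ^+ k * ce ((l + t%:C) * z)) + (- t%:C^-1) * (z ^+ k * ce (l * z))).
  by apply: exp_approxD; apply: exp_approxZ; apply: IH => //; apply: hd'; rewrite nt.
move=> z zr; have zr1 : normc z <= r1 by apply: (le_trans zr); rewrite /r1; have := ler_norm r; lra.
have -> : t%:C^-1 * (z ^+ k * ce ((l + t%:C) * z)) + - t%:C^-1 * (z ^+ k * ce (l * z))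
    - z ^+ k.+1 * ce (l * z)
  = z ^+ k * ce (l * z) * ((ce (t%:C * z) - 1 - t%:C * z) / t%:C).
  by rewrite mulrDl ceD exprS; field.
have htz : normc (t%:C * z) < d.
  by rewrite normcM nt; apply: le_lt_trans tr; rewrite ler_wpM2l // ltW.
have := hd _ htz; rewrite add0r ce0 mulr1 => k1.
rewrite normcM [normc (_ / t%:C)]normcM normcV nt.
apply: (@le_trans _ _ (B * (e / ((B + 1) * r1) * r1))).
  apply: ler_pM; rewrite ?normc_ge0 ?divr_ge0 ?normc_ge0 ?(ltW t0) //.
    exact: hB.
  rewrite ler_pdivrMr //; apply: (le_trans k1); rewrite normcM nt -[leRHS]mulrA.
  rewrite ler_wpM2l ?divr_ge0 ?(ltW e0) ?(ltW K0) //.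
  by rewrite [leRHS]mulrC ler_wpM2l // ltW.
have B1 : B + 1 != 0 by rewrite gt_eqF // ltr_wpDl.
have r1n : r1 != 0 by rewrite gt_eqF.
have -> : B * (e / ((B + 1) * r1) * r1) = e * (B / (B + 1)) by field; rewrite B1 r1n.
by rewrite ler_piMr ?(ltW e0) // ler_pdivrMr ?ltr_wpDl //; lra.
Qed.

(** Multiplying by e^(- l z), this is the density of polynomials. *)
Lemma exp_approx_holo U l f :
  (forall l, U l -> exists2 d : R, 0 < d & forall h, normc h < d -> U (l + h)) ->
  U l -> holo f -> exp_approx U f.
Proof.
move=> Uo Ul hf; apply: exp_approx_lim => r e e0.
have hl a : holo (fun z => ce (a * z)) by apply/holo_ce/holoZ/holo_id.
pose g z := f z * ce (- l * z).
have hg : holo g by apply: holoM.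
have [B B0 hB] := holo_bounded r (hl l).
have K0 : 0 < B + 1 by rewrite ltr_wpDl.
have [N hN] := taylor_unif r hg (divr_gt0 e0 K0).
exists (fun z => \sum_(i < N) dern i g 0 / i`!%:R * (z ^+ i * ce (l * z))).
  elim: (N) => [|n IH].
    move=> r' e' e'0; exists [::] => // z _.
    by rewrite /expsum big_nil big_ord0 subrr normc0 ltW.
  have := exp_approxD IH (exp_approxZ (dern n g 0 / n`!%:R) (exp_approx_monom n Uo Ul)).
  by congr exp_approx; apply/funext => z; rewrite big_ord_recr.
move=> z zr.
have -> : f z = g z * ce (l * z).
  by rewrite /g -mulrA -ceD mulNr addNr ce0 mulr1.
have -> : \sum_(i < N) dern i g 0 / i`!%:R * (z ^+ i * ce (l * z))
  = (\sum_(i < N) dern i g 0 / i`!%:R * z ^+ i) * ce (l * z).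
  by rewrite mulr_suml; apply: eq_bigr => i _; rewrite mulrA.
rewrite -mulrBl normcM.
apply: (@le_trans _ _ (e / (B + 1) * B)).
  by apply: ler_pM; rewrite ?normc_ge0 ?hN ?hB.
by rewrite mulrAC ler_pdivrMr // ler_wpM2l ?(ltW e0) //; lra.
Qed.

Lemma expsum_small (mu : C -> C) s (r e : R) :
  (forall p, p \in s -> normc (mu p.2) < 1) -> 0 < e ->
  exists N, forall n, (N <= n)%N -> forall z, normc z <= r ->
    normc (expsum [seq (p.1 * mu p.2 ^+ n, p.2) | p <- s] z) <= e.
Proof.
elim: s e => [|p s IH] e hs e0.
  by exists 0%N => n _ z _; rewrite /expsum big_nil normc0 ltW.
have e2 : 0 < e / 2 by rewrite divr_gt0.
have [|N1 h1] := IH _ _ e2; first by move=> q qs; apply: hs; rewrite inE qs orbT.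
have hl : holo (fun z => p.1 * ce (p.2 * z)) by apply/holoZ/holo_ce/holoZ/holo_id.
have [B B0 hB] := holo_bounded r hl.
have mu1 : normc (mu p.2) < 1 by apply: hs; rewrite inE eqxx.
have [N2 h2] := geo_small (normc_ge0 _) mu1 B0 e2.
exists (maxn N1 N2) => n; rewrite geq_max => /andP[/h1 k1 /h2 k2] z zr.
rewrite /= expsum_cons /= (splitr e) (le_trans (normcD _ _)) // lerD ?k1 //.
apply: le_trans k2; rewrite mulrAC normcM normcX ler_wpM2r ?exprn_ge0 ?normc_ge0 //.
exact: hB.
Qed.

End ExponentialSums.

(** * Topological transitivity *)

Section Transitivity.
Variable R : realType.
Local Notation C := R[i].
Implicit Types (z w h l : C) (f g F : C -> C) (s : seq (C * C)) (U : C -> Prop).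

Variable Phi : C -> C.
Hypothesis Phi_holo : holo Phi.
Hypothesis Phi_sub : forall eps : R, 0 < eps -> exists2 A : R, 0 < A &
  forall z, normc (Phi z) <= A * expR (eps * normc z).
Hypothesis Phi_nc : ~ exists c, forall z, Phi z = c.

Local Notation PhiD := (PhiD Phi).

Lemma conv_expsum s : PhiD (expsum s) = expsum [seq (p.1 * Phi p.2, p.2) | p <- s].
Proof.
apply/funext => z; apply: csum_unique (conv_csum Phi_holo Phi_sub z (holo_expsum s)) _.
have : csum (fun n => \sum_(p <- s) p.1 * ce (p.2 * z) * (phic Phi n * p.2 ^+ n))
  (\sum_(p <- s) p.1 * ce (p.2 * z) * Phi p.2).
  elim: s => [|p s IH].
    by rewrite big_nil; apply: csum_eq (@csum0 R) => // n; rewrite big_nil.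
  rewrite big_cons.
  apply: csum_eq (csumD (csumZ (p.1 * ce (p.2 * z)) (phic_series Phi_holo p.2)) IH) => // n.
  by rewrite big_cons.
apply: csum_eq => [n|].
  rewrite dern_expsum /expsum big_map mulr_sumr; apply: eq_bigr => p _ /=; ring.
by rewrite /expsum big_map; apply: eq_bigr => p _ /=; ring.
Qed.

Lemma iter_conv_expsum n s :
  iter n PhiD (expsum s) = expsum [seq (p.1 * Phi p.2 ^+ n, p.2) | p <- s].
Proof.
elim: n => [|n IH] /=.
  congr expsum; rewrite -[LHS]map_id; apply: eq_map => -[a b].
  by rewrite expr0 mulr1.
rewrite IH conv_expsum -map_comp; congr expsum; apply: eq_map => p /=.
by rewrite -mulrA -exprSr.
Qed.

(** Both from Liouville's theorem, applied to [Phi] and to its inverse. *)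
Lemma Phi_large : exists l, 1 < normc (Phi l).
Proof.
apply: contrapT => H; apply: Phi_nc; exists (Phi 0).
apply: (liouville (M := 1)) => // z; rewrite leNgt; apply/negP => h.
by apply: H; exists z.
Qed.

Lemma Phi_small : exists l, normc (Phi l) < 1.
Proof.
apply: contrapT => H; apply: Phi_nc; exists (Phi 0).
have P1 z : 1 <= normc (Phi z) by rewrite leNgt; apply/negP => h; apply: H; exists z.
have P0 z : Phi z != 0 by rewrite -normc_gt0; apply: lt_le_trans (P1 z).
have hV : holo (fun z => (Phi z)^-1).
  move=> z; have [L dL] := Phi_holo z; eexists; apply: cder_comp dL _.
  exact: cderV.
move=> z; apply: invr_inj; apply: (liouville (M := 1) hV) => w.
by rewrite normcV invf_le1 ?P1 // normc_gt0.
Qed.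

Lemma small_open l : normc (Phi l) < 1 ->
  exists2 d : R, 0 < d & forall h, normc h < d -> normc (Phi (l + h)) < 1.
Proof.
move=> l1; have e0 : 0 < (1 - normc (Phi l)) / 2 by lra.
have [d d0 hd] := holo_cctn Phi_holo l e0; exists d => // h /hd k.
have := normcD (Phi (l + h) - Phi l) (Phi l); rewrite subrK; lra.
Qed.

Lemma large_open l : 1 < normc (Phi l) ->
  exists2 d : R, 0 < d & forall h, normc h < d -> 1 < normc (Phi (l + h)).
Proof.
move=> l1; have e0 : 0 < (normc (Phi l) - 1) / 2 by lra.
have [d d0 hd] := holo_cctn Phi_holo l e0; exists d => // h /hd k.
have := normcB (Phi (l + h)) (Phi (l + h) - Phi l); rewrite opprB addrC subrK; lra.
Qed.

(** Godefroy and Shapiro's argument: exponential sums with frequencies in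
    |Phi| < 1 and in |Phi| > 1 are both dense; the former tend to 0 along the
    iterates, and the latter have preimages that tend to 0. *)
Lemma conv_transitive f g (r e : R) : holo f -> holo g -> 0 < e ->
  exists p n, [/\ holo p, (0 < n)%N,
    forall z, normc z <= r -> normc (p z - f z) <= e &
    forall z, normc z <= r -> normc (iter n PhiD p z - g z) <= e].
Proof.
move=> hf hg e0; have e2 : 0 < e / 2 by rewrite divr_gt0.
have [l1 hl1] := Phi_small; have [l2 hl2] := Phi_large.
have [s1 S1 k1] := exp_approx_holo (U := fun l => normc (Phi l) < 1) small_open hl1 hf r e2.
have [s2 S2 k2] := exp_approx_holo (U := fun l => 1 < normc (Phi l)) large_open hl2 hg r e2.
have [N1 m1] := expsum_small (mu := Phi) r S1 e2.
have S2' p : p \in s2 -> normc ((Phi p.2)^-1) < 1.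
  by move=> /S2 h1; rewrite normcV invf_lt1 // (lt_trans ltr01).
have [N2 m2] := expsum_small (mu := fun l => (Phi l)^-1) r S2' e2.
pose n := (maxn N1 N2).+1.
have n1 : (N1 <= n)%N by rewrite leqW // leq_maxl.
have n2 : (N2 <= n)%N by rewrite leqW // leq_maxr.
pose s2' := [seq (p.1 * (Phi p.2)^-1 ^+ n, p.2) | p <- s2].
exists (expsum (s1 ++ s2')), n; split => //; first exact: holo_expsum.
  move=> z zr; rewrite expsum_cat addrAC (le_trans (normcD _ _)) // (splitr e).
  by rewrite lerD ?k1 ?m2.
move=> z zr; rewrite iter_conv_expsum map_cat expsum_cat -addrA (le_trans (normcD _ _)) //.
rewrite (splitr e) lerD ?m1 //.
have -> : expsum [seq (p.1 * Phi p.2 ^+ n, p.2) | p <- s2'] z = expsum s2 z; last exact: k2.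
rewrite /s2' /expsum !big_map !big_seq; apply: eq_bigr => p /S2 p1 /=.
have P0 : Phi p.2 != 0 by rewrite -normc_gt0 (lt_trans ltr01).
by congr (_ * _); rewrite -mulrA -exprMn mulVf // expr1n mulr1.
Qed.

End Transitivity.

(** * Transitivity within the zero-free functions *)

Section ZeroFree.
Variable R : realType.
Local Notation C := R[i].
Implicit Types (z w h l u : C) (f g F G : C -> C).

Definition logpoly n u : C := \sum_(k < n) (-1) ^+ k * (u ^+ k.+1 / k.+1%:R).

Lemma cder_logpoly n u : cder (logpoly n) u (\sum_(k < n) (- u) ^+ k).
Proof.
apply: (cder_sum (F := fun k u => (-1) ^+ k * (u ^+ k.+1 / k.+1%:R)) (L := fun k => (- u) ^+ k)) => k _.
apply: cder_eq (cderZ ((-1) ^+ k) (cderM (cderX u k.+1) (cder_cst k.+1%:R^-1 u))) => //=.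
have k0 : (k.+1%:R : C) != 0 by rewrite pnatr_eq0.
by rewrite -[- u]mulN1r exprMn mulr0 addr0 [k.+1%:R * _]mulrC mulfK.
Qed.

Lemma logpoly_le n u : normc u <= 1 / 2 -> normc (logpoly n u) <= 2 * normc u.
Proof.
move=> u2; have u0 := normc_ge0 u.
have b k : normc ((-1) ^+ k * (u ^+ k.+1 / k.+1%:R)) <= normc u * (1 / 2) ^+ k.
  rewrite normcM normcX normc_opp normc1 expr1n mul1r normcM normcV normc_nat normcX.
  rewrite ler_pdivrMr // exprS -mulrA ler_wpM2l //.
  apply: (@le_trans _ _ ((1 / 2) ^+ k * 1)); last first.
    by rewrite ler_wpM2l ?exprn_ge0 ?divr_ge0 // ler1n.
  by rewrite mulr1 lerXn2r ?nnegrE ?divr_ge0.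
have h0 : (0 : R) <= 1 / 2 by rewrite divr_ge0.
have h1 : (1 / 2 : R) < 1 by lra.
have := geo_partial 0 n h0 h1 b; rewrite add0n big_ord0 subr0 expr0 => h.
apply: (le_trans h); have : 0 <= (1 / 2 : R) ^+ n by rewrite exprn_ge0.
have -> : 1 - 1 / 2 = 2^-1 :> R by lra.
by rewrite invrK => ?; nra.
Qed.

(** The truncated logarithm [logpoly n] is an entire function whose
    exponential is close to 1 + u: with v = t u, the derivative of
    e^(- logpoly n v) (1 + v) is u e^(- logpoly n v) (- v)^n. *)
Lemma exp_logpoly (e : R) : 0 < e -> exists n, forall u, normc u <= 1 / 2 ->
  normc (ce (logpoly n u) - (1 + u)) <= e.
Proof.
move=> e0; pose K := expR 1 ^+ 2 : R.
have E0 : 0 <= expR 1 :> R by rewrite expR_ge0.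
have [n hn] := half_pow_small K e0; exists n => u u2.
have lb v : normc v <= normc u -> normc (logpoly n v) <= 1.
  move=> vu; apply: (le_trans (logpoly_le n (le_trans vu u2))); lra.
pose phi x := ce (- logpoly n (x * u)) * (1 + x * u).
have -> : ce (logpoly n u) - (1 + u) = ce (logpoly n u) * (phi 0 - phi 1).
  rewrite /phi mul0r mul1r addr0 mulr1 mulrBr [ce _ * (ce _ * _)]mulrA -[ce _ * ce (- logpoly n u)]ceD subrr ce0 mul1r.
  have -> : logpoly n 0 = 0.
    by rewrite /logpoly big1 // => k _; rewrite exprS !mul0r mulr0.
  by rewrite oppr0 ce0 mulr1.
have phi' : normc (phi 1 - phi 0) <= expR 1 / 2 ^+ n.
  apply: mean_value => t /andP[t0 t1]; set v := t%:C * u.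
  have vu : normc v <= normc u.
    by rewrite normcM normc_real ger0_norm // ler_piMl ?normc_ge0.
  exists (u * ce (- logpoly n v) * (- v) ^+ n).
    have d1 : cder (fun x => x * u) t%:C u.
      by apply: cder_eq (cderM (cder_id _) (cder_cst u _)) => //; rewrite mul1r mulr0 addr0.
    have d2 := cderN (cder_comp d1 (cder_logpoly n (t%:C * u))).
    have d3 := cder_comp d2 (cder_ce _).
    have d4 := cderD (cder_cst 1 _) d1.
    apply: cder_eq (cderM d3 d4) => //; rewrite -/v add0r.
    have -> : (- v) ^+ n = 1 - (1 + v) * (\sum_(k < n) (- v) ^+ k).
      have -> : 1 + v = - (- v - 1) by ring.
      by rewrite mulNr -subrX1; ring.
    by ring.
  rewrite normcM normcX normc_opp -exprVn; apply: ler_pM; rewrite ?normc_ge0 ?exprn_ge0 ?normc_ge0 //.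
    rewrite normcM -[leRHS]mul1r; apply: ler_pM; rewrite ?normc_ge0 //; first lra.
    by apply: (le_trans (normc_ce_le _)); rewrite normc_opp ler_expR lb.
  by rewrite lerXn2r ?nnegrE ?normc_ge0 ?invr_ge0 //; lra.
rewrite normcM normc_distC.
apply: le_trans (ltW hn); rewrite /K expr2 -mulrA; apply: ler_pM; rewrite ?normc_ge0 //.
by apply: (le_trans (normc_ce_le _)); rewrite ler_expR lb.
Qed.

Variable Phi : C -> C.
Hypothesis Phi_holo : holo Phi.
Hypothesis Phi_sub : forall eps : R, 0 < eps -> exists2 A : R, 0 < A &
  forall z, normc (Phi z) <= A * expR (eps * normc z).
Hypothesis Phi_nc : ~ exists c, forall z, Phi z = c.

(** Transitivity gives an entire [p] close to e^G whose image under an iterate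
    is close to [g]; write p = e^G (1 + u) and replace 1 + u by
    e^(logpoly u).  The resulting zero-free function is as close to [p] on the
    larger disc as wished, so the same iterate also maps it close to [g]. *)
Lemma zero_free_transitive G g (r e : R) : holo G -> holo g -> 0 < e ->
  exists G' n, [/\ holo G', (0 < n)%N,
    forall z, normc z <= r -> normc (G' z - G z) <= e &
    forall z, normc z <= r ->
      normc (iter n (PhiD Phi) (fun z => ce (G' z)) z - g z) <= e].
Proof.
move=> hG hg e0; have hF := holo_ce hG.
have hV : holo (fun z => ce (- G z)) by apply: holo_ce => z; have [L dL] := hG z; exists (- L); apply: cderN.
have [B B0 hB] := holo_bounded (r + 1) hV.
have [B2 B20 hB2] := holo_bounded (r + 1) hF.
have [eta [eta0 eta1 eta2 eta3]] : exists eta : R,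
    [/\ 0 < eta, eta * (B + 1) <= 1 / 2, eta * (B + 1) <= e / 2 & eta <= e / 2].
  have B1 : 0 < B + 1 by rewrite ltr_wpDl.
  exists (Num.min (1 / 2) (e / 2) / (B + 1)); split.
  - by rewrite divr_gt0 // lt_min !divr_gt0.
  - by rewrite mulfVK ?gt_eqF // ge_min lexx.
  - by rewrite mulfVK ?gt_eqF // ge_min lexx orbT.
  - rewrite ler_pdivrMr // ge_min; apply/orP; right.
    by rewrite ler_peMr ?divr_ge0 ?(ltW e0) // lerDr.
have [p [n [hp n0 pF pg]]] := conv_transitive Phi_holo Phi_sub Phi_nc (r + 1) hF hg eta0.
pose u z := p z * ce (- G z) - 1.
have hu : holo u by apply: holoB; [apply: holoM | apply: holo_cst].
have uE z : u z = (p z - ce (G z)) * ce (- G z).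
  by rewrite mulrBl -ceD subrr ce0.
have pE z : p z = ce (G z) * (1 + u z).
  by rewrite /u addrC subrK mulrCA -ceD subrr ce0 mulr1.
have ub z : normc z <= r + 1 -> normc (u z) <= eta * (B + 1).
  move=> zr; rewrite uE normcM; apply: ler_pM; rewrite ?normc_ge0 ?pF //.
  by apply: (le_trans (hB _ zr)); rewrite lerDl.
have [K K0 hK] := iter_conv_bound Phi_holo Phi_sub n (ltr01 : (0 : R) < 1).
have KB : 0 < K * B2 + 1 by rewrite ltr_wpDl // mulr_ge0.
have [k hk] := exp_logpoly (divr_gt0 (divr_gt0 e0 (ltr0Sn R 1)) KB).
pose G' z := G z + logpoly k (u z).
have hG' : holo G'.
  apply: holoD => // z; have [L dL] := hu z; eexists; apply: cder_comp dL _.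
  exact: cder_logpoly.
exists G', n; split => //.
  move=> z zr; rewrite /G' addrC addKr.
  have zr1 : normc z <= r + 1 by rewrite (le_trans zr) // lerDl.
  have := ub _ zr1 => uz; apply: (le_trans (logpoly_le k (le_trans uz eta1))); lra.
move=> z zr; rewrite (le_trans (normc_split (iter n (PhiD Phi) p z) _ _)) //.
rewrite (splitr e) lerD //; last first.
  by apply: (le_trans (pg z _)) => //; rewrite (le_trans zr) // lerDl.
have hcG' := holo_ce hG'.
have := iter_conv_lin Phi_holo Phi_sub n (-1) hcG' hp => /(congr1 (fun f => f z)).
rewrite mulN1r => <-.
have -> : (fun x => ce (G' x) + -1 * p x) = (fun x => ce (G x) * (ce (logpoly k (u x)) - (1 + u x))).
  by apply/funext => x; rewrite pE /G' ceD; ring.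
have hd : holo (fun x => ce (G x) * (ce (logpoly k (u x)) - (1 + u x))).
  apply: holoM => //; apply: holoB; last by apply: holoD => //; apply: holo_cst.
  apply: holo_ce => x; have [L dL] := hu x; eexists; apply: cder_comp dL _.
  exact: cder_logpoly.
apply: le_trans (hK _ _ (B2 * (e / 2 / (K * B2 + 1))) hd _ z zr) _.
  move=> x xr; rewrite normcM; apply: ler_pM; rewrite ?normc_ge0 ?hB2 //.
  by apply: hk; apply: (le_trans (ub _ xr)).
have -> : K * (B2 * (e / 2 / (K * B2 + 1))) = e / 2 * (K * B2 / (K * B2 + 1)).
  by field; rewrite gt_eqF.
by rewrite ler_piMr ?divr_ge0 ?(ltW e0) // ler_pdivrMr // mul1r lerDl.
Qed.

(** The argument of the function at 0 can be kept, by a small rotation. *)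
Lemma zero_free_transitive_arg G g (r e : R) : holo G -> holo g -> 0 <= r -> 0 < e ->
  exists G' n, [/\ holo G', (0 < n)%N, complex.Im (G' 0 - G 0) = 0,
    forall z, normc z <= r -> normc (G' z - G z) <= e &
    forall z, normc z <= r ->
      normc (iter n (PhiD Phi) (fun z => ce (G' z)) z - g z) <= e].
Proof.
move=> hG hg r0 e0; have [M M0 hM] := holo_bounded r hg.
have M1 : 0 < 1 + M by rewrite ltr_pwDl.
have [d d0 hd] := ce_lip R.
have [e1 [e10 e1d e1e]] : exists e1 : R, [/\ 0 < e1, e1 < d & 2 * e1 * (1 + M) <= e].
  exists (Num.min (d / 2) (e / (2 * (1 + M)))); split.
  - by rewrite lt_min !divr_gt0 // mulr_gt0.
  - by rewrite gt_min; apply/orP; left; lra.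
  - by rewrite mulrAC mulrC -ler_pdivlMr ?mulr_gt0 // ge_min lexx orbT.
have [G1 [n [hG1 n0 G1G G1g]]] := zero_free_transitive r hG hg e10.
pose th : C := - (0 +i* complex.Im (G1 0 - G 0)).
have thn : normc th <= e1.
  rewrite normc_opp /= expr0n add0r sqrtr_sqr; apply: (le_trans (normc_Im _)).
  by apply: G1G; rewrite normc0.
have th1 : normc (ce th) = 1 by rewrite normc_ce /= oppr0 expR0.
have h1 := holo_ce hG1.
exists (fun z => G1 z + th), n; split => //.
- by apply: holoD => //; apply: holo_cst.
- by rewrite addrAC; case: (G1 0 - G 0) @th {thn th1} => a b /=; rewrite subrr.
- move=> z zr; rewrite addrAC (le_trans (normcD _ _)) //.
  have := G1G z zr; nra.
- move=> z zr.
  have h0 := holo_cst (0 : C).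
  have lin a := iter_conv_lin Phi_holo Phi_sub n a h0 h1.
  have z0 : iter n (PhiD Phi) (fun=> 0) = fun=> 0.
    have := iter_conv_lin Phi_holo Phi_sub n (-1) h0 h0.
    under [X in iter n _ X]eq_fun do rewrite mulr0 addr0.
    by move=> ->; apply/funext => x; rewrite mulN1r subrr.
  have -> : (fun x => ce (G1 x + th)) = (fun x => 0 + ce th * ce (G1 x)).
    by apply/funext => x; rewrite add0r ceD mulrC.
  rewrite lin z0 add0r.
  set I := iter n _ _ z.
  have -> : ce th * I - g z = ce th * (I - g z) + (ce th - 1) * g z by ring.
  rewrite (le_trans (normcD _ _)) // !normcM th1 mul1r.
  have k1 := G1g z zr; have k2 := hM z zr.
  have k3 : normc (ce th - 1) <= 2 * e1.
    by apply: (le_trans (hd _ (le_lt_trans thn e1d))); rewrite ler_wpM2l.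
  have k4 : normc (ce th - 1) * normc (g z) <= 2 * e1 * M.
    by apply: ler_pM; rewrite ?normc_ge0.
  apply: (le_trans (lerD k1 k4)); lra.
Qed.

End ZeroFree.

(** * A Baire category argument *)

Section Baire.
Variable R : realType.
Local Notation C := R[i].
Local Notation fam := (nat -> C -> C).
Implicit Types (z w h : C) (g : fam) (O : fam -> Prop).

(** Logarithms of the generators.  Being real at 0 makes the generators
    positive there. *)
Definition admissible g := forall i, holo (g i) /\ complex.Im (g i 0) = 0.

(** Only the first [rho] functions are constrained: these are the basic
    neighbourhoods of the product topology. *)
Definition nearby (rho : nat) (dl : R) g g' := forall i z, (i < rho)%N ->
  normc z <= rho%:R -> normc (g' i z - g i z) <= dl.

(** The set [O] has a dense interior. *)
Definition fat O := forall g rho (dl : R), admissible g -> 0 < dl ->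
  exists g' rho' (dl' : R), [/\ admissible g', nearby rho dl g g', 0 < dl' &
    forall g'', admissible g'' -> nearby rho' dl' g' g'' -> O g''].

Lemma nearbyW rho rho' (dl dl' : R) g g' : (rho' <= rho)%N -> dl <= dl' ->
  nearby rho dl g g' -> nearby rho' dl' g g'.
Proof.
move=> rr dd h i z ir zr; apply: le_trans dd; apply: h; first exact: leq_trans rr.
by apply: (le_trans zr); rewrite ler_nat.
Qed.

(** Nested neighbourhoods, the [n]th one inside the interior of [O n], whose
    radii decrease geometrically; their centres converge, and the limit is
    entire by Weierstrass's theorem. *)
Lemma baire (O : nat -> fam -> Prop) : (forall n, fat (O n)) ->
  exists2 g, admissible g & forall n, O n g.
Proof.
move=> hO.
pose St := {x : fam * nat * R | admissible x.1.1 /\ 0 < x.2}.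
have step (nx : nat * St) : exists y : St,
   [/\ nearby (sval nx.2).1.2 ((sval nx.2).2 / 2) (sval nx.2).1.1 (sval y).1.1,
       ((sval nx.2).1.2 < (sval y).1.2)%N, (sval y).2 <= (sval nx.2).2 / 2 &
       forall g, admissible g -> nearby (sval y).1.2 (sval y).2 (sval y).1.1 g -> O nx.1 g].
  case: nx => n [[[g rho] dl] [/= ag d0]].
  have [g' [rho' [dl' [ag' gg' d'0 hg']]]] := hO n g rho (dl / 2) ag (divr_gt0 d0 (ltr0Sn R 1)).
  have d1 : 0 < Num.min dl' (dl / 2) by rewrite lt_min d'0 divr_gt0.
  exists (exist _ (g', maxn rho' rho.+1, Num.min dl' (dl / 2)) (conj ag' d1)); split => //=.
  - by rewrite leq_maxr.
  - by rewrite ge_min lexx orbT.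
  - move=> g'' ag'' h; apply: hg' => //; apply: nearbyW h; first exact: leq_maxl.
    by rewrite ge_min lexx.
have [nxt hnxt] := choice step.
have a0 : admissible (fun _ _ => 0) by move=> i; split; first exact: holo_cst.
pose st := fix st n : St := if n is m.+1 then nxt (m, st m)
  else exist _ ((fun _ _ => 0, 0%N), 1) (conj a0 ltr01).
pose g n := (sval (st n)).1.1; pose rho n := (sval (st n)).1.2; pose dl n := (sval (st n)).2.
have ag n : admissible (g n) by rewrite /g; case: (svalP (st n)).
have dl0 n : 0 < dl n by rewrite /dl; case: (svalP (st n)).
have gS n : nearby (rho n) (dl n / 2) (g n) (g n.+1) by case: (hnxt (n, st n)).
have rhoS n : (rho n < rho n.+1)%N by case: (hnxt (n, st n)).
have dlS n : dl n.+1 <= dl n / 2 by case: (hnxt (n, st n)).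
have gO n (h : fam) : admissible h -> nearby (rho n.+1) (dl n.+1) (g n.+1) h -> O n h.
  by case: (hnxt (n, st n)) => _ _ _ k; apply: k.
have rho_mono n k : (rho n <= rho (n + k))%N.
  elim: k => [|k IH]; first by rewrite addn0.
  by rewrite addnS (leq_trans IH) // ltnW.
have rho_ge n : (n <= rho n)%N by elim: n => // n IH; apply: leq_ltn_trans (rhoS n).
have dl_small n : dl n <= 1 / 2 ^+ n.
  elim: n => [|n IH]; first by rewrite expr0 divr1.
  apply: (le_trans (dlS n)); rewrite exprS; apply: (@le_trans _ _ (1 / 2 ^+ n / 2)).
    by rewrite ler_pM2r ?invr_gt0.
  by rewrite invfM mulrCA mulrC mulrA.
have gk n k i z : (i < rho n)%N -> normc z <= (rho n)%:R ->
    normc (g (n + k)%N i z - g n i z) <= dl n - dl (n + k)%N.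
  move=> ir zr; elim: k => [|k IH]; first by rewrite addn0 !subrr normc0.
  rewrite addnS (le_trans (normc_split (g (n + k)%N i z) _ _)) //.
  have h1 : normc (g (n + k).+1 i z - g (n + k)%N i z) <= dl (n + k)%N / 2.
    apply: gS; first exact: leq_trans (rho_mono n k).
    by apply: (le_trans zr); rewrite ler_nat.
  have k1 := dlS (n + k)%N; apply: le_trans (lerD h1 IH) _; lra.
have gk' n k i z : (i < rho n)%N -> normc z <= (rho n)%:R ->
    normc (g (n + k)%N i z - g n i z) <= dl n.
  by move=> ir zr; apply: le_trans (gk n k i z ir zr) _; rewrite gerBl ltW.
have idx i (z : C) : exists n, (i < rho n)%N /\ normc z <= (rho n)%:R.
  pose n := maxn i.+1 (Num.truncn (normc z)).+1; exists n; split.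
    by apply: leq_trans (rho_ge n); rewrite leq_maxl.
  apply: ltW; apply: lt_le_trans (Num.Theory.truncnS_gt _) _.
  by rewrite ler_nat (leq_trans _ (rho_ge n)) // leq_maxr.
have idx' i (z : C) m : exists n, [/\ (m <= n)%N, (i < rho n)%N & normc z <= (rho n)%:R].
  have [n [ir zr]] := idx i z; exists (n + m)%N; split; first exact: leq_addl.
    exact: leq_trans (rho_mono n m).
  by apply: (le_trans zr); rewrite ler_nat.
have lim i z : exists l, clim (fun n => g n i z) l.
  apply: ccauchy_lim => e e0; have [m hm] := half_pow_small 2 e0.
  have [n [mn ir zr]] := idx' i z m; exists n => a b na nb.
  have := gk' n (a - n)%N i z ir zr; have := gk' n (b - n)%N i z ir zr.
  rewrite !subnKC // normc_distC => k1 k2.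
  rewrite (le_trans (normc_split (g n i z) _ _)) //.
  have : dl n <= 1 / 2 ^+ m.
    apply: (le_trans (dl_small n)); rewrite ler_pM2l // lef_pV2 ?posrE ?exprn_gt0 //.
    by apply: ler_weXn2l => //; rewrite ler1n.
  have : 2 / 2 ^+ m = 2 * (1 / 2 ^+ m) :> R by rewrite mulrA mulr1.
  by move=> h1 h2; apply: (le_trans (lerD k2 k1)); lra.
have /choice [G hG] : forall i, exists f : C -> C, forall z, clim (fun n => g n i z) (f z).
  by move=> i; have /choice := lim i => -[f hf]; exists f.
have Gg n : nearby (rho n) (dl n) (g n) G.
  move=> i z ir zr; apply: clim_le (hG i z) _; exists n => m nm.
  by have := gk' n (m - n)%N i z ir zr; rewrite subnKC.
have aG : admissible G.
  move=> i; split.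
    apply: (holo_limit (F := fun n => g n i)) (hG i); first by move=> n; case: (ag n i).
    move=> r; have [N [ir rr]] := idx i (`|r|%:C).
    have {}rr : r <= (rho N)%:R.
      by apply: le_trans rr; rewrite normc_real normr_id ler_norm.
    have [M _ hM] := holo_bounded r (ag N i).1.
    exists N, (M + dl N) => n z Nn zr.
    have := gk' N (n - N)%N i z ir (le_trans zr rr); rewrite subnKC // => h.
    rewrite -(subrK (g N i z) (g n i z)) (le_trans (normcD _ _)) // addrC lerD //.
    exact: hM.
  apply/eqP; rewrite -normr_eq0 eq_le normr_ge0 andbT; apply/ler_addgt0Pr => e e0.
  rewrite add0r; have [N hN] := hG i 0 e e0.
  have [_ im0] := ag N i; have := hN N (leqnn _); apply: le_trans.
  rewrite normc_distC; apply: le_trans (normc_Im _).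
  by rewrite raddfB /= im0 subr0.
by exists G => // n; apply: gO.
Qed.

End Baire.

(** * Generic generators *)

Section Generators.
Variable R : realType.
Local Notation C := R[i].
Local Notation fam := (nat -> C -> C).
Implicit Types (z w h : C) (g : fam) (m : {poly int}) (q : seq (rat * rat)).

Definition comb m g z : C := \sum_(i < size m) (m`_i)%:~R * g i z.

Lemma comb_widen n m g z : (size m <= n)%N ->
  comb m g z = \sum_(i < n) (m`_i)%:~R * g i z.
Proof.
move=> mn; rewrite /comb (big_ord_widen n (fun i => (m`_i)%:~R * g i z)) //.
rewrite [RHS](bigID (fun i : 'I_n => (i < size m)%N)) /= [X in _ = _ + X]big1 ?addr0 // => i.
by rewrite -leqNgt => im; rewrite nth_default // mul0r.
Qed.

Lemma combD m1 m2 g z : comb (m1 + m2) g z = comb m1 g z + comb m2 g z.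
Proof.
pose n := maxn (size m1) (size m2).
rewrite (comb_widen (n := n) _ _ (size_polyD _ _)) (@comb_widen n m1) ?leq_maxl //.
rewrite (@comb_widen n m2) ?leq_maxr // -big_split; apply: eq_bigr => i _ /=.
by rewrite coefD intrD mulrDl.
Qed.

Lemma combN m g z : comb (- m) g z = - comb m g z.
Proof.
rewrite /comb size_polyN -sumrN; apply: eq_bigr => i _.
by rewrite coefN mulrNz mulNr.
Qed.

Lemma comb0 g z : comb 0 g z = 0.
Proof. by rewrite /comb size_poly0 big_ord0. Qed.

Lemma combXn k g z : comb 'X^k g z = g k z.
Proof.
rewrite /comb size_polyXn big_ord_recr /= coefXn eqxx mulr1z mul1r big1 ?add0r // => i _.
by rewrite coefXn ltn_eqF // mul0r.
Qed.

Lemma comb_holo m g : admissible g -> holo (comb m g).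
Proof.
move=> ag; apply: (holo_sum (F := fun i z => (m`_i)%:~R * g i z)) => i _.
by apply: holoZ; case: (ag i).
Qed.

Lemma Im_intM (a : int) z : complex.Im (a%:~R * z) = a%:~R * complex.Im z.
Proof.
by rewrite -(rmorph_int (real_complex R)); case: z => x y /=; rewrite mul0r addr0.
Qed.

Lemma comb_Im0 m g : admissible g -> complex.Im (comb m g 0) = 0.
Proof.
move=> ag; rewrite raddf_sum big1 // => i _.
by have [_ h] := ag i; apply: etrans (Im_intM _ _) _; rewrite h mulr0.
Qed.

Definition comb_weight m : R := \sum_(i < size m) normc ((m`_i)%:~R : C).

Lemma comb_weight_ge0 m : 0 <= comb_weight m.
Proof. by apply: sumr_ge0 => i _; apply: normc_ge0. Qed.

Lemma comb_near m g g' rho (dl : R) z : (size m <= rho)%N -> nearby rho dl g g' ->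
  normc z <= rho%:R -> normc (comb m g' z - comb m g z) <= comb_weight m * dl.
Proof.
move=> mr gg zr; rewrite -sumrB mulr_suml.
apply: (normc_sum_le (F := fun i => (m`_i)%:~R * g' i z - (m`_i)%:~R * g i z)
  (b := fun i => normc ((m`_i)%:~R : C) * dl)) => i im.
rewrite -mulrBr normcM ler_wpM2l ?normc_ge0 //.
by apply: gg => //; apply: leq_trans mr.
Qed.

(** Polynomials with coefficients in Q(i): countably many targets suffice. *)
Definition ratpoly q z : C :=
  \sum_(i < size q) ((ratr (nth (0, 0) q i).1) +i* (ratr (nth (0, 0) q i).2)) * z ^+ i.

Lemma ratpoly_holo q : holo (ratpoly q).
Proof.
apply: (holo_sum (F := fun i z => ((ratr (nth (0, 0) q i).1) +i* (ratr (nth (0, 0) q i).2)) * z ^+ i)) => i _.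
by apply/holoZ/holoX/holo_id.
Qed.

Lemma rat_approx (x e : R) : 0 < e -> exists a : rat, `|ratr a - x| <= e.
Proof.
move=> e0; have : x - e < x + e by lra.
move=> /rat_in_itvoo [a]; rewrite in_itv /= => /andP[h1 h2].
by exists a; rewrite ler_norml; lra.
Qed.

Lemma ratpoly_dense f (r e : R) : holo f -> 0 < e ->
  exists q, forall z, normc z <= r -> normc (ratpoly q z - f z) <= e.
Proof.
move=> hf e0; have e2 : 0 < e / 2 by rewrite divr_gt0.
have [N hN] := taylor_unif r hf e2.
pose r1 := `|r| + 1; have r11 : 1 <= r1 by rewrite lerDr.
have r10 : 0 < r1 := lt_le_trans ltr01 r11.
pose c i : C := dern i f 0 / i`!%:R.
pose d := e / 2 / (N.+1%:R * r1 ^+ N) / 2.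
have d0 : 0 < d by rewrite !divr_gt0 // mulr_gt0 // exprn_gt0.
have /choice [a ha] : forall i, exists p : rat * rat,
    normc ((ratr p.1) +i* (ratr p.2) - c i) <= 2 * d.
  move=> i; have [a ha] := rat_approx (complex.Re (c i)) d0.
  have [b hb] := rat_approx (complex.Im (c i)) d0; exists (a, b).
  rewrite (le_trans (normc_le_ReIm _)) // raddfB [complex.Im (_ - _)]raddfB /=; lra.
exists (mkseq a N) => z zr; have zr1 : normc z <= r1.
  by apply: (le_trans zr); have := ler_norm r; rewrite /r1; lra.
rewrite (le_trans (normc_split (\sum_(i < N) c i * z ^+ i) _ _)) // (splitr e) lerD ?hN //.
rewrite /ratpoly size_mkseq.
rewrite (eq_bigr (fun i : 'I_N => ((ratr (a i).1) +i* (ratr (a i).2)) * z ^+ i)); last first.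
  by move=> i _; rewrite nth_mkseq.
rewrite -sumrB.
have := @normc_mean_le R N (fun i => ((ratr (a i).1) +i* (ratr (a i).2)) * z ^+ i - c i * z ^+ i) (2 * d * r1 ^+ N).
move=> H; apply: le_trans (H _) _.
  move=> i iN; rewrite -mulrBl normcM normcX; apply: ler_pM => //; rewrite ?normc_ge0 ?exprn_ge0 ?normc_ge0 //.
  apply: (@le_trans _ _ (r1 ^+ i)); first by rewrite lerXn2r ?nnegrE ?normc_ge0 // ltW.
  by apply: ler_weXn2l => //; apply: ltnW.
have -> : N%:R * (2 * d * r1 ^+ N) = e / 2 * (N%:R / N.+1%:R).
  rewrite /d; field; rewrite expf_neq0 ?gt_eqF //= nat1r pnatr_eq0 //.
by rewrite ler_piMr ?(ltW e2) // ler_pdivrMr // mul1r ler_nat.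
Qed.

(** The first function that the given neighbourhood leaves unconstrained can be
    chosen freely; [ratpoly q] is shifted to be real at 0. *)
Lemma fat_dense q N : fat (fun g => exists j, forall z, normc z <= N%:R ->
  normc (g j z - (ratpoly q z - (0 +i* complex.Im (ratpoly q 0)))) <= N.+1%:R^-1).
Proof.
move=> g rho dl ag d0.
pose t z := ratpoly q z - (0 +i* complex.Im (ratpoly q 0)).
have N0 : 0 < N.+1%:R^-1 :> R by rewrite invr_gt0.
exists (fun i => if i == rho then t else g i), (maxn rho.+1 N), N.+1%:R^-1; split => //.
- move=> i; case: eqP => // _; split; first by apply: holoB; [apply: ratpoly_holo | apply: holo_cst].
  by rewrite /t raddfB /= subrr.
- by move=> i z ir _; rewrite (ltn_eqF ir) subrr normc0 ltW.
- move=> g' _ h; exists rho => z zN; have := h rho z.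
  rewrite eqxx; apply; first by rewrite leq_maxl.
  by apply: (le_trans zN); rewrite ler_nat leq_maxr.
Qed.

(** Adding dl (z / r)^(k+1) to [g K] changes it by at most [dl] on the disc of
    radius [r], but by dl 2^(k+1) at the point 2 r. *)
Lemma fat_growth K N : fat (fun g => exists z,
  N%:R * (1 + \sum_(i < K) normc (g i z)) < complex.Re (g K z)).
Proof.
move=> g rho dl ag d0; pose r : R := rho.+1%:R.
have r0 : 0 < r by rewrite ltr0n.
pose x : C := (2 * r)%:C.
pose T : R := N%:R * (1 + \sum_(i < K) normc (g i x)) + 1 - complex.Re (g K x).
have [k hk] := half_pow_small T d0.
have Tk : T < dl * 2 ^+ k.+1.
  have : T < dl * 2 ^+ k by rewrite -ltr_pdivrMr ?exprn_gt0.
  have : dl * 2 ^+ k <= dl * 2 ^+ k.+1 by rewrite ler_pM2l // exprS ler_peMl ?exprn_ge0 // ler1n.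
  lra.
pose p z : C := dl%:C * (z / r%:C) ^+ k.+1.
have hp : holo p by apply/holoZ/holoX; apply: holoM; [apply: holo_id | apply: holo_cst].
pose g' i := if i == K then (fun z => g K z + p z) else g i.
have ag' : admissible g'.
  move=> i; rewrite /g'; case: eqP => // _; have [hK imK] := ag K; split.
    exact: holoD.
  by rewrite raddfD /= imK /p mul0r exprS mul0r mulr0 /= add0r.
pose dl' : R := (2 * (N%:R * K%:R + 1))^-1.
have NK : 0 < N%:R * K%:R + 1 :> R by rewrite ltr_wpDl // mulr_ge0.
have d'0 : 0 < dl' by rewrite invr_gt0 mulr_gt0.
exists g', (maxn K.+1 (2 * rho.+1)), dl'; split => //.
  move=> i z _ zr; rewrite /g'; case: eqP => [->|_]; last by rewrite subrr normc0 ltW.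
  rewrite addrC addKr /p normcM normcX normcM normcV !normc_real (gtr0_norm d0) (gtr0_norm r0).
  rewrite ler_piMr ?(ltW d0) //; apply: exprn_ile1.
    by rewrite divr_ge0 ?normc_ge0 // ltW.
  by rewrite ler_pdivrMr // mul1r (le_trans zr) // ler_nat.
move=> g'' ag'' h; exists x.
have xr : normc x <= (maxn K.+1 (2 * rho.+1))%:R.
  rewrite normc_real ger0_norm ?mulr_ge0 ?(ltW r0) //.
  by rewrite -natrM ler_nat leq_maxr.
have hi i : (i <= K)%N -> normc (g'' i x - g' i x) <= dl'.
  by move=> iK; apply: h => //; rewrite leq_max ltnS iK.
have S1 : \sum_(i < K) normc (g'' i x) <= \sum_(i < K) normc (g i x) + K%:R * dl'.
  have -> : K%:R * dl' = \sum_(i < K) dl' by rewrite sumr_const card_ord mulr_natl.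
  rewrite -big_split; apply: ler_sum => i _ /=.
  have := hi i (ltnW (ltn_ord i)); rewrite /g' ltn_eqF // => k1.
  by have := normcD (g'' i x - g i x) (g i x); rewrite subrK; lra.
have := hi K (leqnn _); rewrite /g' eqxx => /(le_trans (normc_Re _)).
have px : p x = (dl * 2 ^+ k.+1)%:C.
  rewrite /p (_ : x / r%:C = 2%:C).
    by rewrite -rmorphXn -rmorphM.
  by rewrite /x rmorphM mulfK // -normc_gt0 normc_real gtr0_norm.
rewrite raddfB raddfD /= px /= ler_norml => /andP[k1 _].
have S2 : N%:R * (1 + \sum_(i < K) normc (g'' i x)) <= N%:R * (1 + \sum_(i < K) normc (g i x)) + N%:R * (K%:R * dl').
  by rewrite -mulrDr ler_wpM2l // -addrA lerD2l.
have k2 : (N%:R * K%:R + 1) * dl' = 1 / 2 by rewrite /dl'; field; rewrite gt_eqF.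
apply: (le_lt_trans S2).
move: Tk; rewrite /T; lra.
Qed.

Section Hypercyclic.
Variable Phi : C -> C.
Hypothesis Phi_holo : holo Phi.
Hypothesis Phi_sub : forall eps : R, 0 < eps -> exists2 A : R, 0 < A &
  forall z, normc (Phi z) <= A * expR (eps * normc z).
Hypothesis Phi_nc : ~ exists c, forall z, Phi z = c.

(** Transitivity asks for a small change of [comb m g], which can be realised
    on a single [g k] with nonzero exponent.  Afterwards [n] is fixed, and the
    continuity of the [n]th iterate leaves room for further small changes. *)
Lemma fat_hypercyclic m q N : m != 0 -> fat (fun g => exists2 n, (0 < n)%N &
  forall z, normc z <= N%:R ->
    normc (iter n (PhiD Phi) (fun z => ce (comb m g z)) z - ratpoly q z) <= N.+1%:R^-1).
Proof.
move=> m0 g rho dl ag d0; pose k := (size m).-1.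
have km : (k < size m)%N by rewrite prednK // lt0n size_poly_eq0.
have mk : ((m`_k)%:~R : C) != 0.
  by rewrite intr_eq0 -/(lead_coef m) lead_coef_eq0.
have mk0 : 0 < normc ((m`_k)%:~R : C) by rewrite normc_gt0.
have e1 : 0 < N.+1%:R^-1 / 2 :> R by rewrite divr_gt0 // invr_gt0.
pose r : R := (maxn rho N)%:R.
pose e := Num.min (dl * normc ((m`_k)%:~R : C)) (N.+1%:R^-1 / 2).
have e0 : 0 < e by rewrite lt_min e1 mulr_gt0.
have [G [n [hG n0 G0 Gg Gq]]] := zero_free_transitive_arg Phi_holo Phi_sub Phi_nc
  (comb_holo m ag) (ratpoly_holo q) (ler0n R _ : 0 <= r) e0.
pose p z := (m`_k)%:~R^-1 * (G z - comb m g z).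
pose g' i := if i == k then (fun z => g k z + p z) else g i.
have combg' z : comb m g' z = G z.
  have -> : comb m g' z = comb m g z + \sum_(i < size m) (if i == k :> nat then (m`_k)%:~R * p z else 0).
    rewrite -big_split; apply: eq_bigr => i _ /=; rewrite /g'.
    by case: eqP => [->|_]; rewrite ?mulrDr ?addr0.
  rewrite -big_mkcond (big_pred1 (Ordinal km)) => [|i] //=.
  by rewrite /p mulVKf // addrC subrK.
have ag' : admissible g'.
  move=> i; rewrite /g'; case: eqP => // _; have [hk imk] := ag k; split.
    by apply: holoD => //; apply/holoZ/holoB => //; apply: comb_holo.
  rewrite raddfD /= imk add0r /p -(rmorph_int (real_complex R)) -fmorphV.
  by move: G0; case: (G 0 - comb m g 0) => a b /= ->; rewrite mulr0 mul0r addr0.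
have hcG := holo_ce hG.
have [K K0 hK] := iter_conv_bound Phi_holo Phi_sub n (ltr01 : (0 : R) < 1).
have [M M0 hM] := holo_bounded (N%:R + 1) hcG.
have [d dd0 hd] := ce_lip R.
pose W := comb_weight m + 1.
have W0 : 0 < W by rewrite ltr_wpDl ?comb_weight_ge0.
have KM : 0 < K * M + 1 by rewrite ltr_wpDl // mulr_ge0.
have [dl' [d'0 d'1 d'2]] : exists dl' : R, [/\ 0 < dl', W * dl' < d &
    (K * M + 1) * (2 * (W * dl')) <= N.+1%:R^-1 / 2].
  exists (Num.min (d / 2) (N.+1%:R^-1 / 2 / (2 * (K * M + 1))) / W); split.
  - by rewrite divr_gt0 // lt_min !divr_gt0 // mulr_gt0.
  - rewrite mulrC mulfVK ?gt_eqF // gt_min; apply/orP; left; lra.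
  - rewrite [W * _]mulrC mulfVK ?gt_eqF // mulrA mulrC [_ * 2]mulrC -ler_pdivlMr ?mulr_gt0 //.
    by rewrite ge_min lexx orbT.
exists g', (maxn (size m) N.+1), dl'; split => //.
  move=> i z ir zr; rewrite /g'; case: eqP => [->|_]; last by rewrite subrr normc0 ltW.
  rewrite addrC addKr /p normcM normcV mulrC ler_pdivrMr //.
  have zr' : normc z <= r by apply: (le_trans zr); rewrite ler_nat leq_maxl.
  by apply: (le_trans (Gg z zr')); rewrite ge_min lexx.
move=> g'' ag'' h; exists n => // z zN.
have hc'' := holo_ce (comb_holo m ag'').
rewrite (le_trans (normc_split (iter n (PhiD Phi) (fun z => ce (G z)) z) _ _)) //.
rewrite (splitr N.+1%:R^-1) lerD //; last first.
  have zr : normc z <= r by apply: (le_trans zN); rewrite ler_nat leq_maxr.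
  by apply: (le_trans (Gq z zr)); rewrite ge_min lexx orbT.
have := iter_conv_lin Phi_holo Phi_sub n (-1) hc'' hcG => /(congr1 (fun f => f z)).
rewrite mulN1r => <-.
have hdiff : holo (fun x => ce (comb m g'' x) + -1 * ce (G x)).
  by apply: holoD => //; apply: holoZ.
apply: le_trans (hK _ _ (M * (2 * (W * dl'))) hdiff _ z zN) _.
  move=> x xN; rewrite mulN1r.
  have -> : ce (comb m g'' x) - ce (G x) = ce (G x) * (ce (comb m g'' x - G x) - 1).
    by rewrite mulrBr mulr1 -ceD [G x + _]addrC subrK.
  rewrite normcM; apply: ler_pM; rewrite ?normc_ge0 ?hM //.
  have cl : normc (comb m g'' x - G x) <= W * dl'.
    rewrite -combg'; apply: (@le_trans _ _ (comb_weight m * dl')).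
      apply: (comb_near (rho := maxn (size m) N.+1)) => //; first exact: leq_maxl.
      by apply: (le_trans xN); rewrite natr1 ler_nat leq_maxr.
    by rewrite ler_wpM2r ?(ltW d'0) // lerDl.
  apply: (le_trans (hd _ (le_lt_trans cl d'1))).
  by rewrite ler_wpM2l.
apply: le_trans d'2; rewrite [leLHS]mulrA ler_wpM2r ?lerDl //.
by rewrite !mulr_ge0 ?(ltW W0) ?(ltW d'0).
Qed.

Lemma generators_exist : exists g, [/\ admissible g,
  forall m q N, m != 0 -> exists2 n, (0 < n)%N & forall z, normc z <= N%:R ->
    normc (iter n (PhiD Phi) (fun z => ce (comb m g z)) z - ratpoly q z) <= N.+1%:R^-1,
  forall q N, exists j, forall z, normc z <= N%:R ->
    normc (g j z - (ratpoly q z - (0 +i* complex.Im (ratpoly q 0)))) <= N.+1%:R^-1 &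
  forall K N, exists z, N%:R * (1 + \sum_(i < K) normc (g i z)) < complex.Re (g K z)].
Proof.
pose I := (({poly int} * seq (rat * rat) * nat) + (seq (rat * rat) * nat) + (nat * nat))%type.
pose O (i : I) (g : fam) : Prop := match i with
  | inl (inl (m, q, N)) => m != 0 -> exists2 n, (0 < n)%N & forall z, normc z <= N%:R ->
    normc (iter n (PhiD Phi) (fun z => ce (comb m g z)) z - ratpoly q z) <= N.+1%:R^-1
  | inl (inr (q, N)) => exists j, forall z, normc z <= N%:R ->
    normc (g j z - (ratpoly q z - (0 +i* complex.Im (ratpoly q 0)))) <= N.+1%:R^-1
  | inr (K, N) => exists z, N%:R * (1 + \sum_(i < K) normc (g i z)) < complex.Re (g K z)
  end.
have fatT (P : fam -> Prop) : (forall g, P g) -> fat P.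
  move=> hP g rho dl ag d0; exists g, 0%N, 1; split => //.
  by move=> i z _ _; rewrite subrr normc0 ltW.
have fO i : fat (O i).
  case: i => [[[[m q] N]|[q N]]|[K N]].
  - have [->|m0] := eqVneq m 0; first by apply: fatT => g; rewrite /O eqxx.
    move=> g rho dl ag d0; have [g' [rho' [dl' [a b c h]]]] := @fat_hypercyclic m q N m0 g rho dl ag d0.
    by exists g', rho', dl'; split => // g'' ag'' n'' _; apply: h.
  - exact: fat_dense.
  - exact: fat_growth.
pose O' n g := if (unpickle n : option I) is Some i then O i g else True.
have [|g ag hg] := @baire R O'.
  by move=> n; rewrite /O'; case: unpickle => [i|]; [exact: fO | exact: fatT].
have hO i : O i g by have := hg (pickle i); rewrite /O' pickleK.
exists g; split => //.
- by move=> m q N m0; apply: (hO (inl (inl (m, q, N)))).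
- by move=> q N; apply: (hO (inl (inr (q, N)))).
- by move=> K N; apply: (hO (inr (K, N))).
Qed.

End Hypercyclic.
End Generators.

(** * Growth, and finite generation *)

Section Growth.
Variable R : realType.
Local Notation C := R[i].
Variable g : nat -> C -> C.
Hypothesis ag : admissible g.
Hypothesis g_growth : forall K N, exists z,
  N%:R * (1 + \sum_(i < K) normc (g i z)) < complex.Re (g K z).

Let S K z : R := \sum_(i < K) normc (g i z).

Let S_ge0 K z : 0 <= S K z.
Proof. by apply: sumr_ge0 => i _; apply: normc_ge0. Qed.

(** The entire functions of growth at most that of the exponentials of
    combinations of the first [K] functions.  They form an algebra, to which
    e^(g K) does not belong: so neither the group nor the algebra generated by
    the e^(g i) is generated by finitely many elements. *)
Definition growth_class K : set (CC R -> CC R) :=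
  [set u | holo (u : C -> C) /\ exists2 A : R, 0 <= A &
     forall z : C, normc (u z : C) <= A * expR (A * S K z)].

Lemma growth_weaken (A B s : R) : 0 <= A -> A <= B -> 0 <= s ->
  A * expR (A * s) <= B * expR (B * s).
Proof.
by move=> A0 AB s0; apply: ler_pM; rewrite ?expR_ge0 // ler_expR ler_wpM2r.
Qed.

Lemma growth_classS K L : (K <= L)%N -> growth_class K `<=` growth_class L.
Proof.
move=> KL u [hu [A A0 hA]]; split => //; exists A => // z; apply: (le_trans (hA z)).
rewrite ler_wpM2l // ler_expR ler_wpM2l // /S.
rewrite (big_ord_widen L (fun i => normc (g i z)) KL) big_mkcond.
by apply: ler_sum => i _; case: ifP => // _; apply: normc_ge0.
Qed.

Lemma growth_class_comb (m : {poly int}) K : (size m <= K)%N -> growth_class K (fun z => ce (comb m g z)).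
Proof.
move=> mK; split; first exact/holo_ce/comb_holo.
pose W := comb_weight R m + 1; have W0 : 0 <= W by rewrite addr_ge0 ?comb_weight_ge0.
exists W => // z; apply: (le_trans (normc_ce_le _)).
rewrite -[leLHS]mul1r; apply: ler_pM => //; rewrite ?expR_ge0 //.
  by rewrite lerDr comb_weight_ge0.
rewrite ler_expR (comb_widen _ _ mK).
apply: (le_trans (normc_sum_le (F := fun i => (m`_i)%:~R * g i z) (b := fun i => W * normc (g i z)) _)).
  move=> i iK; rewrite normcM ler_wpM2r ?normc_ge0 //.
  have [im|im] := ltnP i (size m); last by rewrite nth_default // normc0.
  rewrite /W /comb_weight (bigD1 (Ordinal im)) //= -addrA lerDl addr_ge0 //.
  by apply: sumr_ge0 => j _; apply: normc_ge0.
by rewrite -mulr_sumr.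
Qed.

Lemma growth_class_subalgebra K : subalgebra (growth_class K).
Proof.
split.
- by move=> u [hu _]; apply/entireE.
- split; first exact: holo_cst.
  by exists 0 => // z; rewrite mul0r normc0.
- move=> c u v [hu [A A0 hA]] [hv [B B0 hB]]; split.
    by apply: holoD => //; apply: holoZ.
  pose D := (normc (c : C) + 1) * A + B.
  have AD : A <= D by rewrite /D; have := normc_ge0 (c : C); nra.
  have cA0 : 0 <= normc (c : C) * A by rewrite mulr_ge0 ?normc_ge0.
  have D0 : 0 <= D by rewrite /D; lra.
  exists D => // z; apply: (@le_trans _ _ (normc (c : C) * normc (u z : C) + normc (v z : C))).
    by rewrite -normcM; apply: normcD.
  have k1 : normc (u z : C) <= A * expR (D * S K z).
    by apply: (le_trans (hA z)); rewrite ler_wpM2l // ler_expR ler_wpM2r.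
  have k2 : normc (v z : C) <= B * expR (D * S K z).
    apply: (le_trans (hB z)); rewrite ler_wpM2l // ler_expR ler_wpM2r // /D; nra.
  have k3 : normc (c : C) * normc (u z : C) <= normc (c : C) * (A * expR (D * S K z)).
    by rewrite ler_wpM2l ?normc_ge0.
  have E0 : 0 <= A * expR (D * S K z) by rewrite mulr_ge0 ?expR_ge0.
  apply: (le_trans (lerD k3 k2)); rewrite /D; lra.
- move=> u v [hu [A A0 hA]] [hv [B B0 hB]]; split; first exact: holoM.
  pose D := A * B + A + B.
  have AB0 : 0 <= A * B by rewrite mulr_ge0.
  exists D => [|z]; first by rewrite !addr_ge0.
  apply: (@le_trans _ _ (normc (u z : C) * normc (v z : C))); first by rewrite -normcM.
  apply: (@le_trans _ _ ((A * expR (A * S K z)) * (B * expR (B * S K z)))).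
    by apply: ler_pM; rewrite ?normc_ge0.
  rewrite mulrACA -expRD -mulrDl; apply: ler_pM; rewrite ?expR_ge0 //.
    by rewrite /D; lra.
  by rewrite ler_expR ler_wpM2r // /D; lra.
Qed.

Lemma growth_class_out K : ~ growth_class K (fun z => ce (g K z)).
Proof.
move=> [_ [A A0 hA]]; have [N [AN _]] := nat_large A (ltr01 : (0 : R) < 1).
have [z hz] := g_growth K N; have := hA z; apply/negP; rewrite -ltNge normc_ce.
apply: le_lt_trans (growth_weaken A0 AN (S_ge0 K z)) _.
have : expR (N%:R * (1 + S K z)) < expR (complex.Re (g K z)) by rewrite ltr_expR.
apply: le_lt_trans; rewrite mulrDr mulr1 expRD ler_wpM2r ?expR_ge0 //.
by apply: le_trans (expR_ge1Dx _); rewrite lerDr.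
Qed.

Definition gen_group : set (CC R -> CC R) :=
  [set f | exists m, f = (fun z => ce (comb m g z))].

Let comb_inv m z : ce (comb m g z) * ce (comb (- m) g z) = 1.
Proof. by rewrite combN ceN mulfV // ce_neq0. Qed.

Lemma gen_group_mul : mul_group gen_group.
Proof.
split.
- by exists 0; apply/funext => z; rewrite comb0 ce0.
- move=> _ _ [m1 ->] [m2 ->]; exists (m1 + m2); apply/funext => z.
  by rewrite combD ceD.
- move=> _ [m ->]; exists (fun z => ce (comb (- m) g z)); first by exists (- m).
  by apply/funext => z; apply: comb_inv.
Qed.

Lemma gen_group_gen K : gen_group (fun z => ce (g K z)).
Proof. by exists 'X^K; apply/funext => z; rewrite combXn. Qed.

Lemma finite_growth (P : nat -> set (CC R -> CC R)) (T : set (CC R -> CC R)) :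
  (forall K L, (K <= L)%N -> P K `<=` P L) -> finite_set T ->
  (forall f, T f -> exists K, P K f) -> exists K, T `<=` P K.
Proof.
move=> Pmono /finite_seqP [s ->]; elim: s => [|f s IH] hs.
  by exists 0%N => f; rewrite /= in_nil.
have [|K hK] := IH; first by move=> h hin; apply: hs; rewrite /= inE hin orbT.
have [|L hL] := hs f; first by rewrite /= inE eqxx.
exists (maxn K L) => h; rewrite /= inE => /orP[/eqP ->|hin].
  by apply: Pmono hL; exact: leq_maxr.
by apply: Pmono (hK h hin); exact: leq_maxl.
Qed.

Lemma gen_algebra_not_fg : ~ algebra_fg (gen_algebra gen_group).
Proof.
move=> [T [fT TG GT]].
have sub : gen_algebra gen_group `<=` [set u | exists K, growth_class K u].
  apply: smallest_sub.
    split.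
    - by move=> u [K]; case: (growth_class_subalgebra K) => s _ _ _; apply: s.
    - by exists 0%N; case: (growth_class_subalgebra 0%N).
    - move=> c u v [K hu] [L hv]; exists (maxn K L).
      case: (growth_class_subalgebra (maxn K L)) => _ _ lin _; apply: lin.
        by apply: growth_classS hu; exact: leq_maxl.
      by apply: growth_classS hv; exact: leq_maxr.
    - move=> u v [K hu] [L hv]; exists (maxn K L).
      case: (growth_class_subalgebra (maxn K L)) => _ _ _; apply.
        by apply: growth_classS hu; exact: leq_maxl.
      by apply: growth_classS hv; exact: leq_maxr.
  by move=> _ [m ->]; exists (size m); apply: growth_class_comb.
have [K hK] := finite_growth growth_classS fT (fun f Tf => sub f (TG f Tf)).
have sub2 : gen_algebra T `<=` growth_class K.
  by apply: smallest_sub => //; apply: growth_class_subalgebra.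
apply: (growth_class_out (K := K)); apply: sub2; rewrite -GT.
exact: sub_smallest (gen_group_gen K).
Qed.

Lemma gen_group_not_fg : ~ group_fg gen_group.
Proof.
move=> [T [fT TG GT]].
pose U K : set (CC R -> CC R) := [set f | growth_class K f /\
  exists2 h, growth_class K h & f * h = cst 1].
have Umono K L : (K <= L)%N -> U K `<=` U L.
  move=> KL f [hf [h hh fh]]; split; first exact: growth_classS hf.
  by exists h => //; apply: growth_classS hh.
have Ucomb (m : {poly int}) : U (size m) (fun z => ce (comb m g z)).
  split; first exact: growth_class_comb.
  exists (fun z => ce (comb (- m) g z)); first by apply: growth_class_comb; rewrite size_polyN.
  by apply/funext => z; apply: comb_inv.
have [|K hK] := finite_growth Umono fT.
  by move=> f /TG [m ->]; exists (size m); apply: Ucomb.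
have UG : mul_group (U K).
  have [_ hz lin mul] := growth_class_subalgebra K.
  have one1 : (cst 1 : CC R -> CC R) * cst 1 = cst 1.
    by apply/funext => z; rewrite /= -[RHS]mulr1.
  have B1 : growth_class K (cst 1).
    by have := @growth_class_comb 0 K; rewrite size_poly0 => /(_ isT); congr growth_class;
      apply/funext => z; rewrite comb0 ce0.
  split.
  - by split => //; exists (cst 1).
  - move=> u v [hu [u' hu' uu']] [hv [v' hv' vv']]; split; first exact: mul.
    by exists (u' * v'); [exact: mul | rewrite mulrACA uu' vv'].
  - move=> u [hu [u' hu' uu']]; exists u' => //; split => //; exists u => //.
    by rewrite mulrC.
have sub : gen_group `<=` U K by rewrite {1}GT; apply: smallest_sub.
by have [/growth_class_out] := sub _ (gen_group_gen K).
Qed.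

End Growth.

Section Conclusion.
Variable R : realType.
Local Notation C := R[i].
Variable g : nat -> C -> C.
Hypothesis ag : admissible g.

Lemma gen_group_entire : gen_group g `<=` @entire R.
Proof. by move=> _ [m ->]; apply/entireE/holo_ce/comb_holo. Qed.

Lemma gen_group_expH : gen_group g `<=` @expH_pos0 R.
Proof.
move=> _ [m ->]; split.
  by exists (comb m g : CC R -> CC R) => //; apply/entireE/comb_holo.
rewrite /ce comb_Im0 // cos0 sin0 mulr1 mulr0.
by rewrite ltcE /= eqxx expR_gt0.
Qed.

Lemma gen_group_hypercyclic (Phi : C -> C) : holo Phi ->
  (forall m q N, m != 0 -> exists2 n, (0 < n)%N & forall z, normc z <= N%:R ->
    normc (iter n (PhiD Phi) (fun z => ce (comb m g z)) z - ratpoly q z) <= N.+1%:R^-1) ->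
  forall f, gen_group g f -> f <> cst 1 -> hypercyclic (conv_op (Phi : CC R -> CC R)) f.
Proof.
move=> hPhi hg f Gf f1; split; first exact: gen_group_entire.
case: Gf f1 => m -> f1 h /entireE hh; apply: closure_compact => r e e0.
have m0 : m != 0.
  apply/eqP => m0; apply: f1; apply/funext => z.
  by rewrite m0 comb0 ce0.
have e2 : 0 < e / 2 by rewrite divr_gt0.
have [q hq] := ratpoly_dense r hh e2; have [N [rN Ne]] := nat_large r e2.
have [n n0 hn] := hg m q N m0.
exists (iter n (PhiD Phi) (fun z => ce (comb m g z))); first by exists n.
move=> z zr; rewrite (le_trans (normc_split (ratpoly q z) _ _)) // (splitr e).
by rewrite lerD ?hq //; apply: le_trans Ne; apply: hn; apply: le_trans rN.
Qed.

(** If e^w > 0 then sin (Im w) = 0 and cos (Im w) = 1, so subtracting i Im w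
    from a logarithm with value w at 0 does not change its exponential. *)
Lemma real_log_at0 f : @expH_pos0 R f -> exists h : C -> C,
  [/\ holo h, complex.Im (h 0) = 0 & f = (fun z => ce (h z))].
Proof.
move=> [[h /entireE hh ->]]; rewrite /comp /cexp ltcE /= => /andP[/eqP s0 c0].
set a := complex.Re (h 0) in s0 c0; set b := complex.Im (h 0) in s0 c0.
have E0 : expR a != 0 by rewrite gt_eqF // expR_gt0.
have sb : sin b = 0 by apply: (mulfI E0); rewrite s0 mulr0.
have cb : 0 < cos b by rewrite -(pmulr_rgt0 _ (expR_gt0 a)).
have cb1 : cos b = 1.
  have := cos2Dsin2 b; rewrite sb expr0n addr0 => /eqP.
  by rewrite sqrf_eq1 => /orP[/eqP //|/eqP k]; move: cb; rewrite k; lra.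
exists (fun z => h z - 0 +i* b); split.
- by apply: holoB => //; apply: holo_cst.
- by rewrite raddfB /= subrr.
- apply/funext => z; rewrite ceB.
  have -> : ce (0 +i* b) = 1 by rewrite /ce /= expR0 cb1 sb !mul1r.
  by rewrite divr1.
Qed.

Lemma gen_group_dense :
  (forall q N, exists j, forall z, normc z <= N%:R ->
    normc (g j z - (ratpoly q z - (0 +i* complex.Im (ratpoly q 0)))) <= N.+1%:R^-1) ->
  dense_in (@expH_pos0 R) (gen_group g).
Proof.
move=> hg f /real_log_at0 [h [hh h0 ->]]; apply: closure_compact => r e e0.
pose r1 := `|r|; have rr1 : r <= r1 by exact: ler_norm.
have [M M0 hM] := holo_bounded r1 (holo_ce hh).
have [d d0 hd] := ce_lip R.
have M1 : 0 < M + 1 by rewrite ltr_wpDl.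
have [k [k0 kd ke]] : exists k : R, [/\ 0 < k, 3 * k < d & M * (2 * (3 * k)) <= e].
  exists (Num.min (d / 6) (e / (6 * (M + 1)))); split.
  - by rewrite lt_min !divr_gt0 // mulr_gt0.
  - have : Num.min (d / 6) (e / (6 * (M + 1))) <= d / 6 by rewrite ge_min lexx.
    lra.
  - set k := Num.min _ _; have : k <= e / (6 * (M + 1)) by rewrite ge_min lexx orbT.
    rewrite ler_pdivlMr ?mulr_gt0 // => kk.
    have k0 : 0 <= k by rewrite le_min !divr_ge0 ?mulr_ge0 ?ltW.
    nra.
have [q hq] := ratpoly_dense r1 hh k0; have [N [rN Nk]] := nat_large r1 k0.
have [j hj] := hg q N; exists (fun z => ce (g j z)); first exact: gen_group_gen.
move=> z zr; have zr1 := le_trans zr rr1.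
have q0 : normc (0 +i* complex.Im (ratpoly q 0)) <= k.
  rewrite /= expr0n add0r sqrtr_sqr.
  have -> : complex.Im (ratpoly q 0) = complex.Im (ratpoly q 0 - h 0) by rewrite raddfB /= h0 subr0.
  apply: (le_trans (normc_Im _)); apply: hq; rewrite normc0; exact: normr_ge0.
have gh : normc (g j z - h z) <= 3 * k.
  have k1 := hj z (le_trans zr1 rN); have k2 := hq z zr1.
  have := normc_split (ratpoly q z - (0 +i* complex.Im (ratpoly q 0))) (g j z) (h z).
  have := normcB (ratpoly q z - h z) (0 +i* complex.Im (ratpoly q 0)).
  rewrite [ratpoly q z - h z - _]addrAC => a b; apply: (le_trans b).
  have -> : 3 * k = k + (k + k) by ring.
  exact: lerD (le_trans k1 Nk) (le_trans a (lerD k2 q0)).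
have -> : ce (g j z) - ce (h z) = ce (h z) * (ce (g j z - h z) - 1).
  by rewrite mulrBr mulr1 -ceD [h z + _]addrC subrK.
rewrite normcM; apply: le_trans ke; apply: ler_pM; rewrite ?normc_ge0 ?hM //.
apply: (le_trans (hd _ (le_lt_trans gh kd))); by rewrite ler_wpM2l.
Qed.

End Conclusion.

Theorem theorem3p3 (R : realType) (Phi : CC R -> CC R)
    (Phi_entire : entire Phi)
    (Phi_nonconstant : ~ exists c : CC R, Phi = cst c)
    (Phi_subexp : subexponential_type Phi) :
  exists G : set (CC R -> CC R),
    [/\ mul_group G,
        G `<=` @entire R,
        ~ group_fg G &
        forall f, G f -> f <> cst 1 -> hypercyclic (conv_op Phi) f] /\
    [/\ G `<=` @expH_pos0 R,
        dense_in (@expH_pos0 R) G &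
        ~ algebra_fg (gen_algebra G)].
Proof.
have hPhi : holo (Phi : R[i] -> R[i]) by exact/entireE.
have nPhi : ~ exists c, forall z, (Phi : R[i] -> R[i]) z = c.
  by move=> [c hc]; apply: Phi_nonconstant; exists c; apply/funext.
have [g [ag hyp dns gro]] := generators_exist hPhi Phi_subexp nPhi.
exists (gen_group g); split; split.
- exact: gen_group_mul.
- exact: gen_group_entire.
- exact: gen_group_not_fg.
- exact: gen_group_hypercyclic.
- exact: gen_group_expH.
- exact: gen_group_dense.
- exact: gen_algebra_not_fg.
Qed.
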